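(* Let $d\in\{2,3,\dots\}\cup\{\infty\}$, $\lambda=\frac{d-2}{2}$, and let $$K(x,y)=\sum_{n=0}^\infty\alpha_n^d(\|x\|,\|y\|)\,\hat C_n^\lambda\Bigl(\Bigl\langle\tfrac{x}{\|x\|},\tfrac{y}{\|y\|}\Bigr\rangle\Bigr),\qquad x,y\in\mathbb{R}^d,$$ be a real-valued, isotropic, continuous positive definite kernel, with the unique associated kernels $\alpha_n^d$ on $[0,\infty)$ described in the context. A centered Gaussian random function $\mathbf{f}$ with continuous covariance $K$ may be represented as $$\mathbf{f}(x):=\sum_{n=0}^\infty\mathbf{f}_n(x),$$ using independent Gaussian random functions $\mathbf{f}_n$ explicitly defined below, where the series converges for every $x\in\mathbb{R}^d$ both in $L^2(\Omega)$ and almost surely. 1. Case $d=\infty$: Let $\mathbf{g}_0$ be a real-valued, centered Gaussian random function on $[0,\infty)$ with covariance kernel $\alpha_0^\infty$, and let $\mathbf{g}_n^{i_1,\dots,i_n}$ with $i_j\in\mathbb{N}$ be real-valued, centered, independent Gaussian random functions on $[0,\infty)$ with covariance kernel $\alpha_n^\infty$. Then define $$\mathbf{f}_n(x):=\sum_{i_1,\dots,i_n=1}^\infty \mathbf{g}_n^{i_1,\dots,i_n}(\|x\|)\,\hat x_{i_1}\cdots\hat x_{i_n},\qquad \mathbf{f}_0(x):=\mathbf{g}_0(\|x\|),$$ where $\hat x:=x/\|x\|$ for $x\neq0$ and $\hat 0:=0$. The series defining $\mathbf{f}_n(x)$ converges in $L^2(\Omega)$ and almost surely for each $x\in\ell^2$.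 2. Case $d<\infty$: Let $Y_{n,k}$, $k\in\{1,\dots,N_n^d\}$, be an orthonormal basis of the space of spherical harmonics of degree $n$ on $\mathbb{S}^{d-1}$, where $N_n^d$ is the dimension of this space, and for $k\in\{1,\dots,N_n^d\}$ let $\mathbf{g}_n^k$ be real-valued, centered, independent Gaussian random functions on $[0,\infty)$ with covariance kernel $\alpha_n^d$. Then define $\mathbf{f}_0(x):=\mathbf{g}_0^1(\|x\|)$ and, for $n\ge1$, $\mathbf{f}_n(0):=0$ and $$\mathbf{f}_n(x):=\frac{1}{\sqrt{N_n^d}}\sum_{k=1}^{N_n^d}\mathbf{g}_n^k(\|x\|)\,Y_{n,k}\bigl(\tfrac{x}{\|x\|}\bigr),\qquad x\in\mathbb{R}^d\setminus\{0\}.$$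
   Context: For $d=\infty$, $\mathbb{R}^\infty:=\ell^2$ is the real Hilbert space of square summable real sequences. $O(d)$ is the group of linear isometries of $\mathbb{R}^d$. A positive definite kernel on a set $X$ is a function $K\colon X\times X\to\mathbb{C}$ such that $\sum_{i,j=1}^m c_i\overline{c_j}K(x_i,x_j)\ge 0$ for all $m\in\mathbb{N}$, $x_1,\dots,x_m\in X$, $c\in\mathbb{C}^m$; it is isotropic (for $X=\mathbb{R}^d$) if $K(Ux,Uy)=K(x,y)$ for all $U\in O(d)$ and all $x,y$. A (centered) Gaussian random function on a set $X$ is a family of random variables indexed by $X$, on a probability space $\Omega$, all of whose finite-dimensional marginals are (centered) Gaussian; it has covariance $K$ if $\operatorname{Cov}(\mathbf{f}(x),\mathbf{f}(y))=K(x,y)$ for all $x,y\in X$. Normalized Gegenbauer polynomials: for $0<\lambda<\infty$, $\hat C_n^\lambda(t)=C_n^\lambda(t)/C_n^\lambda(1)$ where $\sum_{n\ge0}z^nC_n^\lambda(t)=(1-2tz+z^2)^{-\lambda}$ ($|z|<1$, $t\in[-1,1]$); for $\lambda=0$, $\hat C_n^0=T_n$ with $T_n(\cos\theta)=\cos(n\theta)$ (Chebyshev polynomials); for $\lambda=\infty$, $\hat C_n^\infty(t)=t^n$ (with $0^0=1$). Associated kernels $\alpha_n^d$: every continuous isotropic positive definite kernel $K$ on $\mathbb{R}^d$ can be written as $K(x,y)=\sum_{n=0}^\infty\alpha_n^d(\|x\|,\|y\|)\,\hat C_n^\lambda(\langle\frac{x}{\|x\|},\frac{y}{\|y\|}\rangle)$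 for $x,y\neq0$, and $K(x,y)=\alpha_0^d(\|x\|,\|y\|)$ if $x=0$ or $y=0$ (this is how the series in the claim is read at the origin), where $\alpha_n^d\colon[0,\infty)^2\to\mathbb{C}$ are unique, continuous, positive definite kernels with the properties: (a) for every $r\ge0$ there is a neighborhood $U_r\subset[0,\infty)$ of $r$ with $\sup_{s\in U_r}\sum_{n\ge N}\alpha_n^d(s,s)\to0$ as $N\to\infty$; (b) $\alpha_n^d(r,0)=\alpha_n^d(0,r)=0$ for all $n\ge1$, $r\ge0$. They are real-valued if and only if $K$ is. Spherical harmonics of degree $n$ on the unit sphere $\mathbb{S}^{d-1}\subset\mathbb{R}^d$ are the restrictions to $\mathbb{S}^{d-1}$ of (complex-coefficient) harmonic homogeneous polynomials of degree $n$ in $d$ variables. Orthonormality is with respect to the inner product $\langle f,g\rangle=\frac{1}{|\mathbb{S}^{d-1}|}\int_{\mathbb{S}^{d-1}}f\overline{g}\,d\sigma$, with $\sigma$ the surface measure and $|\mathbb{S}^{d-1}|$ its total mass. *)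

(* Defs.v *)
From HB Require Import structures.
From mathcomp Require Import all_boot all_order all_algebra.
From mathcomp Require Import finmap.
From mathcomp Require Import all_classical all_reals all_analysis.
From mathcomp Require Import measurable_realfun complex.
From mathcomp Require Import ring lra.
From mathcomp Require Import (canonicals, coercions) mpoly.
Set Implicit Arguments.
Unset Strict Implicit.
Unset Printing Implicit Defensive.
Import Order.TTheory GRing.Theory Num.Theory.
Import numFieldNormedType.Exports.
Local Open Scope classical_set_scope.
Local Open Scope complex_scope.
Local Open Scope ring_scope.

Section SquareSummable.
Variable R : realType.
Implicit Types (x y : nat -> R).

Definition square_summable : pred (nat -> R) :=
  fun x => `[< cvgn (series (fun k => x k ^+ 2)) >].

Record l2 := L2 { l2_seq :> nat -> R ; _ : square_summable l2_seq }.

HB.instance Definition _ := [isSub for l2_seq].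
HB.instance Definition _ := [Choice of l2 by <:].

Lemma cvg_series_le x y : (forall k, 0 <= x k <= y k) ->
  cvgn (series y) -> cvgn (series x).
Proof.
move=> xy; apply: series_le_cvg => k; first by case/andP: (xy k).
  by case/andP: (xy k) => /le_trans; apply.
by case/andP: (xy k).
Qed.

Lemma square_summable_submod : submod_closed square_summable.
Proof.
split.
  apply/asboolP; rewrite (_ : series _ = cst 0); first exact: is_cvg_cst.
  by apply/funext => n; rewrite /series/= big1 // => k _; rewrite expr0n.
move=> a x y /asboolP hx /asboolP hy; apply/asboolP.
apply: (@cvg_series_le _ (fun k => (2 * a ^+ 2) * x k ^+ 2 + 2 * y k ^+ 2)).
  move=> k; rewrite sqr_ge0 /=.
  rewrite [X in X ^+ 2](_ : _ = a * x k + y k) //.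
  by have := sqr_ge0 (a * x k - y k); nra.
rewrite (_ : series _ = (fun n => 2 * a ^+ 2 * series (fun k => x k ^+ 2) n
    + 2 * series (fun k => y k ^+ 2) n)).
  by apply: is_cvgD; apply: is_cvgMr => //; exact: is_cvg_cst.
by apply/funext => n; rewrite /series/= big_split /= -!mulr_sumr.
Qed.


HB.instance Definition _ := GRing.isSubmodClosed.Build R (nat -> R)
  square_summable square_summable_submod.
HB.instance Definition _ := [SubChoice_isSubLmodule of l2 by <:].

Lemma l2P (x : l2) : square_summable x. Proof. by case: x. Qed.

Definition l2_dot (x y : l2) : R := limn (series (fun k => x k * y k)).

Lemma l2_dot_cvg (x y : l2) : cvgn (series (fun k => x k * y k)).
Proof.
have /asboolP hx := l2P x; have /asboolP hy := l2P y.
apply: normed_cvg => /=.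
apply: (@cvg_series_le _ (fun k => x k ^+ 2 + y k ^+ 2)) => [k|].
  rewrite normr_ge0 /= normrM -(real_normK (num_real (x k))).
  rewrite -(real_normK (num_real (y k))).
  by have := sqr_ge0 (`|x k| - `|y k|); have := sqr_ge0 (`|x k| + `|y k|); nra.
rewrite (_ : series _ = series (fun k => x k ^+ 2) + series (fun k => y k ^+ 2)).
  exact: is_cvgD.
by apply/funext => n; rewrite /series/= big_split.
Qed.

Lemma l2_dotC (x y : l2) : l2_dot x y = l2_dot y x.
Proof. by congr (limn (series _)); apply/funext => k; rewrite mulrC. Qed.

Lemma l2_dotDl (x y z : l2) : l2_dot (x + y) z = l2_dot x z + l2_dot y z.
Proof.
rewrite /l2_dot -limD; [|exact: l2_dot_cvg..].
congr (limn _); apply/funext => n.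
rewrite -[RHS]/(series _ n + series _ n) /series /= -big_split /=.
by apply: eq_bigr => k _; rewrite -mulrDl.
Qed.

Lemma l2_dotZl a (x y : l2) : l2_dot (a *: x) y = a * l2_dot x y.
Proof.
rewrite -[RHS]lim_seriesZ; last exact: l2_dot_cvg.
by congr (limn (series _)); apply/funext => k; rewrite /= -mulrA.
Qed.

Lemma l2_dot_ge0 (x : l2) : 0 <= l2_dot x x.
Proof.
apply: limr_ge; first exact: l2_dot_cvg.
by apply: nearW => n; apply: sumr_ge0 => k _; rewrite -expr2 sqr_ge0.
Qed.

Lemma l2_dot_eq0 (x : l2) : l2_dot x x = 0 -> x = 0.
Proof.
move=> x0; apply/val_inj/funext => k /=; apply/eqP.
rewrite -sqrf_eq0 eq_le sqr_ge0 andbT -[leRHS]x0.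
apply: le_trans (nondecreasing_cvgn_le _ (@l2_dot_cvg x x) k.+1).
  rewrite /series /= big_nat_recr //= -expr2 lerDr.
  by apply: sumr_ge0 => j _; rewrite -expr2 sqr_ge0.
by apply: nondecreasing_series => j _ _; rewrite -expr2 sqr_ge0.
Qed.

Definition l2_norm (x : l2) : R := Num.sqrt (l2_dot x x).

Lemma l2_CauchySchwarz (x y : l2) : l2_dot x y <= l2_norm x * l2_norm y.
Proof.
have [y0|y0] := eqVneq (l2_dot y y) 0.
  have -> : y = 0 *: y by rewrite scale0r (l2_dot_eq0 y0).
  rewrite l2_dotC l2_dotZl mul0r; apply: mulr_ge0; exact: sqrtr_ge0.
have yp : 0 < l2_dot y y by rewrite lt_def y0 l2_dot_ge0.
rewrite -sqrtrM ?l2_dot_ge0 //; apply: (le_trans (ler_norm _)).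
rewrite -sqrtr_sqr; apply: ler_wsqrtr.
have := l2_dot_ge0 (l2_dot y y *: x + (- l2_dot x y) *: y).
rewrite l2_dotDl !l2_dotZl ![l2_dot _ (_ + _)]l2_dotC !l2_dotDl !l2_dotZl.
rewrite (l2_dotC y x) => h.
have : 0 <= l2_dot y y * (l2_dot x x * l2_dot y y - l2_dot x y ^+ 2) by lra.
by rewrite pmulr_rge0 // subr_ge0.
Qed.

Lemma l2_normD (x y : l2) : l2_norm (x + y) <= l2_norm x + l2_norm y.
Proof.
rewrite -(ler_pXn2r (n := 2)) ?nnegrE ?addr_ge0 ?sqrtr_ge0 //.
rewrite sqrrD !sqr_sqrtr ?l2_dot_ge0 // l2_dotDl ![l2_dot _ (_ + _)]l2_dotC.
rewrite !l2_dotDl (l2_dotC y x).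
by have := l2_CauchySchwarz x y; lra.
Qed.

Lemma l2_normZ a (x : l2) : l2_norm (a *: x) = `|a| * l2_norm x.
Proof.
rewrite /l2_norm l2_dotZl l2_dotC l2_dotZl mulrA -expr2 sqrtrM ?sqr_ge0 //.
by rewrite sqrtr_sqr.
Qed.

Lemma l2_norm_eq0 (x : l2) : l2_norm x = 0 -> x = 0.
Proof.
move/eqP; rewrite sqrtr_eq0 => x0; apply: l2_dot_eq0; apply/eqP.
by rewrite eq_le x0 l2_dot_ge0.
Qed.

HB.instance Definition _ :=
  Lmodule_isNormed.Build R l2 l2_normD l2_normZ l2_norm_eq0.

End SquareSummable.
Section TupleLebesgue.
Variable R : realType.
Let mR : measurableType _ := measurableTypeR R.

Section cons.
Variables (n : nat) (m : {sigma_finite_measure set (n.-tuple R) -> \bar R}).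

Definition tcons (p : mR * n.-tuple R) : n.+1.-tuple R := [tuple of p.1 :: p.2].

Lemma measurable_tcons : measurable_fun [set: mR * n.-tuple R] tcons.
Proof. exact: measurable_cons. Qed.

Definition lebesgue_cons : set (n.+1.-tuple R) -> \bar R :=
  pushforward (@lebesgue_measure R \x m)%E tcons.

Let lebesgue_cons0 : lebesgue_cons set0 = 0%E.
Proof. by rewrite /lebesgue_cons /pushforward preimage_set0 measure0. Qed.

Let lebesgue_cons_ge0 A : (0 <= lebesgue_cons A)%E.
Proof. by rewrite /lebesgue_cons /pushforward; exact: measure_ge0. Qed.

Let lebesgue_cons_sigma_additive : semi_sigma_additive lebesgue_cons.
Proof.
exact: (@measure_semi_sigma_additive _ _ _
  (measure_function_pushforward__canonical__measure_function_Measure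
     (@lebesgue_measure R \x m)%E measurable_tcons)).
Qed.

HB.instance Definition _ := isMeasure.Build _ _ _ lebesgue_cons
  lebesgue_cons0 lebesgue_cons_ge0 lebesgue_cons_sigma_additive.

Let lebesgue_cons_sigma_finite : sigma_finite setT lebesgue_cons.
Proof.
have /sigma_finiteP[F [TF ndF Foo]] := sigma_finiteT (@lebesgue_measure R).
have /sigma_finiteP[G [TG ndG Goo]] := sigma_finiteT m.
pose un (t : n.+1.-tuple R) := (thead t, [tuple of behead t]).
have unK : cancel un tcons by move=> t; rewrite [RHS]tuple_eta.
have tconsK : cancel tcons un.
  by case=> x t; congr (_, _); apply/val_inj.
have mun : measurable_fun setT un.
  apply/measurable_fun_pairP; split => /=; last exact: measurable_behead.
  exact: measurable_tnth.
exists (fun k => un @^-1` (F k `*` G k)).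
  rewrite -preimage_bigcup (_ : \bigcup_k _ = setT) ?preimage_setT //.
  rewrite -setXTT TF TG predeqE => -[x y]; split.
    by move=> [k _ []]; split; exists k.
  move=> [/= [i _ Fx] [j _ Gy]]; exists (maxn i j) => //; split.
    by move: x Fx; exact/subsetPset/ndF/leq_maxl.
  by move: y Gy; exact/subsetPset/ndG/leq_maxr.
move=> k; have [mF Fk] := Foo k; have [mG Gk] := Goo k; split.
  by rewrite -[X in measurable X]setTI; apply: mun => //; exact: measurableX.
rewrite /lebesgue_cons /pushforward -comp_preimage.
rewrite (_ : un \o tcons = id); last by apply/funext => p; rewrite /= tconsK.
rewrite preimage_id product_measure1E //.
by rewrite lte_mul_pinfty // ge0_fin_numE.
Qed.

HB.instance Definition _ := @Measure_isSigmaFinite.Build _ _ _ lebesgue_cons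
  lebesgue_cons_sigma_finite.
End cons.

Fixpoint lebesgue_tuple (n : nat) :
    {sigma_finite_measure set (n.-tuple R) -> \bar R} :=
  match n with
  | 0 => \d_([tuple] : 0.-tuple R)
  | n'.+1 => lebesgue_cons (lebesgue_tuple n')
  end.

Lemma measurable_inv : measurable_fun [set: R] (fun x : R => x^-1 : R).
Proof.
rewrite -(setUv [set (0 : R)]); apply/measurable_funU.
- exact: measurable_set1.
- by apply: measurableC; exact: measurable_set1.
split; first exact: measurable_fun_set1.
apply: open_continuous_measurable_fun.
  by rewrite openC; exact: closed_eq.
by move=> x /set_mem /= /eqP x0; exact: inv_continuous.
Qed.

End TupleLebesgue.

Section Sphere.
Variables (R : realType) (d : nat).
Implicit Types (x y : 'rV[R]_d) (t : d.-tuple R).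

Definition rv_dot x y : R := \sum_(i < d) x 0 i * y 0 i.

Definition rv_tuple t : 'rV[R]_d := \row_i tnth t i.

Definition unit_ball : set (d.-tuple R) :=
  [set t | \sum_(i < d) tnth t i ^+ 2 <= 1].

Definition normalize t : d.-tuple R :=
  [tuple (Num.sqrt (\sum_(j < d) tnth t j ^+ 2))^-1 * tnth t i | i < d].

Lemma measurable_sumsq :
  measurable_fun setT (fun t => \sum_(i < d) tnth t i ^+ 2 : R).
Proof.
apply: measurable_sum => i; apply: measurable_funX.
exact: measurable_tnth.
Qed.

Lemma measurable_unit_ball : measurable unit_ball.
Proof.
rewrite (_ : unit_ball =
  setT `&` (fun t => \sum_(i < d) tnth t i ^+ 2 : R) @^-1` `]-oo, 1]).
  by apply: measurable_sumsq => //; exact: measurable_itv.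
by rewrite setTI; apply/seteqP; split => t; rewrite /= in_itv.
Qed.

Lemma measurable_normalize : measurable_fun setT normalize.
Proof.
apply/measurable_fun_tnthP => i.
rewrite (_ : _ \o _ = fun t =>
  (Num.sqrt (\sum_(j < d) tnth t j ^+ 2))^-1 * tnth t i); last first.
  by apply/funext => t /=; rewrite tnth_mktuple.
apply: measurable_funM; last exact: measurable_tnth.
apply: (measurableT_comp (@measurable_inv R)).
apply: (@measurableT_comp _ _ _ _ _ _ (Num.sqrt : R -> R)).
  by apply: continuous_measurable_fun; exact: sqrt_continuous.
exact: measurable_sumsq.
Qed.

(* the surface measure in the normalisation for which Lebesgue measure is
   r^(d-1) dr dsigma in polar coordinates: d times the volume of the cone
   spanned by A in the unit ball *)
Definition sphere_measure : set (d.-tuple R) -> \bar R := fun A =>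
  (d%:R%:E * @lebesgue_tuple R d (normalize @^-1` A `&` unit_ball))%E.

Let sphere_measure0 : sphere_measure set0 = 0%E.
Proof. by rewrite /sphere_measure preimage_set0 set0I measure0 mule0. Qed.

Let sphere_measure_ge0 A : (0 <= sphere_measure A)%E.
Proof. by rewrite /sphere_measure mule_ge0. Qed.

Let sphere_measure_sigma_additive : semi_sigma_additive sphere_measure.
Proof.
pose m1 : {measure set (d.-tuple R) -> \bar R} :=
  mrestr (@lebesgue_tuple R d) measurable_unit_ball.
pose m2 : {measure set (d.-tuple R) -> \bar R} :=
  measure_function_pushforward__canonical__measure_function_Measure
    m1 measurable_normalize.
exact: (@measure_semi_sigma_additive _ _ _ (mscale d%:R%:nng m2)).
Qed.

HB.instance Definition _ := isMeasure.Build _ _ _ sphere_measure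
  sphere_measure0 sphere_measure_ge0 sphere_measure_sigma_additive.

End Sphere.

Section Spherical.
Variables (R : realType) (d : nat).
Implicit Types (f g h : 'rV[R]_d -> R[i]).

Definition sphere : set 'rV[R]_d := [set x | rv_dot x x = 1].

Definition laplacian (p : mpoly.mpoly d R[i]) : mpoly.mpoly d R[i] :=
  \sum_(i < d) mpoly.mderiv i (mpoly.mderiv i p).

(* only the values of h on the sphere matter *)
Definition spherical_harmonic (n : nat) h : Prop :=
  exists p : mpoly.mpoly d R[i],
    [/\ p \is mpoly.ishomog1 n mpoly.mdeg, laplacian p = 0
      & forall x, sphere x -> h x = mpoly.meval (fun i => (x 0 i)%:C) p].

Definition sphere_inner f g : R[i] :=
  let S := [set t : d.-tuple R | sphere (rv_tuple t)] in
  let fg t := f (rv_tuple t) * (g (rv_tuple t))^* in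
  (fine (sphere_measure S))^-1%:C *
    (Rintegral (@sphere_measure R d) S (fun t => complex.Re (fg t)) +i*
     Rintegral (@sphere_measure R d) S (fun t => complex.Im (fg t))).

Definition orthonormal_basis_harmonics (n N : nat)
    (Y : 'I_N -> 'rV[R]_d -> R[i]) : Prop :=
  [/\ forall k, spherical_harmonic n (Y k),
      forall k l, sphere_inner (Y k) (Y l) = (k == l)%:R
    & forall h, spherical_harmonic n h -> exists c : 'I_N -> R[i],
        forall x, sphere x -> h x = \sum_(k < N) c k * Y k x].

End Spherical.

Section Gegenbauer.
Variable R : realType.

Definition gegenbauer_generating (l : R) (C : nat -> R -> R) : Prop :=
  forall t z, -1 <= t <= 1 -> `|z| < 1 ->
    series (fun n => z ^+ n * C n t) @ \oo --> (1 - 2 * t * z + z ^+ 2) `^ (- l).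

(* only the values on [-1, 1] are constrained when lambda is finite *)
Definition normalized_gegenbauer (lambda : \bar R) (Ch : nat -> R -> R) : Prop :=
  match lambda with
  | +oo%E => forall n t, Ch n t = t ^+ n
  | EFin l => if l == 0 then forall n theta, Ch n (cos theta) = cos (n%:R * theta)
            else exists2 C, gegenbauer_generating l C &
              forall n t, -1 <= t <= 1 -> Ch n t = C n t / C n 1
  | -oo%E => False
  end.

End Gegenbauer.

Section Kernels.
Variable R : realType.

Definition posdef_kernel (T : Type) (A : set T) (K : T -> T -> R[i]) : Prop :=
  forall (m : nat) (x : 'I_m -> T) (c : 'I_m -> R[i]), (forall i, A (x i)) ->
    0 <= \sum_(i < m) \sum_(j < m) c i * (c j)^* * K (x i) (x j).

Definition nonneg_half_line : set R := [set r | 0 <= r].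

Variables (V : normedModType R) (dot : V -> V -> R).
(* [dot] is the inner product and [enorm] the Hilbert norm; the norm of [V]
   itself (the sup norm when V = 'rV[R]_d) is used only for its topology. *)

Definition enorm (x : V) : R := Num.sqrt (dot x x).

(* [unitv 0 = 0] *)
Definition unitv (x : V) : V := (enorm x)^-1 *: x.

Definition isotropic (K : V -> V -> R) : Prop :=
  forall U : {linear V -> V}, bijective U -> (forall x, enorm (U x) = enorm x) ->
    forall x y, K (U x) (U y) = K x y.

Definition isotropic_kernel (K : V -> V -> R) : Prop :=
  [/\ posdef_kernel setT (fun x y => (K x y)%:C), isotropic K
    & continuous (fun p : V * V => K p.1 p.2)].

Definition associated_kernels (Ch : nat -> R -> R) (K : V -> V -> R)
    (alpha : nat -> R -> R -> R) : Prop :=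
  [/\ forall n,
        {within nonneg_half_line `*` nonneg_half_line,
          continuous (fun p : R * R => alpha n p.1 p.2)} /\
        posdef_kernel nonneg_half_line (fun r s => (alpha n r s)%:C),
      forall r : R, 0 <= r -> exists U : set R,
        [/\ U `<=` nonneg_half_line, within nonneg_half_line (nbhs r) U
          & (fun N => ereal_sup
               [set (\sum_(N <= n <oo) (alpha n s s)%:E)%E | s in U])
              @ \oo --> 0%E],
      forall n r, (0 < n)%N -> 0 <= r -> alpha n r 0 = 0 /\ alpha n 0 r = 0,
      forall x y, x != 0 -> y != 0 ->
        series (fun n => alpha n (enorm x) (enorm y) *
                         Ch n (dot (unitv x) (unitv y))) @ \oo --> K x y
    & forall x y, x = 0 \/ y = 0 -> K x y = alpha 0 (enorm x) (enorm y)].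

End Kernels.

Section RandomFunctions.
Context {disp : measure_display} {Omega : measurableType disp} {R : realType}.
Variable P : probability Omega R.

Definition gaussian_rv (X : Omega -> R) : Prop :=
  measurable_fun setT X /\
  exists m s : R, 0 <= s /\ forall B : set R, measurable B ->
    P (X @^-1` B) = if s == 0 then \d_m B else normal_prob m s B.

Section OnIndexSet.
Variables (T : Type) (A : set T).

(* a random vector is Gaussian when all its linear combinations are *)
Definition gaussian_function (X : T -> Omega -> R) : Prop :=
  forall (m : nat) (t : 'I_m -> T) (a : 'I_m -> R), (forall i, A (t i)) ->
    gaussian_rv (fun w => \sum_(i < m) a i * X (t i) w).

Definition centered_gaussian (X : T -> Omega -> R) (K : T -> T -> R) : Prop :=
  [/\ gaussian_function X, forall t, A t -> ('E_P[X t] = 0)%E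
    & forall s t, A s -> A t -> covariance P (X s) (X t) = (K s t)%:E].

Definition generated_sigma_algebra (X : T -> Omega -> R) : set (set Omega) :=
  <<s [set E | exists t (B : set R), [/\ A t, measurable B & E = X t @^-1` B]] >>.

Definition independent_functions (I : choiceType) (J : set I)
    (X : I -> T -> Omega -> R) : Prop :=
  forall (F : {fset I}) (E : I -> set Omega),
    (forall i, i \in F -> J i /\ generated_sigma_algebra (X i) (E i)) ->
    P (\bigcap_(i in [set` F]) E i) = (\prod_(i <- F) P (E i))%E.

End OnIndexSet.

Definition cvg_as (S : nat -> Omega -> R) (X : Omega -> R) : Prop :=
  {ae P, forall w, (fun N => S N w) @ \oo --> X w}.

Definition cvg_L2 (S : nat -> Omega -> R) (X : Omega -> R) : Prop :=
  [/\ forall N, S N \in Lfun P 2%:E, X \in Lfun P 2%:E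
    & Lnorm P 2%:E (fun w => (S N w - X w)%:E) @[N --> \oo] --> 0%E].

(* a complex-valued random function is handled through the real-valued random
   function, indexed by T * bool, of its real and imaginary parts *)
Definition re_im (T : Type) (X : T -> Omega -> R[i]) (u : T * bool) : Omega -> R :=
  fun w => if u.2 then complex.Im (X u.1 w) else complex.Re (X u.1 w).

Definition cexpectation (X : Omega -> R[i]) : R[i] :=
  fine ('E_P[fun w => complex.Re (X w)])%E +i*
  fine ('E_P[fun w => complex.Im (X w)])%E.

Definition ccovariance (X Y : Omega -> R[i]) : R[i] :=
  cexpectation (fun w => (X w - cexpectation X) * (Y w - cexpectation Y)^*).

Definition ccentered_gaussian (T : Type) (X : T -> Omega -> R[i])
    (K : T -> T -> R[i]) : Prop :=
  [/\ gaussian_function setT (re_im X), forall t, cexpectation (X t) = 0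
    & forall s t, ccovariance (X s) (X t) = K s t].

Definition ccvg_as (S : nat -> Omega -> R[i]) (X : Omega -> R[i]) : Prop :=
  {ae P, forall w, (fun N => S N w : R[i]^o) @ \oo --> (X w : R[i]^o)}.

Definition ccvg_L2 (S : nat -> Omega -> R[i]) (X : Omega -> R[i]) : Prop :=
  let L2 (Z : Omega -> R[i]) := (fun w => complex.Re (Z w)) \in Lfun P 2%:E /\
                                (fun w => complex.Im (Z w)) \in Lfun P 2%:E in
  [/\ forall N, L2 (S N), L2 X
    & Lnorm P 2%:E (fun w => (Normc.normc (S N w - X w))%:E) @[N --> \oo] --> 0%E].

End RandomFunctions.

Section Representation.
Context {disp : measure_display} {Omega : measurableType disp} {R : realType}.

Section InfiniteDimension.
Variable g : forall n, n.-tuple nat -> R -> Omega -> R.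

(* [i : n.-tuple nat] is the multi-index (i_1, ..., i_n), counted from 0 *)
Definition term_infty n (x : l2 R) (i : n.-tuple nat) (w : Omega) : R :=
  g i (enorm (@l2_dot R) x) w *
  \prod_(j < n) (unitv (@l2_dot R) x : l2 R) (tnth i j).

(* the multiple series is summed over the boxes {0, ..., M - 1}^n *)
Definition f_infty n (x : l2 R) (w : Omega) : R :=
  limn (fun M => \sum_(i : n.-tuple 'I_M)
    term_infty x (map_tuple (fun k : 'I_M => k : nat) i) w).

Lemma f_infty0 x w :
  f_infty 0 x w = g [tuple] (enorm (@l2_dot R) x) w.
Proof.
rewrite /f_infty (_ : (fun _ => _) = cst (g [tuple] (enorm (@l2_dot R) x) w)).
  exact: lim_cst.
apply/funext => M; rewrite (big_pred1 [tuple]) => [|i]; last first.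
  by apply/esym/eqP; exact: tuple0.
by rewrite /term_infty big_ord0 mulr1 (tuple0 (map_tuple _ _)).
Qed.

Definition series_infty (x : l2 R) (w : Omega) : R :=
  limn (fun M => \sum_(n < M) f_infty n x w).

End InfiniteDimension.

(* an increasing sequence of finite sets of indices whose union is everything *)
Definition exhaustion (I : choiceType) (A : nat -> {fset I}) : Prop :=
  (forall M, (A M `<=` A M.+1)%fset) /\ (forall i, exists M, i \in A M).

Section FiniteDimension.
Variables (d : nat) (N : nat -> nat).
Variables (Y : forall n, 'I_(N n) -> 'rV[R]_d -> R[i]).
Variables (g : nat -> nat -> R -> Omega -> R).

(* k is counted from 0, and [g n k] is used only for k < N n *)
Definition f_finite (n : nat) (x : 'rV[R]_d) (w : Omega) : R[i] :=
  let r := enorm (@rv_dot R d) x in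
  if n == 0%N then (g 0 0 r w)%:C
  else if x == 0 then 0
  else (Num.sqrt (N n)%:R)^-1%:C *
       \sum_(k < N n) (g n k r w)%:C * Y k (unitv (@rv_dot R d) x).

Definition series_finite (x : 'rV[R]_d) (w : Omega) : R[i] :=
  limn (fun M => \sum_(n < M) f_finite n x w : R[i]^o).

End FiniteDimension.

End Representation.

(* Main.v *)
(* The variables f_n(x) are L2-limits of linear combinations of the g(r), hence form a
   Gaussian space, and disjoint blocks of the g's generate independent sigma-algebras.
   Kolmogorov's maximal inequality gives almost sure convergence of a series of independent
   centered variables with summable variances, Fatou's lemma its L2 convergence, also along
   any other exhaustion of the indices. It remains to compute covariances.

   For d infinite, the covariance over the box {0, ..., M - 1}^n is (sum_(k < M) x_k y_k)^n.

   For d finite, one needs Ch_n(<x, y>) = N^-1 sum_k Y_k(x) conj(Y_k(y)) on the sphere. The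
   three-term recurrence of Ch_n defines a homogeneous harmonic polynomial [zonal y n] with
   values Ch_n(<x, y>) on the sphere. Integration by parts against the Gaussian weight and
   the same recurrence give E[h * zonal y n] = b h(y) for every homogeneous harmonic h of
   degree n. In polar coordinates Gaussian integrals of homogeneous polynomials of a given
   degree are proportional to their averages over the sphere. So the zonal polynomial
   reproduces values at y; expanding it in the Y_k and averaging over x = y yields the
   constant N^-1. *)

From HB Require Import structures.
Require Import Defs.
From mathcomp Require Import all_boot all_order all_algebra.
From mathcomp Require Import finmap.
From mathcomp Require Import all_classical all_reals all_analysis.
From mathcomp Require Import measurable_realfun complex.
From mathcomp Require Import ring lra.
From mathcomp Require Import (canonicals, coercions) mpoly.
Set Implicit Arguments.
Unset Strict Implicit.
Unset Printing Implicit Defensive.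
Import Order.TTheory GRing.Theory Num.Theory.
Import numFieldNormedType.Exports.
Local Open Scope classical_set_scope.
Local Open Scope complex_scope.
Local Open Scope ring_scope.

(** * Densities, affine changes of variables and product measures *)

(** The spherical harmonics are complex and the multi-indices carry no order; both facts shape the
    proof. A limit over multi-indices might depend on the enumeration: the limit along the boxes is
    therefore shown to be the L2 limit along every exhaustion, and two L2 limits of one sequence
    agree almost surely. Complex values are split into real and imaginary parts, indexed by a
    boolean, so that only real Gaussian families occur; the complex [limn] agrees with the pair of
    real ones almost surely only, since each takes a default value where its sequence diverges.
    Normal laws are treated through densities and distribution functions: sums of independent
    variables by convolution, L2 limits by comparing distribution functions. The detour over the
    Gaussian weight replaces Green's formula on the sphere: integration by parts becomes an
    algebraic identity between moments, and analysis enters only when Gaussian integrals are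
    compared with spherical ones. Only products of two polynomials of the same degree are averaged,
    so even degrees suffice. *)

Section Density.
Context d (T : measurableType d) (R : realType).
Variables (m nu : {measure set T -> \bar R}) (f : T -> R).
Hypotheses (f0 : forall x, 0 <= f x) (mf : measurable_fun setT f).
Hypothesis nuE : forall A, measurable A -> nu A = (\int[m]_(x in A) (f x)%:E)%E.

Import HBNNSimple.

Let ge0_integral_density_nnsfun (h : {nnsfun T >-> R}) :
  (\int[nu]_x (h x)%:E = \int[m]_x ((h x)%:E * (f x)%:E))%E.
Proof.
under [RHS]eq_integral.
  move=> x _; rewrite fimfunE -fsumEFin// ge0_mule_fsuml; last first.
    by move=> r; rewrite EFinM nnfun_muleindic_ge0.
  over.
rewrite integralT_nnsfun sintegralE ge0_integral_fsum//; last 2 first.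
  - move=> r; by apply: emeasurable_funM; apply/measurable_EFinP => //; exact/measurableT_comp.
  - by move=> r x _; rewrite mule_ge0// ?lee_fin// -lee_fin EFinM nnfun_muleindic_ge0.
apply: eq_fsbigr => r _.
have [r0|r0] := ltP r 0%R.
  rewrite preimage_nnfun0// measure0 mule0; apply/esym.
  by apply: integral0_eq => x _; rewrite indic0 mulr0 mul0e.
under eq_integral do rewrite EFinM -muleA.
rewrite ge0_integralZl//; last 2 first.
  - by apply: emeasurable_funM; apply/measurable_EFinP.
  - by move=> x _; rewrite mule_ge0// lee_fin.
congr (_ * _)%E; rewrite nuE// integral_mkcond; apply: eq_integral => x _.
by rewrite patchE indicE; case: ifP => _; rewrite ?mul1e ?mul0e.
Qed.

Lemma ge0_integral_density (F : T -> \bar R) :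
  (forall x, (0 <= F x)%E) -> measurable_fun setT F ->
  (\int[nu]_x F x = \int[m]_x (F x * (f x)%:E))%E.
Proof.
move=> F0 mF; pose h := nnsfun_approx measurableT mF.
transitivity (limn (fun n => \int[nu]_x (h n x)%:E)%E).
  rewrite -monotone_convergence//=.
  - apply: eq_integral => ? /[!inE] xD; apply/esym/cvg_lim => //=.
    exact: cvg_nnsfun_approx.
  - by move=> n; exact/measurable_EFinP/measurable_funTS.
  - by move=> n ? _; rewrite lee_fin.
  - by move=> ? _ ? ? mn; rewrite lee_fin; exact/lefP/nd_nnsfun_approx.
under eq_fun do rewrite ge0_integral_density_nnsfun.
rewrite -monotone_convergence//=.
- apply: eq_integral => x _; apply/cvg_lim => //.
  by apply: cvgeZr => //; exact: cvg_nnsfun_approx.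
- by move=> n; apply: emeasurable_funM; apply/measurable_EFinP.
- by move=> n x _; rewrite mule_ge0// lee_fin.
- move=> x _ a b ab; apply: lee_wpmul2r; rewrite lee_fin//.
  exact/lefP/nd_nnsfun_approx.
Qed.

Lemma integrable_density (F : T -> R) : measurable_fun setT F ->
  nu.-integrable setT (EFin \o F) <-> m.-integrable setT (EFin \o (F \* f)).
Proof.
move=> mF.
have E : (\int[nu]_x `|(F x)%:E| = \int[m]_x `|(F x * f x)%:E|)%E.
  rewrite ge0_integral_density//; last first.
    by do 2 apply: measurableT_comp => //.
  by apply: eq_integral => x _; rewrite /= normrM EFinM (ger0_norm (f0 x)).
split=> /integrableP[_ iF]; apply/integrableP; split.
- by apply/measurable_EFinP; apply: measurable_funM.
- by rewrite -E.
- exact/measurable_EFinP.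
- by rewrite E.
Qed.

Lemma integral_density (F : T -> R) : measurable_fun setT F ->
  nu.-integrable setT (EFin \o F) ->
  (\int[nu]_x (F x)%:E = \int[m]_x (F x * f x)%:E)%E.
Proof.
move=> mF iF; rewrite integralE [RHS]integralE.
congr (_ - _)%E; rewrite ge0_integral_density//.
- apply: eq_integral => x _.
  by rewrite !funeposE maxe_pMl ?lee_fin// mul0e.
- apply: measurable_funepos; exact/measurable_EFinP.
- apply: eq_integral => x _.
  by rewrite !funenegE maxe_pMl ?lee_fin// mul0e EFinM mulNe.
- apply: measurable_funeneg; exact/measurable_EFinP.
Qed.


End Density.

Section DensityMeasure.
Context d (T : measurableType d) (R : realType).
Variables (m : {measure set T -> \bar R}) (f : T -> R).
Hypotheses (f0 : forall x, 0 <= f x) (mf : measurable_fun setT f).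

(** Nonnegativity and measurability of the density are arguments, so that the measure structure
    declared below can recover them from the term. *)
Definition density_measure (_ : forall x, 0 <= f x) (_ : measurable_fun setT f) :
  set T -> \bar R := fun A => (\int[m]_(x in A) (f x)%:E)%E.

Local Notation dm := (density_measure f0 mf).

Let density_measure0 : dm set0 = 0%E.
Proof. by rewrite /density_measure integral_set0. Qed.

Let density_measure_ge0 A : (0 <= dm A)%E.
Proof. by apply: integral_ge0 => x _; rewrite lee_fin. Qed.

Let density_measure_sigma_additive : semi_sigma_additive dm.
Proof.
move=> /= F mF tF mUF; rewrite /density_measure; apply: cvg_toP.
  apply: ereal_nondecreasing_is_cvgn => m' n mn.
  apply: lee_sum_nneg_natr => // k _ _.
  by apply: integral_ge0 => /= x Fkx; rewrite lee_fin.
rewrite ge0_integral_bigcup//=.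
- by apply: measurable_funTS; apply: measurableT_comp.
- by move=> x _; rewrite lee_fin.
Qed.

HB.instance Definition _ := isMeasure.Build _ _ _ dm
  density_measure0 density_measure_ge0 density_measure_sigma_additive.

End DensityMeasure.

Section BorelUniqueness.
Variable R : realType.
Local Notation mR := (measurableTypeR R).

(** Closed lower half-lines are stable under intersection and generate the Borel sets, and those
    with natural endpoints cover the line with finite mass. *)
Lemma borel_measure_unique (m1 m2 : {measure set mR -> \bar R}) :
  (forall x : R, m1 `]-oo, x]%classic = m2 `]-oo, x]%classic) ->
  (forall x : R, (m1 `]-oo, x]%classic < +oo)%E) ->
  forall A, measurable A -> m1 A = m2 A.
Proof.
move=> m12 mfin; pose G := [set A : set R | exists x, A = `]-oo, x]%classic].
apply: (@measure_unique _ R mR G (fun n => `]-oo, n%:R]%classic)).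
- rewrite [LHS](RGenOInfty.measurableE R) eqEsubset; split.
    apply: smallest_sub; first exact: smallest_sigma_algebra.
    move=> _ [x ->]; rewrite -setCitvl.
    have [_ C _] := @smallest_sigma_algebra _ setT G.
    by rewrite -setTD; apply: C; apply: sub_sigma_algebra; exists x.
  apply: smallest_sub; first exact: smallest_sigma_algebra.
  move=> _ [x ->]; rewrite -setCitvr.
  have [_ C _] := @smallest_sigma_algebra _ setT (RGenOInfty.G (R := R)).
  by rewrite -setTD; apply: C; apply: sub_sigma_algebra; exists x.
- move=> _ _ [x ->] [y ->]; exists (Num.min x y).
  by apply/seteqP; split=> z /=; rewrite !in_itv /= le_min => /andP.
- by move=> n; exists n%:R.
- apply/seteqP; split=> // x _; exists (Num.truncn `|x|).+1 => //=.
  by rewrite in_itv /= (le_trans (ler_norm x)) // ltW // truncnS_gt.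
- by move=> _ [x ->]; exact: m12.
- by move=> n; exact: mfin.
Qed.

(** Lebesgue measure is determined by its values on the intervals []x, y]], and the preimage of such
    an interval is one whose length is divided by [a]. *)
Lemma lebesgue_measure_affine (a b : R) : 0 < a ->
  forall A : set mR, measurable A ->
  (a%:E * lebesgue_measure ((fun x => (a * x + b)%R) @^-1` A) = lebesgue_measure A :> \bar R)%E.
Proof.
move=> a0 A mA.
have mphi : measurable_fun [set: mR] (fun x : mR => a * x + b : mR).
  by apply: measurable_funD => //; exact: measurable_funM.
pose m1 := measure_function_pushforward__canonical__measure_function_Measure
  (@lebesgue_measure R) mphi.
have a0' : (0 <= a) by exact: ltW.
pose m2 : {measure set mR -> \bar R} := mscale (NngNum a0') m1.
apply/esym; apply: (lebesgue_measure_unique (mu := m2)) => // X [[x y] _ <-].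
rewrite [RHS](_ : _ = a%:E * lebesgue_measure ((fun x => (a * x + b)%R) @^-1` `]x, y]))%E //.
have -> : (fun x : R => a * x + b) @^-1` `]x, y] = `](x - b) / a, (y - b) / a]%classic.
  apply/seteqP; split => z /=; rewrite !in_itv /= ltr_pdivrMr // ler_pdivlMr //;
  by rewrite ltrBlDr lerBrDr mulrC.
rewrite !lebesgue_measure_itv /= !lte_fin ltr_pM2r ?invr_gt0 // ltrD2r.
case: ifP => _; last by rewrite mule0.
by rewrite -!EFinB -EFinM; congr (_%:E); field; rewrite gt_eqF.
Qed.

Lemma ge0_integral_affine (a b : R) (F : R -> \bar R) : 0 < a ->
  (forall x, (0 <= F x)%E) -> measurable_fun [set: mR] F ->
  (\int[lebesgue_measure]_x F (a * x + b)%R = a^-1%:E * \int[lebesgue_measure]_x F x)%E.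
Proof.
move=> a0 F0 mF.
have mphi : measurable_fun [set: mR] (fun x : mR => a * x + b : mR).
  by apply: measurable_funD => //; exact: measurable_funM.
have a0' : (0 <= a) by exact: ltW.
pose m1 := measure_function_pushforward__canonical__measure_function_Measure
  (@lebesgue_measure R) mphi.
rewrite -[in RHS](@eq_measure_integral _ _ _ _ _ (mscale (NngNum a0') m1)); last first.
  move=> A mA _; exact: lebesgue_measure_affine.
rewrite ge0_integral_mscale //= muleA -EFinM mulVf ?gt_eqF // mul1e.
by rewrite (ge0_integral_pushforward mphi) //= preimage_setT.
Qed.

End BorelUniqueness.

Section ProductIntegrable.
Context d1 d2 (T1 : measurableType d1) (T2 : measurableType d2) (R : realType).
Variables (m1 : {sigma_finite_measure set T1 -> \bar R})
          (m2 : {sigma_finite_measure set T2 -> \bar R}).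
Variables (f : T1 -> R) (g : T2 -> R).
Hypotheses (fi : m1.-integrable setT (EFin \o f))
           (gi : m2.-integrable setT (EFin \o g)).

Let mf : measurable_fun setT f.
Proof. exact/measurable_EFinP/(measurable_int m1). Qed.
Let mg : measurable_fun setT g.
Proof. exact/measurable_EFinP/(measurable_int m2). Qed.

Let mfg : measurable_fun setT (fun z : T1 * T2 => f z.1 * g z.2).
Proof. by apply: measurable_funM; apply: measurableT_comp. Qed.

Lemma integrable_prodM : (m1 \x m2)%E.-integrable setT
  (fun z => (f z.1 * g z.2)%:E).
Proof.
apply/integrable12ltyP; first exact/measurable_EFinP.
under eq_integral => x _.
  under eq_integral => y _ do rewrite /= normrM EFinM.
  rewrite ge0_integralZl//; last first.
    by do 2 apply: measurableT_comp => //.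
  over.
rewrite ge0_integralZr //=; last 2 first.
- by do 2 apply: measurableT_comp => //.
- by apply: integral_ge0 => y _; rewrite lee_fin.
have /integrableP[_ hf] := fi; have /integrableP[_ hg] := gi.
by rewrite lte_mul_pinfty// ?integral_ge0// ge0_fin_numE // integral_ge0.
Qed.

Lemma integral_prodM : (\int[m1 \x m2]_z (f z.1 * g z.2)%:E =
  (\int[m1]_x (f x)%:E) * \int[m2]_y (g y)%:E)%E.
Proof.
rewrite -integral12_prod_meas1; last exact: integrable_prodM.
rewrite /fubini_F; under eq_integral => x _.
  under eq_integral => y _ do rewrite /= EFinM.
  rewrite integralZl//; over.
by rewrite -(fineK (integrable_fin_num measurableT gi)) /= integralZr.
Qed.

End ProductIntegrable.

(** * Harmonic polynomials and Gaussian moments *)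

(** Moments of the standard normal law: 0 for odd [k], the double factorial of [k - 1] for even
    [k]. *)
Fixpoint normal_moment (k : nat) : nat :=
  match k with
  | 0 => 1
  | 1 => 0
  | (k'.+1 as l).+1 => l * normal_moment k'
  end%N.

Lemma normal_momentS k : normal_moment k.+1 = (k * normal_moment k.-1)%N.
Proof. by case: k. Qed.

Section MPolyCalculus.
Local Notation mpoly := mpoly.mpoly.
Local Notation xvar i := (mpoly.mpolyX _ (mpoly.mnm1 i)).
Local Notation mder i p := (mpoly.mderiv i p).
Local Notation homog n := (mpoly.ishomog1 n mpoly.mdeg).
Variables (C : numFieldType) (d : nat).
Implicit Types (p q h : mpoly d C) (i j : 'I_d).

Lemma mpoly_lin_ext (V : zmodType) (f g : mpoly d C -> V) :
  {morph f : x y / x + y} -> {morph g : x y / x + y} ->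
  (forall c m, f (c *: mpoly.mpolyX C m) = g (c *: mpoly.mpolyX C m)) ->
  forall p, f p = g p.
Proof.
move=> fD gD fg; have f0 : f 0 = g 0.
  by have := fg 0 mpoly.mnm0; rewrite !scale0r.
by elim/mpoly.mpolyind => // c m p _ _ IH; rewrite fD gD fg IH.
Qed.

Lemma mder_xvar i j : mder i (xvar j) = (i == j)%:R :> mpoly d C.
Proof.
rewrite mpoly.mderivX mpoly.mnm1E eq_sym; case: eqP => [->|_]; last by rewrite scale0r.
rewrite scale1r (_ : mpoly.mnm_sub _ _ = mpoly.mnm0) ?mpoly.mpolyX0 //.
by apply/mpoly.mnmP => k; rewrite mpoly.mnmBE mpoly.mnm0E subnn.
Qed.

Lemma homog_mder n i p : p \is homog n -> mder i p \is homog n.-1.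
Proof.
move=> /mpoly.dhomogP hp; apply/mpoly.dhomogP => m.
rewrite mpoly.mcoeff_msupp mpoly.mcoeff_deriv => nz.
have : mpoly.mnm_add m (mpoly.mnm1 i) \in mpoly.msupp p.
  by rewrite mpoly.mcoeff_msupp; apply: contraNneq nz => ->; rewrite mul0rn.
by move=> /hp /=; rewrite mpoly.mdegD mpoly.mdeg1 addn1 => <-.
Qed.

Lemma homog_xvar i : (xvar i : mpoly d C) \is homog 1.
Proof. by rewrite mpoly.dhomogX /= mpoly.mdeg1. Qed.

(** Euler's identity: on a monomial, [xvar i * mder i] multiplies by the exponent of the [i]-th
    variable. *)
Lemma euler_homog n p : p \is homog n ->
  \sum_i xvar i * mder i p = n%:R *: p.
Proof.
move=> hp; rewrite {1}(mpoly.mpolyE p) [in RHS](mpoly.mpolyE p) scaler_sumr.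
under eq_bigr do rewrite raddf_sum mulr_sumr.
rewrite exchange_big /= [LHS]big_seq [RHS]big_seq; apply: eq_bigr => m pm.
have {hp} /= <- := mpoly.dhomog_mf hp pm.
rewrite mpoly.mdegE natr_sum scaler_suml; apply: eq_bigr => i _.
rewrite mpoly.mderivZ mpoly.mderivX -!scalerAr.
have [->|mi] := posnP (m i); first by rewrite !scale0r scaler0.
rewrite scalerA mulrC -scalerA; congr (_ *: (_ *: _)).
by rewrite -mpoly.mpolyXD mpoly.addmC mpoly.submK // mpoly.lep1mP -lt0n.
Qed.

(** Over [R[i]] this is convertible to [laplacian]; the calculus here is done over any
    [numFieldType]. *)
Definition lapl p := \sum_i mder i (mder i p).

Lemma laplD p q : lapl (p + q) = lapl p + lapl q.
Proof. by rewrite /lapl -big_split; apply: eq_bigr => i _; rewrite !raddfD. Qed.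

Lemma laplZ (c : C) p : lapl (c *: p) = c *: lapl p.
Proof.
by rewrite /lapl scaler_sumr; apply: eq_bigr => i _; rewrite !mpoly.mderivZ.
Qed.

Lemma lapl_mder i p : lapl (mder i p) = mder i (lapl p).
Proof.
rewrite /lapl raddf_sum; apply: eq_bigr => j _.
by rewrite /= (mpoly.mderiv_comm i j p) (mpoly.mderiv_comm i j).
Qed.

Lemma laplM p q :
  lapl (p * q) = lapl p * q + (\sum_i mder i p * mder i q) *+ 2 + p * lapl q.
Proof.
rewrite /lapl mulr_suml mulr_sumr -sumrMnl -!big_split; apply: eq_bigr => i _ /=.
by rewrite !mpoly.mderivM !raddfD /= !mpoly.mderivM; ring.
Qed.

(** The squared Euclidean norm as a polynomial. *)
Definition rho : mpoly d C := \sum_i xvar i ^+ 2.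

Lemma mder_rho i : mder i rho = xvar i *+ 2.
Proof.
rewrite /rho raddf_sum (bigD1 i) //= big1 => [|j ji].
  by rewrite /= addr0 expr2 mpoly.mderivM mder_xvar eqxx mul1r mulr1 mulr2n.
by rewrite /= expr2 mpoly.mderivM mder_xvar eq_sym (negbTE ji) mul0r mulr0 addr0.
Qed.

Lemma homog_rho : rho \is homog 2.
Proof.
apply: rpred_sum => i _; rewrite -[2%N]/(1 * 2)%N.
exact: mpoly.dhomogMn (homog_xvar i).
Qed.

Lemma lapl_rho : lapl rho = (2 * d)%:R.
Proof.
rewrite /lapl; under eq_bigr do rewrite mder_rho mpoly.mderivMn mder_xvar eqxx.
by rewrite sumr_const card_ord -mulrnA.
Qed.

(** In the Leibniz rule for the Laplacian, [rho] has Laplacian [2 * d], and Euler's identity turns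
    the cross term into [4 * n] times [p]. *)
Lemma lapl_rhoM n p : p \is homog n ->
  lapl (rho * p) = (2 * d + 4 * n)%:R *: p + rho * lapl p.
Proof.
move=> hp; rewrite laplM lapl_rho; congr (_ + _).
under eq_bigr do rewrite mder_rho mulrnAl.
rewrite sumrMnl (euler_homog hp) -mulrnA scaler_nat -mulrnA natrD.
by rewrite mulr_natl scalerDl !scaler_nat; congr (_ + _ *+ _); rewrite mulnC.
Qed.

Section Direction.
Variable y : 'I_d -> C.

(** [dir] is the linear form with coefficient vector [y], and [dder] the derivative in the direction
    [y]. *)
Definition dir : mpoly d C := \sum_i y i *: xvar i.
Definition dder p := \sum_i y i *: mder i p.

Lemma homog_dir : dir \is homog 1.
Proof. by apply: rpred_sum => i _; apply: rpredZ; exact: homog_xvar. Qed.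

Lemma mder_dir i : mder i dir = (y i)%:A.
Proof.
rewrite /dir raddf_sum (bigD1 i) //= big1 => [|j ji].
  by rewrite addr0 mpoly.mderivZ mder_xvar eqxx.
by rewrite mpoly.mderivZ mder_xvar eq_sym (negbTE ji) scaler0.
Qed.

Lemma dderD p q : dder (p + q) = dder p + dder q.
Proof.
by rewrite /dder -big_split; apply: eq_bigr => i _; rewrite /= raddfD scalerDr.
Qed.

Lemma dderZ (c : C) p : dder (c *: p) = c *: dder p.
Proof.
rewrite /dder scaler_sumr; apply: eq_bigr => i _.
by rewrite mpoly.mderivZ !scalerA mulrC.
Qed.

Lemma dderM p q : dder (p * q) = dder p * q + p * dder q.
Proof.
rewrite /dder mulr_suml mulr_sumr -big_split; apply: eq_bigr => i _ /=.
by rewrite mpoly.mderivM scalerDr scalerAl scalerAr.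
Qed.

Lemma homog_dder n p : p \is homog n -> dder p \is homog n.-1.
Proof. by move=> hp; apply: rpred_sum => i _; apply/rpredZ/homog_mder. Qed.

Lemma lapl_dder p : lapl (dder p) = dder (lapl p).
Proof.
have lapl0 : lapl 0 = 0 by have := laplZ 0 0; rewrite !scale0r.
rewrite /dder (big_morph lapl laplD lapl0).
by apply: eq_bigr => i _; rewrite laplZ lapl_mder.
Qed.

Lemma dder_rho : dder rho = dir *+ 2.
Proof.
rewrite /dder /dir -sumrMnl; apply: eq_bigr => i _.
by rewrite mder_rho scalerMnr.
Qed.

Lemma meval_dder n p : p \is homog n ->
  mpoly.meval y (dder p) = n%:R * mpoly.meval y p.
Proof.
move=> hp; rewrite -mpoly.mevalZ -(euler_homog hp) /dder !raddf_sum.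
by apply: eq_bigr => i _; rewrite /= mpoly.mevalZ mpoly.mevalM mpoly.mevalXU.
Qed.

Lemma lapl_dirM p : lapl (dir * p) = dder p *+ 2 + dir * lapl p.
Proof.
rewrite laplM (_ : lapl dir = 0); last first.
  by apply: big1 => i _; rewrite mder_dir mpoly.mderivZ mpoly.mderivC scaler0.
rewrite mul0r add0r; congr (_ *+ _ + _); apply: eq_bigr => i _.
by rewrite mder_dir -scalerAl mul1r.
Qed.

Hypothesis y1 : \sum_i y i ^+ 2 = 1.

Lemma dder_dir : dder dir = 1.
Proof.
rewrite /dder; under eq_bigr do rewrite mder_dir scalerA -expr2.
by rewrite -scaler_suml y1 scale1r.
Qed.

(** The three-term recurrence of the normalized Gegenbauer polynomials made homogeneous: the
    variable t becomes [dir], and the term of lower degree receives the factor [rho]. Carrying two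
    consecutive terms makes the recursion structural. *)
Fixpoint zonal_pair (n : nat) : mpoly d C * mpoly d C :=
  if n is n'.+1 then
    let: (p, q) := zonal_pair n' in
    (q, (n' + d.-1)%:R^-1 *:
          ((2 * n' + d)%:R *: (dir * q) - n'.+1%:R *: (rho * p)))
  else (1, dir).

Definition zonal n := (zonal_pair n).1.

Lemma zonal0 : zonal 0 = 1. Proof. by []. Qed.
Lemma zonal1 : zonal 1 = dir. Proof. by []. Qed.
Lemma zonalSS n : zonal n.+2 = (n + d.-1)%:R^-1 *:
  ((2 * n + d)%:R *: (dir * zonal n.+1) - n.+1%:R *: (rho * zonal n)).
Proof. by rewrite /zonal /=; case: (zonal_pair n). Qed.

Lemma zonal_ind2 (Q : nat -> Prop) :
  Q 0 -> Q 1 -> (forall n, Q n -> Q n.+1 -> Q n.+2) -> forall n, Q n.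
Proof.
move=> Q0 Q1 QSS n; suff [] : Q n /\ Q n.+1 by [].
by elim: n => // n [Qn QSn]; split => //; exact: QSS.
Qed.

Lemma homog_zonal n : zonal n \is homog n.
Proof.
elim/zonal_ind2: n => [||n hn hSn]; first exact: mpoly.dhomog1.
  exact: homog_dir.
rewrite zonalSS; apply/rpredZ/rpredB; apply: rpredZ.
  by rewrite -[n.+2]add1n; apply: mpoly.dhomogM => //; exact: homog_dir.
by rewrite -[n.+2]add2n; apply: mpoly.dhomogM => //; exact: homog_rho.
Qed.

Hypothesis d2 : (2 <= d)%N.

Lemma dderMn k p : dder (k%:R * p) = k%:R * dder p.
Proof. by rewrite mulr_natl -scaler_nat dderZ scaler_nat mulr_natl. Qed.

Lemma natr_scale k p : k%:R *: p = k%:R * p.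
Proof. by rewrite scaler_nat mulr_natl. Qed.

Lemma dderB p q : dder (p - q) = dder p - dder q.
Proof. by rewrite dderD -scaleN1r dderZ scaleN1r. Qed.

Lemma zonal_den_neq0 n : (n + d.-1)%:R != 0 :> C.
Proof.
by rewrite pnatr_eq0 -lt0n; case: d d2 => [|[|e]] // _; rewrite addnS.
Qed.

Lemma zonal_rec n : (n + d.-1)%:R * zonal n.+2 =
  (2 * n + d)%:R * (dir * zonal n.+1) - n.+1%:R * (rho * zonal n).
Proof.
by rewrite zonalSS -natr_scale scalerA divff ?zonal_den_neq0 // scale1r !natr_scale.
Qed.

(** Deriving along [y] lowers the degree inside the zonal family. This drives both the harmonicity
    of [zonal] and its reproducing property. The proof differentiates the recurrence and uses the
    statement in the two preceding degrees. *)
Lemma dder_zonal n : dder (zonal n.+1) = n.+1%:R * zonal n.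
Proof.
have dE : d = (d.-2 + 2)%N by rewrite addn2; case: d d2 => [|[]].
have d1E : d.-1 = d.-2.+1 by case: d d2 => [|[]].
have dR : d%:R = d.-2%:R + 2 :> mpoly d C by rewrite -natrD -dE.
have d1R : d.-1%:R = d.-2%:R + 1 :> mpoly d C by rewrite natr1 -d1E.
elim/ltn_ind: n => -[_|n IH].
  by rewrite zonal1 dder_dir mul1r.
apply: (scalerI (zonal_den_neq0 n)); rewrite !natr_scale -dderMn zonal_rec.
rewrite dderB !dderMn !dderM dder_dir dder_rho IH //.
have {IH} -> : dder (zonal n) = n%:R * zonal n.-1.
  case: n IH => [|n] IH; last exact: IH.
  by rewrite mul0r /dder big1 // => i _; rewrite zonal0 mpoly.mderivC scaler0.
(* The recurrence one degree lower eliminates [rho * zonal n.-1]; for [n = 0] both sides vanish. *)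
have rhoE : n%:R * (rho * zonal n.-1) =
    (2 * n + d)%:R * (dir * zonal n) - dir * zonal n *+ 2 - (n + d.-2)%:R * zonal n.+1.
  case: n => [|n].
    by rewrite zonal0 zonal1 muln0 !add0n dR; ring.
  have := zonal_rec n; rewrite !natrD !natrM d1R dR => E.
  have -> : (n.+1%:R + d.-2%:R : mpoly d C) = n%:R + (d.-2%:R + 1) by rewrite -natr1; ring.
  by rewrite E -natr1; ring.
have -> : rho * (n%:R * zonal n.-1) = n%:R * (rho * zonal n.-1) by ring.
rewrite rhoE (natrD _ (2 * n)) natrM (natrD _ n d.-2) (natrD _ n d.-1) d1R dR -[n.+2%:R]natr1.
by rewrite -[n.+1%:R]natr1; ring.
Qed.

(** In the Laplacian of the recurrence, the [dir] term contributes [(2n + d) * 2 * (n + 1)] times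
    [zonal n] by [dder_zonal], and the [rho] term [(n + 1) * (2d + 4n)] times the same polynomial;
    they cancel. *)
Lemma lapl_zonal n : lapl (zonal n) = 0.
Proof.
have laplMn k p : lapl (k%:R * p) = k%:R * lapl p.
  by rewrite mulr_natl -scaler_nat laplZ scaler_nat mulr_natl.
have lapl1 : lapl (zonal 0) = 0.
  by apply: big1 => i _; rewrite zonal0 !mpoly.mderivC.
elim/zonal_ind2: n => [//||n IH IH1].
  by rewrite zonal1 -[dir]mulr1 lapl_dirM [lapl 1]lapl1 mulr0 addr0 /dder big1 ?mul0rn // =>
    i _; rewrite mpoly.mderivC scaler0.
apply: (scalerI (zonal_den_neq0 n)); rewrite scaler0 natr_scale -laplMn zonal_rec.
rewrite laplD -scaleN1r laplZ scaleN1r !laplMn lapl_dirM IH1 (lapl_rhoM (homog_zonal n)).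
by rewrite IH dder_zonal !mulr0 !addr0 natr_scale (natrD _ (2 * n)) (natrD _ (2 * d)) !natrM;
  ring.
Qed.

End Direction.

(** The expectation of [p] at a vector of independent standard normal variables, defined
    algebraically through the moments of its monomials. The link with integrals is made in
    [gaussian_monomial]. *)
Definition gauss_mean p : C :=
  \sum_(m <- mpoly.msupp p) mpoly.mcoeff m p * (\prod_i normal_moment (m i))%:R.

(** A finite set of monomials that depends only on a degree bound; several polynomials can then be
    summed over the same set, which gives linearity. *)
Lemma gauss_meanE k p : (mpoly.mmeasure mpoly.mdeg p <= k)%N -> gauss_mean p =
  \sum_(m : mpoly.bmultinom d k) mpoly.mcoeff m p * (\prod_i normal_moment ((m : mpoly.multinom d) i))%:R.
Proof.
move=> le_pi; set I : subFinType _ := mpoly.bmultinom d k.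
rewrite /gauss_mean (ssrcomplements.big_mksub I) ?mpoly.msupp_uniq //=; first last.
  by move=> x /mpoly.msize_mdeg_lt /leq_trans; apply.
by rewrite big_rmcond //= => j /mpoly.memN_msupp_eq0 ->; rewrite mul0r.
Qed.

Lemma gauss_meanD p q : gauss_mean (p + q) = gauss_mean p + gauss_mean q.
Proof.
pose k := maxn (mpoly.mmeasure mpoly.mdeg (p + q))
  (maxn (mpoly.mmeasure mpoly.mdeg p) (mpoly.mmeasure mpoly.mdeg q)).
rewrite !(@gauss_meanE k) ?leq_max ?leqnn ?orbT // -big_split.
by apply: eq_bigr => m _; rewrite /= mpoly.mcoeffD mulrDl.
Qed.

Lemma gauss_meanZ (c : C) p : gauss_mean (c *: p) = c * gauss_mean p.
Proof.
pose k := maxn (mpoly.mmeasure mpoly.mdeg (c *: p)) (mpoly.mmeasure mpoly.mdeg p).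
rewrite !(@gauss_meanE k) ?leq_max ?leqnn ?orbT // mulr_sumr.
by apply: eq_bigr => m _; rewrite /= mpoly.mcoeffZ mulrA.
Qed.

Lemma gauss_mean_sum (I : Type) (s : seq I) (F : I -> mpoly d C) :
  gauss_mean (\sum_(i <- s) F i) = \sum_(i <- s) gauss_mean (F i).
Proof.
apply: (big_morph _ gauss_meanD).
by have := gauss_meanZ 0 0; rewrite scale0r mul0r.
Qed.

Lemma gauss_meanX m :
  gauss_mean (mpoly.mpolyX C m) = (\prod_i normal_moment (m i))%:R.
Proof. by rewrite /gauss_mean mpoly.msuppX big_seq1 mpoly.mcoeffX eqxx mul1r. Qed.

Lemma gauss_mean1 : gauss_mean 1 = 1.
Proof. by rewrite -mpoly.mpolyX0 gauss_meanX big1 // => i _; rewrite mpoly.mnm0E. Qed.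

(** Gaussian integration by parts (Stein's identity); on a monomial it is the recursion of
    [normal_moment] in the [i]-th exponent. *)
Lemma gauss_mean_stein i p : gauss_mean (xvar i * p) = gauss_mean (mder i p).
Proof.
move: p; apply: mpoly_lin_ext => [p q|p q|c m].
- by rewrite mulrDr gauss_meanD.
- by rewrite raddfD /= gauss_meanD.
rewrite -scalerAr mpoly.mderivZ mpoly.mderivX -mpoly.mpolyXD !gauss_meanZ !gauss_meanX.
congr (_ * _); rewrite -natrM; congr (_%:R).
rewrite (bigD1 i) //= [in RHS](bigD1 i) //= mulnA; congr (_ * _)%N.
  rewrite mpoly.mnmDE mpoly.mnmBE mpoly.mnm1E eqxx add1n subn1.
  exact: normal_momentS.
apply: eq_bigr => j ji; rewrite mpoly.mnmDE mpoly.mnmBE mpoly.mnm1E.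
by rewrite eq_sym (negbTE ji) add0n subn0.
Qed.

Lemma gauss_mean_rho n p : p \is homog n ->
  gauss_mean (rho * p) = (n + d)%:R * gauss_mean p.
Proof.
move=> hp; rewrite /rho mulr_suml gauss_mean_sum.
under eq_bigr do rewrite expr2 -mulrA gauss_mean_stein mpoly.mderivM mder_xvar eqxx mul1r
  gauss_meanD.
rewrite big_split /= sumr_const card_ord -gauss_mean_sum (euler_homog hp) gauss_meanZ.
by rewrite natrD mulrDl addrC [d%:R * _]mulr_natl.
Qed.

Lemma homog0_const p : p \is homog 0 -> exists c : C, p = c%:A.
Proof.
move=> hp; exists (mpoly.mcoeff mpoly.mnm0 p); rewrite mpoly.alg_mpolyC.
apply/mpoly.mpolyP => k; rewrite mpoly.mcoeffC.
have [->|k0] := eqVneq k mpoly.mnm0; first by rewrite mulr1.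
by rewrite mulr0 (mpoly.dhomog_nemf_coeff hp) //= mpoly.mdeg_eq0.
Qed.

Lemma gauss_mean0 : gauss_mean 0 = 0.
Proof. by have := gauss_meanZ 0 0; rewrite scale0r mul0r. Qed.

(** Euler's identity writes [h] as a sum of terms [xvar i * mder i h], and Stein's identity turns
    each factor [xvar i] into a derivative. The second derivatives of [h] add up to its Laplacian;
    in the remaining terms both degrees have dropped by one, and a constant [r] is killed. *)
Lemma gauss_mean_harmonic_low n m h r : h \is homog n -> lapl h = 0 ->
  r \is homog m -> (m < n)%N -> gauss_mean (h * r) = 0.
Proof.
elim: n m h r => // n IH m h r hh lh hr mn.
have n0 : n.+1%:R != 0 :> C by rewrite pnatr_eq0.
apply: (mulfI n0); rewrite mulr0 -gauss_meanZ scalerAl -(euler_homog hh).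
rewrite mulr_suml gauss_mean_sum.
under eq_bigr do rewrite -mulrA gauss_mean_stein mpoly.mderivM gauss_meanD.
rewrite big_split /= -gauss_mean_sum -mulr_suml [X in X * r]lh mul0r.
rewrite gauss_mean0 add0r big1 // => i _.
case: m hr mn => [|m] hr mn.
  have [c ->] := homog0_const hr.
  by rewrite mpoly.mderivZ mpoly.mderivC scaler0 mulr0 gauss_mean0.
apply: (IH m) => //; first exact: (homog_mder i hh).
  by rewrite lapl_mder lh mpoly.mderiv0.
exact: (homog_mder i hr).
Qed.

Lemma gauss_mean_dir y h r : gauss_mean (h * (dir y * r)) =
  gauss_mean (dder y h * r) + gauss_mean (h * dder y r).
Proof.
rewrite -gauss_meanD -dderM mulrCA /dir /dder mulr_suml !gauss_mean_sum.
by apply: eq_bigr => i _; rewrite -scalerAl !gauss_meanZ gauss_mean_stein.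
Qed.

(** The factor [b] is the same for all [y] and [h], which later makes the constant of the addition
    theorem independent of the points. In the recurrence for [zonal], the [rho] term has mean 0 by
    degree, and integration by parts moves [dir] onto [h], where the induction hypothesis
    applies. *)
Lemma gauss_mean_zonal n : (2 <= d)%N ->
  exists2 b : C, 0 < b & forall y h, \sum_i y i ^+ 2 = 1 -> h \is homog n -> lapl h = 0 ->
    gauss_mean (h * zonal y n) = b * mpoly.meval y h.
Proof.
move=> d2; elim/zonal_ind2: n => [||n _ [b b0 IH]].
- exists 1 => [|y h y1 /homog0_const[c ->] _]; first exact: ltr01.
  by rewrite zonal0 mulr1 mpoly.mevalZ mpoly.meval1 gauss_meanZ gauss_mean1 mul1r.
- exists 1 => [|y h y1 hh _]; first exact: ltr01.
  rewrite zonal1 -[dir y]mulr1 gauss_mean_dir mulr1 mul1r.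
  have -> : dder y 1 = 0 by apply: big1 => i _; rewrite mpoly.mderivC scaler0.
  rewrite mulr0 gauss_mean0 addr0 -[RHS]mul1r -(meval_dder y hh).
  have [c ->] := homog0_const (homog_dder y hh).
  by rewrite mpoly.mevalZ mpoly.meval1 gauss_meanZ gauss_mean1.
(* The first two factors are the coefficients of the recurrence; [n.+2] is the degree of [h],
   produced by Euler's identity when [dder y h] is evaluated at [y]. *)
exists ((n + d.-1)%:R^-1 * (2 * n + d)%:R * (b * n.+2%:R)).
  rewrite !mulr_gt0 // ?invr_gt0 ?ltr0n ?addn_gt0 //; case: d d2 => [|[|e]] //= _;
  by rewrite orbT.
move=> y h y1 hh lh; rewrite -[RHS]mulrA.
apply: (mulfI (zonal_den_neq0 d2 n)); rewrite !mulrA mulfV ?zonal_den_neq0 // mul1r.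
rewrite -gauss_meanZ scalerAr natr_scale zonal_rec // mulrBr -[- _]scaleN1r gauss_meanD gauss_meanZ.
have -> : h * (n.+1%:R * (rho * zonal y n)) = n.+1%:R *: (rho * (h * zonal y n)).
  by rewrite natr_scale; ring.
(* Used twice: for the [rho] term, and for the term where the derivative falls on [zonal y n.+1]. *)
have low : gauss_mean (h * zonal y n) = 0.
  by apply: (gauss_mean_harmonic_low hh lh (homog_zonal y n)); rewrite ltnS leqnSn.
rewrite gauss_meanZ (gauss_mean_rho (mpoly.dhomogM hh (homog_zonal y n))) low !mulr0 addr0.
rewrite -natr_scale -scalerAr gauss_meanZ gauss_mean_dir dder_zonal // -natr_scale.
rewrite -scalerAr gauss_meanZ low mulr0 addr0 IH //.
- by rewrite (meval_dder y hh) !mulrA.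
- exact: (homog_dder y hh).
- by rewrite lapl_dder lh /dder big1 // => i _; rewrite mpoly.mderiv0 scaler0.
Qed.

End MPolyCalculus.

(** * Gegenbauer recurrence *)

Section PowerSeries.
Variable R : realType.
Implicit Types (a b : nat -> R) (f g : R -> R) (z : R).

Definition unit_disc_sum a f :=
  forall z, `|z| < 1 -> pseries a z @ \oo --> f z.

Lemma unit_disc_sumD a b f g : unit_disc_sum a f -> unit_disc_sum b g ->
  unit_disc_sum (fun n => a n + b n) (fun z => f z + g z).
Proof.
move=> af bg z z1; rewrite (_ : pseries _ _ = pseries a z \+ pseries b z).
  by apply: cvgD; [exact: af|exact: bg].
apply/funext => n; rewrite /pseries /series /= -big_split.
by apply: eq_bigr => k _; rewrite /= mulrDl.
Qed.

Lemma unit_disc_sumZ c a f : unit_disc_sum a f ->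
  unit_disc_sum (fun n => c * a n) (fun z => c * f z).
Proof.
move=> af z z1; rewrite (_ : pseries _ _ = (fun n => c * pseries a z n)).
  by apply: cvgMr; exact: af.
apply/funext => n; rewrite /pseries /series /= mulr_sumr.
by apply: eq_bigr => k _; rewrite /= mulrA.
Qed.

Definition pseries_shift a n := if n is m.+1 then a m else 0.

Lemma unit_disc_sum_shift a f : unit_disc_sum a f ->
  unit_disc_sum (pseries_shift a) (fun z => z * f z).
Proof.
move=> af z z1; rewrite -cvg_shiftS /=.
rewrite (_ : (fun n => _) = (fun n => z * pseries a z n)).
  by apply: cvgMr; exact: af.
apply/funext => n; rewrite /pseries /series /= mulr_sumr big_nat_recl //=.
by rewrite mul0r add0r; apply: eq_bigr => k _; rewrite /= exprS mulrCA.
Qed.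

(** The factor [n.+1] created by differentiation is absorbed by enlarging the radius from [|z|] to
    some [x < 1], where the original series converges absolutely. *)
Lemma cvg_pseries_diffs a f : unit_disc_sum a f ->
  forall z, `|z| < 1 -> cvgn (pseries (pseries_diffs a) z).
Proof.
move=> af z z1; set q := `|z| in z1; have q0 : 0 <= q := normr_ge0 z.
(* With these choices [(1 + e) * q <= x], so Bernoulli's inequality [1 + n e <= (1 + e)^n] yields
   the bound [nle]. *)
pose x := (1 + q) / 2; pose e := (1 - q) / 2.
have x0 : 0 < x by rewrite /x; lra.
have x1 : x < 1 by rewrite /x; lra.
have e0 : 0 < e by rewrite /e; lra.
have nle n : n.+1%:R * q ^+ n <= e^-1 * x ^+ n.
  rewrite mulrC ler_pdivlMl //.
  have -> : e * (q ^+ n * n.+1%:R) = (e * n.+1%:R) * q ^+ n by ring.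
  apply: (@le_trans _ _ ((1 + e) ^+ n * q ^+ n)).
    apply: ler_wpM2r; first exact: exprn_ge0.
    have : 1 + n%:R * e <= (1 + e) ^+ n.
      elim: n => [|n IH]; first by rewrite expr0 mul0r addr0.
      rewrite exprS -natr1; have := ler_wpM2l (ltW (ltr_pwDl ltr01 (ltW e0))) IH.
      by apply: le_trans; have : 0 <= (n%:R : R) by []; nra.
    apply: le_trans; rewrite -natr1; have : 0 <= (n%:R : R) by [].
    by rewrite /e; nra.
  by rewrite -exprMn lerXn2r // ?nnegrE /x /e; nra.
have cx : cvgn (pseries (fun i => `|a i|) x).
  apply: (@is_cvg_pseries_inside_norm _ _ ((1 + x) / 2)).
    by apply/cvg_ex; eexists; apply: af; rewrite ger0_norm; lra.
  by rewrite !ger0_norm; lra.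
apply: normed_cvg.
apply: (@series_le_cvg _ _ (fun n => (e^-1 * x^-1) * (`|a n.+1| * x ^+ n.+1))).
- by move=> n; exact: normr_ge0.
- by move=> n; rewrite !mulr_ge0 // ?invr_ge0 ?exprn_ge0 // ltW.
- move=> n /=; rewrite /pseries_diffs !normrM normrX -/q ger0_norm //.
  have -> : e^-1 / x * (`|a n.+1| * x ^+ n.+1) = `|a n.+1| * (e^-1 * x ^+ n).
    by rewrite exprS; field; rewrite !gt_eqF.
  by rewrite mulrAC mulrC; apply: ler_wpM2l.
apply: is_cvg_seriesZ.
have : cvgn (fun n => pseries (fun i => `|a i|) x n.+1).
  by apply/cvg_ex; case/cvg_ex : cx => l cx; exists l; rewrite cvg_shiftS.
rewrite (_ : (fun n => _) = (fun n => `|a 0%N| + series (fun n => `|a n.+1| * x ^+ n.+1) n)).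
  by rewrite is_cvgDrE //; exact: is_cvg_cst.
by apply/funext => n; rewrite /pseries /series /= big_nat_recl //= expr0 mulr1.
Qed.

Lemma unit_disc_sum_deriv a f : unit_disc_sum a f ->
  exists2 f', unit_disc_sum (pseries_diffs a) f' &
    forall z, `|z| < 1 -> is_derive z 1 f (f' z).
Proof.
move=> af; exists (fun z => limn (pseries (pseries_diffs a) z)).
  by move=> z z1; exact: cvg_pseries_diffs af _ z1.
have af' : unit_disc_sum (pseries_diffs a) (fun z => limn (pseries (pseries_diffs a) z)).
  by move=> z z1; exact: cvg_pseries_diffs af _ z1.
(* Termwise differentiation at [z] requires the series and its first two formal derivatives to
   converge at a point farther from 0 than [z]. *)
move=> z z1; pose K := (1 + `|z|) / 2.
have K1 : `|K| < 1.
  by rewrite /K ger0_norm; [lra|have := normr_ge0 z; lra].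
have zK : `|z| < `|K|.
  by rewrite [ltRHS]ger0_norm /K; [lra|have := normr_ge0 z; lra].
have near1 : \forall x \near z, `|x| < 1.
  by have /cvgr_lt /(_ _ z1) := @norm_continuous R R z.
apply: (@near_eq_is_derive _ _ _ (fun x => limn (pseries a x))).
  by near=> x; apply: cvg_lim => //; apply: af; near: x.
apply: (pseries_snd_diffs _ _ _ zK).
- by apply/cvg_ex; eexists; exact: af.
- exact: af'.
- exact: (cvg_pseries_diffs af').
Unshelve. all: by end_near.
Qed.

(** Induction for all sequences at once: the value at 0 is the first coefficient, and the
    differentiated series sums to 0 again. *)
Lemma unit_disc_sum_eq0 a : unit_disc_sum a (fun=> 0) -> forall n, a n = 0.
Proof.
move=> a0 n; elim: n a a0 => [|n IH] a a0.
  have z0 : `|0 : R| < 1 by rewrite normr0.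
  have := a0 0 z0; rewrite -cvg_shiftS /= (_ : (fun n => _) = cst (a 0%N)).
    by move=> h; rewrite -(cvg_lim _ h) // lim_cst.
  apply/funext => n; rewrite /pseries /series /= big_nat_recl //= expr0 mulr1.
  by rewrite big1 ?addr0 // => i _; rewrite exprS mul0r mulr0.
have [f' af' df] := unit_disc_sum_deriv a0.
have f'0 z : `|z| < 1 -> f' z = 0.
  move=> z1; have h1 := df z z1; have h2 : is_derive z 1 (fun _ : R => 0 : R) 0 by exact: is_derive_cst.
  by rewrite -(@derive_val _ _ _ _ _ _ _ h1) (@derive_val _ _ _ _ _ _ _ h2).
have : pseries_diffs a n = 0.
  by apply: IH => z z1; rewrite -(f'0 z z1); exact: af'.
by move/eqP; rewrite mulf_eq0 pnatr_eq0 /= => /eqP.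
Qed.

(** The generating function satisfies [(1 - 2tz + z^2) f' = 2l (t - z) f]; the recurrence is the
    comparison of coefficients in this equation. *)
Lemma gegenbauer_recurrence (l t : R) (C : nat -> R -> R) :
  gegenbauer_generating l C -> -1 <= t <= 1 ->
  [/\ C 0 t = 1, C 1 t = 2 * l * t &
  forall n, n.+2%:R * C n.+2 t =
    2 * (n.+1%:R + l) * t * C n.+1 t - (n%:R + 2 * l) * C n t].
Proof.
move=> gC t1; pose a n := C n t; pose f (z : R) := (1 - 2 * t * z + z ^+ 2) `^ (- l).
have af : unit_disc_sum a f.
  move=> z z1; have := gC t z t1 z1; rewrite /pseries -/(f z).
  suff -> : (fun n => z ^+ n * C n t) = [sequence a i * z ^+ i]_i by [].
  by apply/funext => n; rewrite mulrC.
have [f' af' df] := unit_disc_sum_deriv af.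
have a0 : C 0%N t = 1.
  have z0 : `|0 : R| < 1 by rewrite normr0.
  have := af 0 z0; rewrite /f mulr0 subr0 expr0n /= addr0 powR1.
  rewrite -cvg_shiftS /= (_ : (fun n => _) = cst (a 0%N)).
    by move=> h; rewrite -(cvg_lim _ h) // lim_cst.
  apply/funext => n; rewrite /pseries /series /= big_nat_recl //= expr0 mulr1.
  by rewrite big1 ?addr0 // => i _; rewrite exprS mul0r mulr0.
have f'E z : `|z| < 1 -> (1 - 2 * t * z + z ^+ 2) * f' z = 2 * l * (t - z) * f z.
  move=> z1; pose u (z : R) : R := 1 - 2 * t * z + z ^+ 2.
  have u0 : 0 < u z.
    move: z1; rewrite ltr_norml => /andP[z1 z2]; case/andP: t1 => t1 t2.
    rewrite /u; have : 0 < (1 - z) ^+ 2 by rewrite exprn_gt0 // subr_gt0.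
    have : 0 < (1 + z) ^+ 2 by rewrite exprn_gt0 //; lra.
    move=> A B.
    (* A convex combination of two positive squares, hence positive for all [t] in [-1, 1]; the real
       power is therefore differentiable. *)
    have -> : 1 - 2 * t * z + z ^+ 2 = ((1 + t) * (1 - z) ^+ 2 + (1 - t) * (1 + z) ^+ 2) / 2.
      by field.
    rewrite divr_gt0 //; have [t0|t0] := leP 0 t.
      by rewrite ltr_wpDr // ?mulr_ge0 ?mulr_gt0 //; lra.
    by rewrite ltr_wpDl // ?mulr_ge0 ?mulr_gt0 //; lra.
  have du : is_derive z 1 u (- (2 * t) + z *+ 2).
    by rewrite /u; apply: is_derive_eq; rewrite /GRing.scale /= ?expr1; ring.
  have dp := is_derive1_powR (- l) u0.
  have := is_derive1_comp dp du => dfu.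
  have -> : f' z = - l * u z `^ (- l - 1) * (- (2 * t) + z *+ 2).
    by have h1 := df z z1; rewrite -(@derive_val _ _ _ _ _ _ _ h1) (@derive_val _ _ _ _ _ _ _ dfu).
  have E : u z * u z `^ (- l - 1) = u z `^ (- l).
    rewrite -[X in X * _](powRr1 (ltW u0)) -powRD; first by congr (_ `^ _); ring.
    by apply/implyP => _; rewrite gt_eqF.
  by rewrite /f -/(u z) -E; ring.
(* The coefficients of the differential equation, all terms moved to one side; each shift is a
   multiplication by [z]. *)
pose b n := pseries_diffs a n + - (2 * t) * pseries_shift (pseries_diffs a) n
  + pseries_shift (pseries_shift (pseries_diffs a)) n
  + - (2 * l * t) * a n + 2 * l * pseries_shift a n.
have b0 : forall n, b n = 0.
  apply: unit_disc_sum_eq0 => z z1.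
  have -> : 0 = f' z + - (2 * t) * (z * f' z) + z * (z * f' z) + - (2 * l * t) * f z
      + 2 * l * (z * f z).
    by have := f'E z z1; lra.
  move: z z1; do !apply: unit_disc_sumD => //; do ?apply: unit_disc_sumZ => //;
  by do ?apply: unit_disc_sum_shift.
split => //; first by have := b0 0%N; rewrite /b /pseries_shift /pseries_diffs /a a0; lra.
case => [|n].
  have := b0 1%N; rewrite /b /pseries_shift /pseries_diffs /a a0.
  by move=> h; have := b0 0%N; rewrite /b /pseries_shift /pseries_diffs /a a0; lra.
have := b0 n.+2; rewrite /b /pseries_shift /pseries_diffs /a -!natr1; lra.
Qed.

(** For [d = 2] this is the addition formula of the cosine. For [d > 2] the recurrence of the
    unnormalized polynomials is divided by their values at 1. *)
Lemma normalized_gegenbauer_recurrence (d : nat) (Ch : nat -> R -> R) (t : R) :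
  (2 <= d)%N -> normalized_gegenbauer ((d%:R - 2) / 2)%:E Ch -> -1 <= t <= 1 ->
  [/\ Ch 0 t = 1, Ch 1 t = t &
  forall n, (n + d.-1)%:R * Ch n.+2 t =
    (2 * n + d)%:R * t * Ch n.+1 t - n.+1%:R * Ch n t].
Proof.
move=> d2 + t1; have [e de] : exists e, d = e.+2 by exists d.-2; case: d d2 => [|[]].
have -> : (d%:R - 2) / 2 = e%:R / 2 :> R by rewrite de -addn2 natrD addrK.
rewrite /normalized_gegenbauer; have [e0 H|ne0 [C gC H]] := eqVneq.
  have {}e0 : e = 0%N.
    by apply/eqP; move/eqP: e0; rewrite mulf_eq0 invr_eq0 !pnatr_eq0 orbF.
  have ct : cos (acos t) = t by rewrite acosK.
  have ChE k : Ch k t = cos (k%:R * acos t) by rewrite -H ct.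
  split; [by rewrite ChE mul0r cos0|by rewrite ChE mul1r ct|move=> n].
  rewrite !ChE; set th := acos t.
  have -> : n.+2%:R * th = n.+1%:R * th + th by rewrite -(natr1 n.+1) mulrDl mul1r.
  have -> : n%:R * th = n.+1%:R * th - th by rewrite -(natr1 n) mulrDl mul1r addrK.
  by rewrite cosB cosD ct de e0 addn1 natrD natrM -natr1; ring.
have l0 : 0 < e%:R / 2 :> R by rewrite lt_def ne0 divr_ge0.
have e0 : 0 < e%:R :> R by move: l0; lra.
set l := e%:R / 2 in gC l0; have le : 2 * l = e%:R by rewrite /l; lra.
(* At [t = 1] the recurrence collapses to a first-order one, which gives both positivity and the
   ratio of consecutive normalizing values. *)
have cpos n : 0 < C n 1 /\ n.+1%:R * C n.+1 1 = (n%:R + e%:R) * C n 1.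
  have [C0 C1 CS] : [/\ C 0 1 = 1, C 1 1 = 2 * l * 1 & forall n, n.+2%:R * C n.+2 1 =
    2 * (n.+1%:R + l) * 1 * C n.+1 1 - (n%:R + 2 * l) * C n 1].
    by apply: (gegenbauer_recurrence gC); rewrite lexx andbT; lra.
  elim: n => [|n [Cn E]]; first by rewrite C0 C1 le; split; [exact: ltr01|ring].
  split.
    by rewrite -(pmulr_rgt0 _ (ltr0Sn R n)) E mulr_gt0 // ltr_wpDl.
  by rewrite CS; move: E; rewrite -!natr1 -le; lra.
have CnE n : C n 1 != 0 by rewrite gt_eqF //; case: (cpos n).
have [C0 C1 CS] := gegenbauer_recurrence gC t1.
have ChE k : Ch k t = C k t / C k 1 by rewrite H.
have [C10 C11] : C 0%N 1 = 1 /\ C 1%N 1 = 2 * l.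
  have t11 : -1 <= (1 : R) <= 1 by rewrite lexx andbT; lra.
  by have [-> -> _] := gegenbauer_recurrence gC t11; rewrite mulr1.
split; first by rewrite ChE C0 C10 divr1.
  by rewrite ChE C1 C11; field; rewrite gt_eqF.
move=> n; rewrite !ChE de /=.
have [_ E1] := cpos n; have [_ E2] := cpos n.+1.
have A2 : (n + e.+1)%:R = n.+2%:R * C n.+2 1 / C n.+1 1.
  by rewrite E2 mulfK // natrD -!natr1; ring.
have A1 : n.+1%:R = (n%:R + 2 * l) * C n 1 / C n.+1 1 by rewrite le -E1 mulfK.
have A0 : (2 * n + e.+2)%:R = 2 * (n.+1%:R + l).
  by rewrite natrD natrM -!natr1 -le; ring.
rewrite A2 A0 {2}A1.
have -> : n.+2%:R * C n.+2 1 / C n.+1 1 * (C n.+2 t / C n.+2 1) =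
   (n.+2%:R * C n.+2 t) / C n.+1 1 by field; rewrite !CnE.
by rewrite CS; field; rewrite !CnE.
Qed.

End PowerSeries.

(** * The normal law *)

Section GaussianMoments.
Variable R : realType.
Local Notation mR := (measurableTypeR R).
Local Notation lam := (@lebesgue_measure R).
Implicit Types (z x : R).

(** The fundamental theorem of calculus on [[-n, n]], with dominated convergence on the integral
    side and vanishing boundary terms on the other. *)
Lemma integral_deriv_eq0 (F f : R -> R) : continuous f ->
  (forall x, is_derive x 1 F (f x)) -> lam.-integrable setT (EFin \o f) ->
  F n%:R @[n --> \oo] --> 0 -> F (- n%:R) @[n --> \oo] --> 0 ->
  (\int[lam]_x (f x)%:E = 0)%E.
Proof.
move=> cf dF fi Fy FNy.
have cF : continuous F.
  move=> x; apply/differentiable_continuous/derivable1_diffP.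
  by have [] := dF x.
pose D (n : nat) := `[- n%:R, n%:R : R]%classic.
pose fn (n : nat) := (EFin \o f) \_ (D n).
have mf : measurable_fun setT f by exact: continuous_measurable_fun.
have [|||||_ _ H] := @dominated_convergence _ mR R lam setT measurableT fn (EFin \o f)
    (fun x => `|f x|%:E).
- move=> n; apply/(measurable_restrictT _ _).1; first exact: measurable_itv.
  by apply: measurable_funTS; exact/measurable_EFinP.
- exact/measurable_EFinP.
- apply: aeW => x _; apply: cvg_near_cst; near=> n.
  rewrite /fn patchE ifT // inE /D /= in_itv /= -ler_norml.
  by near: n; exact: nbhs_infty_ger.
- exact: integrable_abse fi.
- apply: aeW => x n _; rewrite /fn patchE; case: ifP => //=.
  by rewrite normr0 lee_fin.
(* The index is shifted because the interval has to be nondegenerate. *)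
have E n : (\int[lam]_x fn n.+1 x = (F n.+1%:R - F (- n.+1%:R))%:E)%E.
  rewrite /fn -integral_mkcond (@continuous_FTC2 _ f F) //.
  - by rewrite ltrNl (lt_trans (_ : _ < 0)) ?oppr_lt0 ?ltr0n.
  - exact: continuous_subspaceT.
  - split=> [x _||].
    + by have [] := dF x.
    + exact: cvg_at_right_filter (cF _).
    + exact: cvg_at_left_filter (cF _).
  - by move=> x _; rewrite derive1E; apply: derive_val.
have : (F n.+1%:R - F (- n.+1%:R))%:E @[n --> \oo] --> (\int[lam]_x (f x)%:E)%E.
  by rewrite -(funext E) (cvg_shiftS (fun n => \int[lam]_x fn n x)%E).
have h : F n.+1%:R - F (- n.+1%:R) @[n --> \oo] --> (0 : R).
  rewrite (cvg_shiftS (fun n => F n%:R - F (- n%:R))).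
  by have := cvgB Fy FNy; rewrite subrr; exact.
have : (F n.+1%:R - F (- n.+1%:R))%:E @[n --> \oo] --> 0%E.
  by apply: cvg_EFin; [exact: nearW|exact: h].
by move=> h1 h2; exact: (cvg_unique _ h2 h1).
Unshelve. all: by end_near.
Qed.

Lemma normal_pdf01E z :
  normal_pdf 0 1 z = normal_peak 1 * expR (- z ^+ 2 / 2) :> R.
Proof. by rewrite normal_pdfE ?oner_neq0 // /normal_fun subr0 expr1n. Qed.

(** Half of the exponent absorbs the power: for [|z| > 1], the power is at most [z^(2(k+1))], and
    one term of the exponential series bounds [(z^2/4)^(k+1)] by [(k+1)!] times [exp(z^2/4)]. The
    summand 1 in the constant serves [|z| <= 1]. *)
Lemma expr_gauss_bound k : exists2 C : R, 0 <= C &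
  forall z, `|z| ^+ k * expR (- z ^+ 2 / 2) <= C * expR (- z ^+ 2 / 4).
Proof.
exists (1 + 4 ^+ k.+1 * k.+1`!%:R); first by rewrite addr_ge0 ?mulr_ge0.
move=> z; have -> : - z ^+ 2 / 2 = - z ^+ 2 / 4 + - z ^+ 2 / 4 by field.
rewrite expRD mulrA; apply: ler_wpM2r; first exact: expR_ge0.
have -> : - z ^+ 2 / 4 = - (z ^+ 2 / 4) by ring.
rewrite expRN ler_pdivrMr ?expR_gt0 // mulrDl mul1r.
set q := z ^+ 2 / 4; have q0 : 0 <= q by rewrite divr_ge0 // sqr_ge0.
have E := expR_ge1Dxn k q0.
have E1 : 1 <= expR q by rewrite -expR0 ler_expR.
have [z1|z1] := leP `|z| 1.
  rewrite (le_trans (_ : _ <= 1)) ?exprn_ile1 //.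
  by rewrite (le_trans E1) // lerDl !mulr_ge0 // expR_ge0.
apply: (@le_trans _ _ (4 ^+ k.+1 * k.+1`!%:R * (q ^+ k.+1 / k.+1`!%:R))).
  have -> : 4 ^+ k.+1 * k.+1`!%:R * (q ^+ k.+1 / k.+1`!%:R) = (`|z| ^+ 2) ^+ k.+1.
    have fN : (k.+1`!%:R != 0 :> R) by rewrite pnatr_eq0 -lt0n fact_gt0.
    rewrite /q real_normK ?num_real // exprMn exprVn; field.
    by rewrite fN expf_neq0.
  rewrite -exprM; apply: ler_weXn2l; first exact: ltW.
  by rewrite mul2n -addnn; apply: leq_trans (leq_addr _ _).
rewrite ler_wpDl ?expR_ge0 // ler_wpM2l ?mulr_ge0 //.
by apply: le_trans E; rewrite lerDr.
Qed.

(** The majorant [exp(-z^2/4)] is, up to a constant, the normal density with standard deviation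
    [Num.sqrt 2]. *)
Lemma integrable_normal_moment k :
  lam.-integrable setT (fun z => (z ^+ k * normal_pdf 0 1 z)%:E).
Proof.
have [C C0 HC] := expr_gauss_bound k.
have s0 : Num.sqrt 2 != 0 :> R by rewrite gt_eqF // sqrtr_gt0.
have p0 : normal_peak (Num.sqrt 2) != 0 :> R by rewrite gt_eqF // normal_peak_gt0.
have p10 : 0 < normal_peak 1 :> R by rewrite normal_peak_gt0 ?oner_neq0.
apply: (@le_integrable _ mR R lam setT measurableT _
  (fun z => ((normal_peak 1 * C / normal_peak (Num.sqrt 2)) *
             normal_pdf 0 (Num.sqrt 2) z)%:E)).
- apply/measurable_EFinP; apply: measurable_funM; first exact: measurable_funX.
  exact: measurable_normal_pdf.
- move=> z _ /=; rewrite lee_fin normrM normrX.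
  rewrite [ leRHS]ger0_norm; last first.
    by rewrite !mulr_ge0 ?normal_pdf_ge0 ?normal_peak_ge0 // invr_ge0 normal_peak_ge0.
  rewrite (ger0_norm (normal_pdf_ge0 _ _ _)) normal_pdf01E.
  rewrite normal_pdfE // /normal_fun subr0 sqr_sqrtr // -mulrA -[2 *+ 2]mulr_natr.
  have -> : (2 * 2%:R = 4 :> R) by ring.
  rewrite mulKf // -mulrA mulrCA ler_wpM2l ?(ltW p10) //; exact: HC.
- under eq_fun do rewrite EFinM.
  by apply: integrableZl => //; exact: integrable_normal_pdf.
Qed.

(** The derivative of [z^j] times the density is [j z^(j-1) - z^(j+1)] times the density; its
    integral vanishes, which is the recursion of [normal_moment]. *)
Lemma integral_normal_moment k :
  (\int[lam]_z (z ^+ k * normal_pdf 0 1 z)%:E = (normal_moment k)%:R%:E)%E.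
Proof.
have stein j : (\int[lam]_z (z ^+ j.+1 * normal_pdf 0 1 z)%:E =
    j%:R%:E * \int[lam]_z (z ^+ j.-1 * normal_pdf 0 1 z)%:E)%E.
  pose F z : R := z ^+ j * normal_pdf 0 1 z.
  pose f z : R := j%:R * (z ^+ j.-1 * normal_pdf 0 1 z) - z ^+ j.+1 * normal_pdf 0 1 z.
  have cp : continuous (normal_pdf 0 1 : R -> R).
    by apply: continuous_normal_pdf; exact: oner_neq0.
  have cX i : continuous (fun z : R => z ^+ i) by move=> z; exact: exprn_continuous.
  have dF x : is_derive x 1 F (f x).
    have pE : normal_pdf 0 1 = (fun z : R => normal_peak 1 * expR (- z ^+ 2 / 2)).
      by apply/funext => z; rewrite normal_pdf01E.
    pose u (z : R) : R := - z ^+ 2 / 2.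
    have d1 : is_derive x 1 u (- x).
      by rewrite /u; apply: is_derive_eq; rewrite /GRing.scale /=; field.
    have d2 := @is_derive1_comp R expR u x _ _ (is_derive_expR (u x)) d1.
    have d3 := is_deriveZ (normal_peak 1) d2.
    have dX : is_derive x 1 (fun z : R => z ^+ j) (j%:R * x ^+ j.-1).
      by have := is_deriveX j (is_derive_id x 1); rewrite fctE /GRing.scale /= mulr1.
    have d4 := is_deriveM dX d3.
    rewrite /F /f pE; apply: (is_derive_eq d4).
    rewrite /GRing.scale /= (exprS x j) -/(u x).
    move: (x ^+ j.-1) (x ^+ j) (expR (u x)) => a b e.
    by rewrite -[normal_peak 1 *: e]/(normal_peak 1 * e); ring.
  have fi : lam.-integrable setT (EFin \o f).
    rewrite /f (_ : _ \o _ = (fun z => j%:R%:E * (z ^+ j.-1 * normal_pdf 0 1 z)%:E -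
        (z ^+ j.+1 * normal_pdf 0 1 z)%:E)%E) //.
    by apply: integrableB => //; [apply: integrableZl => //|]; exact: integrable_normal_moment.
  have [C C0 HC] := expr_gauss_bound j.+1.
  have F0 (u : nat -> R) : (forall n, `|u n| = n%:R) -> F (u n) @[n --> \oo] --> 0.
    move=> uE; rewrite -cvg_shiftS; apply/norm_cvg0P.
    apply: (@squeeze_cvgr _ _ _ _ (cst 0) (fun n => normal_peak 1 * C * n.+1%:R^-1)).
    - apply: nearW => n /=; rewrite normr_ge0 /= /F normrM normrX uE.
      rewrite (ger0_norm (normal_pdf_ge0 _ _ _)) normal_pdf01E ler_pdivlMr ?ltr0n //.
      have := HC (u n.+1); rewrite uE exprS => HC1.
      have E1 : expR (- u n.+1 ^+ 2 / 4) <= 1.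
        by rewrite -expR0 ler_expR mulNr oppr_le0 divr_ge0 // sqr_ge0.
      have {E1}HC2 := le_trans HC1 (ler_wpM2l C0 E1).
      rewrite mulr1 in HC2; apply: le_trans (ler_wpM2l (normal_peak_ge0 1) HC2).
      by rewrite le_eqVlt; apply/orP; left; apply/eqP; ring.
    - exact: cvg_cst.
    - rewrite -(mulr0 (normal_peak 1 * C)); apply: cvgMr; exact: cvg_harmonic.
  have cf : continuous f.
    move=> x; apply: cvgB; first by apply: cvgMr; apply: cvgM; [exact: cX|exact: cp].
    by apply: cvgM; [exact: cX|exact: cp].
  have := integral_deriv_eq0 cf dF fi (F0 (fun n => n%:R) _) (F0 (fun n => - n%:R) _).
  rewrite /f; under eq_integral do rewrite EFinB EFinM.
  rewrite integralB //; last 2 first.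
  - by apply: integrableZl => //; exact: integrable_normal_moment.
  - exact: integrable_normal_moment.
  rewrite integralZl //; last exact: integrable_normal_moment.
  have fin i : exists a, (\int[lam]_z (z ^+ i * normal_pdf 0 1 z)%:E = a%:E)%E.
    by eexists; exact/esym/fineK/(integrable_fin_num _ (integrable_normal_moment i)).
  have [a ->] := fin j.-1; have [b ->] := fin j.+1.
  rewrite -EFinM -EFinB => H; congr (_%:E); apply/esym/eqP; rewrite -subr_eq0.
  by apply/eqP/EFin_inj/H => n; rewrite ?normrN ger0_norm.
elim/ltn_ind: k => -[_|k IH].
  by under eq_integral do rewrite expr0 mul1r; rewrite integral_normal_pdf.
rewrite stein normal_momentS; case: k IH => [|k] IH; first by rewrite mul0e.
by rewrite IH // -EFinM natrM.
Qed.

End GaussianMoments.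

Section NormalLaw.
Variable R : realType.
Local Notation mR := (measurableTypeR R).
Local Notation lam := (@lebesgue_measure R).
Local Notation N01 := (@normal_prob R 0 1).

Lemma integrable_normal01_moment k :
  N01.-integrable setT (fun z : mR => (z ^+ k)%:E).
Proof.
have mk : measurable_fun setT (fun z : mR => z ^+ k : R) by exact: measurable_funX.
apply/(@integrable_density _ mR R lam N01 _ (@normal_pdf_ge0 R 0 1)
  (measurable_normal_pdf 0 1) (fun _ _ => erefl) _ mk).
exact: integrable_normal_moment.
Qed.

Lemma integral_normal01_moment k :
  (\int[N01]_z (z ^+ k)%:E = (normal_moment k)%:R%:E)%E.
Proof.
rewrite -integral_normal_moment.
apply: (@integral_density _ mR R lam N01 _ (@normal_pdf_ge0 R 0 1)
  (measurable_normal_pdf 0 1) (fun _ _ => erefl)).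
- exact: measurable_funX.
- exact: integrable_normal01_moment.
Qed.

Lemma normal_pdf_affine (m s z : R) : 0 < s ->
  normal_pdf m s (s * z + m) = s^-1 * normal_pdf 0 1 z.
Proof.
move=> s0; rewrite normal_pdf01E normal_pdfE ?gt_eqF // /normal_fun addrK.
rewrite mulrA; congr (_ * expR _); last by field; rewrite gt_eqF.
rewrite /normal_peak expr1n mul1r -mulrnAr sqrtrM ?sqr_ge0 // sqrtr_sqr.
by rewrite gtr0_norm // invfM.
Qed.

Lemma normal_prob_affine (m s : R) (B : set mR) : 0 < s -> measurable B ->
  normal_prob m s B = N01 ((fun z => s * z + m) @^-1` B).
Proof.
move=> s0 mB; have mphi : measurable_fun [set: mR] (fun x : mR => s * x + m : mR).
  by apply: measurable_funD => //; exact: measurable_funM.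
rewrite /normal_prob integral_mkcond [RHS]integral_mkcond.
pose F := (fun x : R => (normal_pdf m s x)%:E) \_ B.
have F0 x : (0 <= F x)%E by rewrite /F patchE; case: ifP; rewrite ?lee_fin ?normal_pdf_ge0.
have mF : measurable_fun [set: mR] F.
  apply/(measurable_restrictT _ _).1 => //; apply: measurable_funTS.
  by apply/measurable_EFinP; exact: measurable_normal_pdf.
have := ge0_integral_affine m s0 F0 mF.
have mG : measurable_fun [set: mR] (fun x : mR => F (s * x + m)).
  exact: (measurableT_comp mF mphi).
move=> E; transitivity (s%:E * \int[lam]_x F (s * x + m)%R)%E.
  by rewrite E muleA -EFinM mulfV ?gt_eqF // mul1e.
rewrite -(ge0_integralZl lam measurableT mG) //; last by rewrite lee_fin ltW.
apply: eq_integral => z _; rewrite /F !patchE.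
have -> : (z \in (fun z => s * z + m) @^-1` B) = (s * z + m \in B) by [].
case: ifP => _; last by rewrite mule0.
by rewrite normal_pdf_affine // -EFinM mulVKf ?gt_eqF.
Qed.

Context d (T : measurableType d) (P : probability T R).
Implicit Types X Y : T -> R.

(* Writing the normal law as the image of N(0, 1) makes the degenerate case s = 0 uniform. *)
Definition normal_law X (m s : R) := [/\ measurable_fun setT X, 0 <= s &
  forall B : set mR, measurable B -> P (X @^-1` B) = N01 ((fun z => s * z + m) @^-1` B)].

Lemma gaussian_rvP X : gaussian_rv P X <-> exists m s, normal_law X m s.
Proof.
have lawE m s (B : set mR) : 0 <= s -> measurable B ->
    (if s == 0 then \d_m B else normal_prob m s B) = N01 ((fun z => s * z + m) @^-1` B).
  move=> s0 mB; case: eqVneq => [->|sN].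
    rewrite (_ : (fun z => _) = cst m); last by apply/funext => z; rewrite mul0r add0r.
    by rewrite diracE preimage_cst; case: ifP => _; rewrite ?measure0 ?probability_setT.
  by apply: normal_prob_affine => //; rewrite lt_def sN.
split=> [[mX [m [s [s0 H]]]]|[m [s [mX s0 H]]]].
- by exists m, s; split=> // B mB; rewrite H //; exact: lawE.
- by split=> //; exists m, s; split=> // B mB; rewrite H //; apply/esym/lawE.
Qed.

Lemma ge0_integral_normal_law X m s (F : mR -> \bar R) : normal_law X m s ->
  measurable_fun setT F -> (forall x, 0 <= F x)%E ->
  (\int[P]_w F (X w) = \int[N01]_z F (s * z + m)%R)%E.
Proof.
move=> [mX s0 H] mF F0.
have mphi : measurable_fun [set: mR] (fun x : mR => s * x + m : mR).
  by apply: measurable_funD => //; exact: measurable_funM.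
have E1 := @ge0_integral_pushforward _ _ _ mR R X mX P setT F measurableT mF (fun x _ => F0 x).
have E2 := @ge0_integral_pushforward _ _ _ mR R _ mphi N01 setT F measurableT mF (fun x _ => F0 x).
rewrite !preimage_setT in E1 E2; rewrite -E1 -E2.
by apply: eq_measure_integral => A mA _; exact: H.
Qed.

End NormalLaw.

(** * Square integrable random variables *)

Section SquareIntegrable.
Context d (T : measurableType d) (R : realType) (P : probability T R).
Implicit Types X Y Z : T -> R.
Local Notation L2 := (Lfun P 2%:E).
Local Notation "''Ex' X" := (\int[P]_w X w)%R (at level 10, X at next level).

Lemma Lnorm2_sqr (f : T -> \bar R) :
  (Lnorm P 2%:E f `^ 2 = \int[P]_w (`|f w| `^ 2))%E.
Proof. by rewrite powR_Lnorm // pnatr_eq0. Qed.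

Lemma Lnorm2E X : (Lnorm P 2%:E (EFin \o X) `^ 2 = \int[P]_w (X w ^+ 2)%:E)%E.
Proof.
rewrite Lnorm2_sqr; apply: eq_integral => w _ /=.
by rewrite powR_mulrn // real_normK ?num_real.
Qed.

Lemma Lfun2P X : X \in L2 <->
  measurable_fun setT X /\ (\int[P]_w (X w ^+ 2)%:E < +oo)%E.
Proof.
split=> [XL2|[mX XL2]].
  split; first by have /andP[/[!inE]] := XL2.
  have /integrableP[_] := Lfun2_integrable_sqr XL2.
  by under eq_integral do rewrite /= ger0_norm ?sqr_ge0 //.
rewrite inE; apply/andP; split; first by rewrite inE.
rewrite inE /= /finite_norm; apply: (@lty_poweRy _ _ 2); first by rewrite pnatr_eq0.
by rewrite Lnorm2E.
Qed.

Lemma measurable_L2 X : X \in L2 -> measurable_fun setT X.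
Proof. by move=> /Lfun2P[]. Qed.

Let L2_lin a X Y : X \in L2 -> Y \in L2 -> a *: X + Y \in L2.
Proof. by have [_] := @Lfun_submod_closed _ _ _ P 2%:E (lee1n 2); exact. Qed.

Lemma L2_0 : (fun=> 0) \in L2.
Proof. by have [] := @Lfun_submod_closed _ _ _ P 2%:E (lee1n 2). Qed.

Lemma L2D X Y : X \in L2 -> Y \in L2 -> (fun w => X w + Y w) \in L2.
Proof.
move=> hX hY; have := L2_lin 1 hX hY; rewrite scale1r; exact.
Qed.

Lemma L2Z a X : X \in L2 -> (fun w => a * X w) \in L2.
Proof.
move=> hX; have -> : (fun w => a * X w) = a *: X + (fun=> 0).
  by apply/funext => w; exact/esym/addr0.
exact: (L2_lin a hX L2_0).
Qed.

Lemma L2B X Y : X \in L2 -> Y \in L2 -> (fun w => X w - Y w) \in L2.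
Proof.
move=> hX hY; have := L2D hX (L2Z (-1) hY).
by under eq_fun do rewrite mulN1r.
Qed.

Lemma L2_sum (I : Type) (s : seq I) (p : pred I) (F : I -> T -> R) :
  (forall i, p i -> F i \in L2) -> (fun w => \sum_(i <- s | p i) F i w) \in L2.
Proof.
move=> hF; elim: s => [|i s IH].
  by under eq_fun do rewrite big_nil; exact: L2_0.
have [pi|/negbTE pi] := boolP (p i); under eq_fun do rewrite big_cons pi.
  by apply: L2D => //; exact: hF.
exact: IH.
Qed.

Lemma L2_integrable X : X \in L2 -> P.-integrable setT (EFin \o X).
Proof.
by move=> hX; apply/Lfun1_integrable; apply: (Lfun_subset12 _ hX); exact: fin_num_measure.
Qed.

Lemma L2M_integrable X Y : X \in L2 -> Y \in L2 ->
  P.-integrable setT (EFin \o (fun w => X w * Y w)).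
Proof. by move=> hX hY; apply/Lfun1_integrable; exact: Lfun2_mul_Lfun1. Qed.

Lemma L2MZ_integrable a X Y : X \in L2 -> Y \in L2 ->
  P.-integrable setT (EFin \o (fun w => a * (X w * Y w))).
Proof.
by move=> hX hY; have := L2M_integrable (L2Z a hX) hY; under eq_fun do rewrite -mulrA.
Qed.

Lemma L2_cst c : cst c \in L2. Proof. exact: Lfun_cst. Qed.

(** Real-valued through [Rintegral], hence bilinear only under integrability; this is why membership
    in L2 accompanies each rule below. *)
Definition ip X Y : R := \int[P]_w (X w * Y w).

Lemma ipC X Y : ip X Y = ip Y X.
Proof. by apply: eq_Rintegral => w _; rewrite mulrC. Qed.

Lemma ipDl X Y Z : X \in L2 -> Y \in L2 -> Z \in L2 ->
  ip (fun w => X w + Y w) Z = ip X Z + ip Y Z.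
Proof.
move=> hX hY hZ; rewrite /ip -RintegralD //; try exact: L2M_integrable.
by apply: eq_Rintegral => w _; rewrite mulrDl.
Qed.

Lemma ipZl a X Y : X \in L2 -> Y \in L2 -> ip (fun w => a * X w) Y = a * ip X Y.
Proof.
move=> hX hY; rewrite /ip -RintegralZl //; try exact: L2M_integrable.
by apply: eq_Rintegral => w _; rewrite mulrA.
Qed.

Lemma ipBl X Y Z : X \in L2 -> Y \in L2 -> Z \in L2 ->
  ip (fun w => X w - Y w) Z = ip X Z - ip Y Z.
Proof.
move=> hX hY hZ; rewrite /ip -RintegralB //; try exact: L2M_integrable.
by apply: eq_Rintegral => w _; rewrite mulrBl.
Qed.

Lemma ipDr X Y Z : X \in L2 -> Y \in L2 -> Z \in L2 ->
  ip Z (fun w => X w + Y w) = ip Z X + ip Z Y.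
Proof. by move=> hX hY hZ; rewrite ipC ipDl // !(ipC Z). Qed.

Lemma ipZr a X Y : X \in L2 -> Y \in L2 -> ip X (fun w => a * Y w) = a * ip X Y.
Proof. by move=> hX hY; rewrite ipC ipZl // ipC. Qed.

Lemma ipBr X Y Z : X \in L2 -> Y \in L2 -> Z \in L2 ->
  ip Z (fun w => X w - Y w) = ip Z X - ip Z Y.
Proof. by move=> hX hY hZ; rewrite ipC ipBl // !(ipC Z). Qed.

Lemma ip_suml (I : Type) (s : seq I) (p : pred I) (F : I -> T -> R) Y :
  (forall i, p i -> F i \in L2) -> Y \in L2 ->
  ip (fun w => \sum_(i <- s | p i) F i w) Y = \sum_(i <- s | p i) ip (F i) Y.
Proof.
move=> hF hY; elim: s => [|i s IH].
  rewrite big_nil /ip; under eq_Rintegral do rewrite big_nil mul0r.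
  by rewrite Rintegral_cst // mul0r.
rewrite big_cons -IH; case: ifP => pi; last first.
  by congr ip; apply/funext => w; rewrite big_cons pi.
rewrite -ipDl //; [|exact: hF|exact: L2_sum].
by congr ip; apply/funext => w; rewrite big_cons pi.
Qed.

Lemma ip_sumr (I : Type) (s : seq I) (p : pred I) (F : I -> T -> R) Y :
  (forall i, p i -> F i \in L2) -> Y \in L2 ->
  ip Y (fun w => \sum_(i <- s | p i) F i w) = \sum_(i <- s | p i) ip Y (F i).
Proof.
by move=> hF hY; rewrite ipC ip_suml //; apply: eq_bigr => i _; rewrite ipC.
Qed.

Lemma ip_ge0 X : 0 <= ip X X.
Proof. by apply: Rintegral_ge0 => w _; rewrite -expr2 sqr_ge0. Qed.

Lemma ipE X : X \in L2 -> ((ip X X)%:E = \int[P]_w (X w ^+ 2)%:E)%E.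
Proof.
move=> hX; rewrite /ip fineK; first by apply: eq_integral => w _; rewrite expr2.
exact: integrable_fin_num (L2M_integrable hX hX).
Qed.

(* Young's inequality at a free scale; the scale is optimised when passing to limits. *)
Lemma ip_young e X Y : 0 < e -> X \in L2 -> Y \in L2 ->
  `|ip X Y| <= e * ip X X + e^-1 * ip Y Y.
Proof.
move=> e0 hX hY; have ie0 : 0 < e^-1 by rewrite invr_gt0.
rewrite /ip -!RintegralZl //; try exact: L2M_integrable.
rewrite -RintegralD //; try exact: L2MZ_integrable.
have iXY := L2M_integrable hX hY.
apply: (le_trans (le_normr_Rintegral measurableT iXY)).
apply: le_Rintegral => //.
- exact: integrable_norm iXY.
- have h1 := L2MZ_integrable e hX hX; have h2 := L2MZ_integrable e^-1 hY hY.
  exact: (@integrableD _ _ _ P _ measurableT _ _ h1 h2).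
move=> w _; set x := X w; set y := Y w.
have H (u v : R) : u * v <= e * (u * u) + e^-1 * (v * v).
  have ee : e * e^-1 = 1 by rewrite mulfV ?gt_eqF.
  have : 0 <= e * (u - e^-1 * v) ^+ 2 by rewrite mulr_ge0 ?sqr_ge0 // ltW.
  have : 0 <= e * (u * u) by rewrite mulr_ge0 ?(ltW e0) // -expr2 sqr_ge0.
  have : 0 <= e^-1 * (v * v) by rewrite mulr_ge0 ?(ltW ie0) // -expr2 sqr_ge0.
  have -> : e * (u - e^-1 * v) ^+ 2 = e * (u * u) - 2 * (e * e^-1) * (u * v)
     + e * e^-1 * e^-1 * (v * v) by ring.
  by rewrite ee; lra.
rewrite ler_norml H andbT lerNl; have := H (- x) y.
by rewrite mulNr mulrN mulNr opprK.
Qed.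

(** Convergence of the squared distance, which keeps square roots out of the estimates; [cvg_L2P]
    connects it with the norm of the statement. *)
Definition cvgL2 (S : nat -> T -> R) X :=
  (fun n => ip (fun w => S n w - X w) (fun w => S n w - X w)) @ \oo --> (0 : R).

Lemma Lnorm2_ip X : X \in L2 -> Lnorm P 2%:E (EFin \o X) = (Num.sqrt (ip X X))%:E.
Proof.
move=> hX; have := Lnorm2E X; rewrite -ipE //.
have := Lnorm_ge0 P 2%:E (EFin \o X).
have : (Lnorm P 2%:E (EFin \o X) < +oo)%E by have /andP[_ /[!inE]] := hX.
case: (Lnorm _ _ _) => [l| |] //= _; rewrite lee_fin => l0.
rewrite powR_mulrn // => -[<-]; congr (_%:E).
by rewrite sqrtr_sqr ger0_norm.
Qed.

Lemma cvg_L2P (S : nat -> T -> R) X :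
  cvg_L2 P S X <-> [/\ forall n, S n \in L2, X \in L2 & cvgL2 S X].
Proof.
have E n : S n \in L2 -> X \in L2 -> Lnorm P 2%:E (fun w => (S n w - X w)%:E) =
    (Num.sqrt (ip (fun w => S n w - X w) (fun w => S n w - X w)))%:E.
  by move=> hS hX; rewrite -Lnorm2_ip //; exact: L2B.
split=> -[hS hX H]; split=> //.
- have : (fun n => (Num.sqrt (ip (fun w => S n w - X w) (fun w => S n w - X w)))%:E) @ \oo --> (0 : R)%:E.
    by under eq_fun do rewrite -E //.
  move=> /fine_cvgP[_ /= H1].
  rewrite /cvgL2; pose D n w := S n w - X w.
  have -> : (fun n => ip (D n) (D n)) =
      (fun n => Num.sqrt (ip (D n) (D n)) * Num.sqrt (ip (D n) (D n))).
    by apply/funext => n; rewrite -expr2 sqr_sqrtr // ip_ge0.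
  by rewrite -(mulr0 0); exact: cvgM.
- under eq_fun do rewrite E //.
  apply: cvg_EFin; first exact: nearW.
  apply/cvgr0Pnorm_lt => e e0; have e20 : 0 < e ^+ 2 by exact: exprn_gt0.
  have /cvgr0Pnorm_lt /(_ _ e20) H2 := H; apply: filterS H2 => n /=.
  rewrite ger0_norm ?ip_ge0 // (ger0_norm (sqrtr_ge0 _)) => h.
  by rewrite -(ger0_norm (ltW e0)) -sqrtr_sqr ltr_sqrt.
Qed.

(** The difference of the inner products splits into two terms with one error factor and one term
    with two; each is controlled by [ip_young]. *)
Lemma cvgL2_ip (S S' : nat -> T -> R) X X' :
  (forall n, S n \in L2) -> X \in L2 -> cvgL2 S X ->
  (forall n, S' n \in L2) -> X' \in L2 -> cvgL2 S' X' ->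
  (fun n => ip (S n) (S' n)) @ \oo --> ip X X'.
Proof.
move=> hS hX SX hS' hX' SX'.
pose D n w := S n w - X w; pose D' n w := S' n w - X' w.
have hD n : D n \in L2 by exact: L2B.
have hD' n : D' n \in L2 by exact: L2B.
have small (A : nat -> T -> R) Y : (forall n, A n \in L2) -> Y \in L2 ->
    (fun n => ip (A n) (A n)) @ \oo --> (0 : R) -> (fun n => ip (A n) Y) @ \oo --> (0 : R).
  move=> hA hY A0; apply/cvgr0Pnorm_lt => e e0.
  (* With this scale both terms of Young's inequality are at most [e / 2] as soon as
     [ip (A n) (A n) < e * c / 2]; the summand 1 avoids a division by zero. *)
  pose c := e / (2 * (1 + ip Y Y)).
  have y0 : 0 < 1 + ip Y Y by rewrite ltr_pwDl // ip_ge0.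
  have c0 : 0 < c by rewrite /c divr_gt0 // mulr_gt0.
  have ec : 0 < e * c / 2 by rewrite divr_gt0 // mulr_gt0.
  have /cvgr0Pnorm_lt /(_ _ ec) A1 := A0; apply: filterS A1 => n.
  rewrite ger0_norm ?ip_ge0 // => An.
  have ic0 : 0 < c^-1 by rewrite invr_gt0.
  apply: le_lt_trans (ip_young ic0 (hA n) hY) _; rewrite invrK.
  have h1 : c^-1 * ip (A n) (A n) < e / 2.
    by rewrite mulrC ltr_pdivrMr // mulrAC.
  have h2 : c * ip Y Y <= e / 2.
    have -> : e / 2 = c * (1 + ip Y Y) by rewrite /c; field; rewrite gt_eqF.
    by rewrite ler_wpM2l ?(ltW c0) // lerDr.
  by lra.
have -> : (fun n => ip (S n) (S' n)) =
   (fun n => ip (D n) X' + ip (D' n) X + ip (D n) (D' n) + ip X X').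
  apply/funext => n.
  have SE : S n = (fun w => D n w + X w) by apply/funext => w; rewrite subrK.
  have S'E : S' n = (fun w => D' n w + X' w) by apply/funext => w; rewrite subrK.
  rewrite SE S'E ipDl //; last by exact: L2D.
  by rewrite (ipDr (hD' n) hX' (hD n)) (ipDr (hD' n) hX' hX) (ipC X (D' n)); ring.
rewrite -[X in _ --> X]add0r -[X in _ --> X + _]add0r -[X in _ --> X + _ + _]add0r.
apply: cvgD; last exact: cvg_cst.
apply: cvgD; first by apply: cvgD; exact: small.
have DD : (fun n => ip (D n) (D n) + ip (D' n) (D' n)) @ \oo --> (0 : R).
  by rewrite -[X in _ --> X]addr0; exact: cvgD.
apply/norm_cvg0P; apply: (squeeze_cvgr _ (cvg_cst 0) DD).
apply: nearW => n; rewrite normr_ge0 /=.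
by apply: le_trans (ip_young ltr01 (hD n) (hD' n)) _; rewrite invr1 !mul1r.
Qed.

Lemma cvgL2_ip_sqr (S : nat -> T -> R) X : (forall n, S n \in L2) -> X \in L2 ->
  cvgL2 S X -> (fun n => ip (S n) (S n)) @ \oo --> ip X X.
Proof. by move=> hS hX SX; exact: cvgL2_ip. Qed.

(** From [(u + v)^2 <= 2 u^2 + 2 v^2], that is, from nonnegativity of the squared norm of the
    difference. *)
Lemma cvgL2_lin (a : R) (S S' : nat -> T -> R) X X' :
  (forall n, S n \in L2) -> X \in L2 -> cvgL2 S X ->
  (forall n, S' n \in L2) -> X' \in L2 -> cvgL2 S' X' ->
  cvgL2 (fun n w => a * S n w + S' n w) (fun w => a * X w + X' w).
Proof.
move=> hS hX SX hS' hX' SX'.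
pose D n w := S n w - X w; pose D' n w := S' n w - X' w.
have hD n : D n \in L2 by exact: L2B.
have hD' n : D' n \in L2 by exact: L2B.
have DD : (fun n => 2 * a ^+ 2 * ip (D n) (D n) + 2 * ip (D' n) (D' n)) @ \oo --> (0 : R).
  rewrite -[X in _ --> X]addr0; apply: cvgD.
    by rewrite -(mulr0 (2 * a ^+ 2)); exact: cvgMr.
  by rewrite -(mulr0 2); exact: cvgMr.
apply: (squeeze_cvgr _ (cvg_cst 0) DD); apply: nearW => n; rewrite ip_ge0 /=.
have -> : (fun w => a * S n w + S' n w - (a * X w + X' w)) = (fun w => a * D n w + D' n w).
  by apply/funext => w; rewrite /D /D'; ring.
move: (hD n) (hD' n); move: (D n) (D' n) => A B hA hB.
have haA := L2Z a hA; have hE := L2B haA hB; have hF := L2D haA hB.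
have := ip_ge0 (fun w => a * A w - B w).
rewrite (ipBl haA hB hE) (ipBr haA hB haA) (ipBr haA hB hB).
rewrite (ipDl haA hB hF) (ipDr haA hB haA) (ipDr haA hB hB).
rewrite (ipZl a hA haA) (ipZl a hA hB) (ipZr a hA hA) (ipZr a hB hA) (ipC B A).
lra.
Qed.

End SquareIntegrable.

(** * Independence and sums of normal variables *)

Section IndependentPair.
Context d (T : measurableType d) (R : realType) (P : probability T R).
Local Notation mR := (measurableTypeR R).
Implicit Types X Y : T -> R.

Definition indep2 X Y := forall A B : set mR, measurable A -> measurable B ->
  P (X @^-1` A `&` Y @^-1` B) = (P (X @^-1` A) * P (Y @^-1` B))%E.

Definition law_of X (mX : measurable_fun setT X) : probability mR R :=
  distribution P (@mfun_Sub _ _ T mR X (mem_set mX)).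

Lemma law_ofE X (mX : measurable_fun setT X) A : law_of mX A = P (X @^-1` A).
Proof. by []. Qed.

(** Independence is the product formula on rectangles, and these determine the product measure. *)
Lemma joint_lawE X Y (mX : measurable_fun setT X) (mY : measurable_fun setT Y) :
  indep2 X Y -> forall C : set (mR * mR), measurable C ->
  P ((fun w => (X w, Y w)) @^-1` C) = (law_of mX \x law_of mY)%E C.
Proof.
move=> iXY C mC; have mXY : measurable_fun setT (fun w => (X w, Y w) : mR * mR).
  exact: measurable_fun_pair.
pose m := measure_function_pushforward__canonical__measure_function_Measure P mXY.
by rewrite (@product_measure_unique _ _ _ _ _ (law_of mX) (law_of mY) m) // => A B mA mB.
Qed.

Lemma ip_indep2 X Y : X \in Lfun P 2%:E -> Y \in Lfun P 2%:E -> indep2 X Y ->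
  ip P X Y = (\int[P]_w X w) * (\int[P]_w Y w).
Proof.
move=> hX hY iXY; have mX := measurable_L2 hX; have mY := measurable_L2 hY.
have mXY : measurable_fun setT (fun w => (X w, Y w) : mR * mR).
  exact: measurable_fun_pair.
have mpr : measurable_fun setT (fun z : mR * mR => (z.1 * z.2)%:E).
  by apply/measurable_EFinP; apply: measurable_funM.
have iX := L2_integrable hX; have iY := L2_integrable hY.
have law_int Z (hZ : Z \in Lfun P 2%:E) (mZ : measurable_fun setT Z) :
    (law_of mZ).-integrable setT (EFin \o (id : mR -> R)) /\
    (\int[law_of mZ]_z (z : R)%:E = \int[P]_w (Z w)%:E)%E.
  have iZ := L2_integrable hZ.
  have mid : measurable_fun setT (EFin \o (id : mR -> R)) by apply/measurable_EFinP.
  split; last exact: integral_distribution.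
  apply/integrableP; split=> //.
  rewrite ge0_integral_distribution //; last exact: measurableT_comp.
  by have /integrableP[_] := iZ.
have [iX' EX] := law_int X hX mX; have [iY' EY] := law_int Y hY mY.
have := @integral_prodM _ _ _ _ R (law_of mX) (law_of mY) id id iX' iY'.
rewrite EX EY => E.
have E2 : (\int[P]_w (X w * Y w)%:E =
    \int[law_of mX \x law_of mY]_z (z.1 * z.2)%:E)%E.
  have := @integral_pushforward _ _ _ _ R _ mXY P setT (fun z => (z.1 * z.2)%:E) mpr.
  rewrite preimage_setT => <- //; last exact: (L2M_integrable hX hY).
  by apply: eq_measure_integral => C mC _; exact: (joint_lawE mX mY iXY mC).
rewrite /ip /Rintegral E2 E.
by rewrite fineM //; exact: integrable_fin_num.
Qed.

End IndependentPair.

Section NormalSum.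
Variable R : realType.
Local Notation mR := (measurableTypeR R).
Local Notation lam := (@lebesgue_measure R).
Local Notation N01 := (@normal_prob R 0 1).

(** Completing the square in [z]. Both sides are the joint density of a standard normal Z and of
    [x = a Z + b Z']: on the left conditioned on Z, on the right conditioned on [x]. *)
Lemma normal_pdf_convolution (a b x z : R) : 0 < a -> 0 < b ->
  let s := Num.sqrt (a ^+ 2 + b ^+ 2) in
  normal_pdf 0 1 z * normal_pdf (a * z) b x =
  normal_pdf 0 s x * normal_pdf (x * a / s ^+ 2) (b / s) z.
Proof.
move=> a0 b0 s; have s2 : s ^+ 2 = a ^+ 2 + b ^+ 2.
  by rewrite sqr_sqrtr // addr_ge0 // sqr_ge0.
have s0 : 0 < s by rewrite sqrtr_gt0 addr_gt0 // exprn_gt0.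
clearbody s; rewrite !normal_pdfE ?gt_eqF ?divr_gt0 // /normal_fun.
rewrite [LHS]mulrACA [RHS]mulrACA -!expRD; congr (_ * expR _).
  rewrite /normal_peak expr1n mul1r.
  have sq c : 0 < c -> (Num.sqrt (c ^+ 2 * pi *+ 2))^-1 = (Num.sqrt (pi *+ 2))^-1 / c :> R.
    move=> c0; rewrite -mulrnAr sqrtrM ?sqr_ge0 // sqrtr_sqr.
    by rewrite gtr0_norm // invfM mulrC.
  have abs0 : 0 < b / s by rewrite divr_gt0.
  rewrite (sq b b0) (sq s s0) (sq _ abs0).
  by move: (Num.sqrt (pi *+ 2))^-1 => k; field; rewrite !gt_eqF.
rewrite !expr1n !expr_div_n s2; field.
by rewrite !gt_eqF // ?addr_gt0 // ?exprn_gt0.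
Qed.

Lemma normal_prob_scale (s : R) (B : set mR) : 0 < s -> measurable B ->
  N01 ((fun z : mR => s * z) @^-1` B) = (\int[lam]_(x in B) (normal_pdf 0 s x)%:E)%E.
Proof.
move=> s0 mB; have := normal_prob_affine 0 s0 mB; rewrite /normal_prob => ->.
by congr (\int[lam]_(x in _ @^-1` B) _)%E; apply/funext => z; rewrite addr0.
Qed.

(** When [a] or [b] is 0 one summand has no density, so these cases are treated apart; otherwise
    Tonelli's theorem is applied to the factorization [normal_pdf_convolution]. *)
Lemma normal_sum_law (a b : R) (B : set mR) : 0 <= a -> 0 <= b -> measurable B ->
  (N01 \x N01)%E ((fun z : mR * mR => a * z.1 + b * z.2) @^-1` B) =
  N01 ((fun z : mR => Num.sqrt (a ^+ 2 + b ^+ 2) * z) @^-1` B).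
Proof.
move=> a0 b0 mB.
have mlin (c : R) : measurable_fun [set: mR] (fun z : mR => c * z : mR).
  exact: measurable_funM.
have mpre (c : R) : measurable ((fun z : mR => c * z) @^-1` B).
  by rewrite -[X in measurable X]setTI; exact: mlin.
have [->|aN0] := eqVneq a 0.
  have -> : (fun z : mR * mR => 0 * z.1 + b * z.2) @^-1` B =
      setT `*` ((fun z : mR => b * z) @^-1` B).
    by apply/seteqP; split=> -[x y] /=; rewrite mul0r add0r => //; case.
  rewrite [LHS](product_measure1E _ _ measurableT (mpre b)).
  rewrite [X in (X * _)%E](_ : _ = 1%E) ?mul1e; last exact: probability_setT.
  by rewrite expr0n /= add0r sqrtr_sqr ger0_norm.
have [->|bN0] := eqVneq b 0.
  have -> : (fun z : mR * mR => a * z.1 + 0 * z.2) @^-1` B =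
      ((fun z : mR => a * z) @^-1` B) `*` setT.
    by apply/seteqP; split=> -[x y] /=; rewrite mul0r addr0 => //; case.
  rewrite [LHS](product_measure1E _ _ (mpre a) measurableT).
  rewrite [X in (_ * X)%E](_ : _ = 1%E) ?mule1; last exact: probability_setT.
  by rewrite expr0n /= addr0 sqrtr_sqr ger0_norm.
have {}a0 : 0 < a by rewrite lt_def aN0. 
have {}b0 : 0 < b by rewrite lt_def bN0.
set s := Num.sqrt _.
have s0 : 0 < s by rewrite sqrtr_gt0 addr_gt0 // exprn_gt0.
rewrite normal_prob_scale //.
have inner (z : mR) : (N01 \o xsection ((fun z : mR * mR => (a * z.1 + b * z.2)%R) @^-1` B)) z =
    (\int[lam]_(x in B) (normal_pdf (a * z) b x)%:E)%E.
  rewrite /= (_ : xsection _ _ = (fun y => b * y + a * z) @^-1` B).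
    by rewrite -normal_prob_affine.
  by apply/seteqP; split=> y; rewrite /xsection /= inE /= addrC.
have mC : measurable ((fun z : mR * mR => (a * z.1 + b * z.2)%R) @^-1` B).
  rewrite -[X in measurable X]setTI.
  suff : measurable_fun [set: mR * mR] (fun z : mR * mR => a * z.1 + b * z.2 : mR) by exact.
  by apply: measurable_funD; exact: measurable_funM.
have mX := measurable_fun_xsection N01 mC.
have N01int (F : mR -> \bar R) := @ge0_integral_density _ mR R lam N01 _
  (@normal_pdf_ge0 R 0 1) (measurable_normal_pdf 0 1) (fun _ _ => erefl) F.
rewrite /product_measure1 N01int //.
pose G (z x : mR) : R := normal_pdf 0 s x * normal_pdf (x * a / s ^+ 2) (b / s) z.
have GE z x : G z x = normal_pdf 0 1 z * normal_pdf (a * z) b x.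
  by rewrite /G normal_pdf_convolution.
pose H (p : mR * mR) : \bar R := ((G p.1 p.2)%:E * (\1_B p.2)%:E)%E.
have mpdf2 : measurable_fun [set: mR * mR] (fun p : mR * mR => normal_pdf (a * p.1) b p.2 : R).
  rewrite /normal_pdf gt_eqF // /normal_fun.
  apply: measurable_funM => //; apply: measurableT_comp => //.
  apply: measurable_funM => //; apply: measurableT_comp => //; apply: measurable_funX.
  by apply: measurable_funB => //; exact: measurable_funM.
have mH : measurable_fun [set: mR * mR] H.
  apply: emeasurable_funM; apply/measurable_EFinP.
    under eq_fun do rewrite GE.
    apply: measurable_funM => //; apply: measurableT_comp => //.
    exact: measurable_normal_pdf.
  by apply: measurableT_comp => //; exact: measurable_indic.
have H0 p : (0 <= H p)%E.
  by rewrite /H mule_ge0 // lee_fin ?indic_ge0 // /G mulr_ge0 ?normal_pdf_ge0.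
transitivity (\int[lam]_z \int[lam]_x H (z, x))%E.
  apply: eq_integral => z _; rewrite inner -ge0_integralZr //; last 3 first.
  - apply: measurable_funTS; apply/measurable_EFinP; exact: measurable_normal_pdf.
  - by move=> x _; rewrite lee_fin normal_pdf_ge0.
  - by rewrite lee_fin normal_pdf_ge0.
  rewrite integral_mkcond; apply: eq_integral => x _; rewrite patchE /H /= GE indicE.
  by case: ifP => _; rewrite ?mule1 ?mule0 // -EFinM mulrC.
(* After the exchange [z] is integrated first, and its conditional density has total mass 1. *)
rewrite (fubini_tonelli H mH H0) [RHS]integral_mkcond; apply: eq_integral => x _.
rewrite /H /= ge0_integralZr //; last 2 first.
- under eq_fun do rewrite /G EFinM; apply: emeasurable_funM => //.
  by apply/measurable_EFinP; exact: measurable_normal_pdf.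
- by move=> z _; rewrite lee_fin /G mulr_ge0 ?normal_pdf_ge0.
under eq_integral do rewrite /G EFinM.
rewrite ge0_integralZl //; last 3 first.
- by apply/measurable_EFinP; exact: measurable_normal_pdf.
- by move=> z _; rewrite lee_fin normal_pdf_ge0.
- by rewrite lee_fin normal_pdf_ge0.
rewrite integral_normal_pdf mule1 patchE indicE.
by case: ifP => _; rewrite ?mule1 ?mule0.
Qed.

Context d (T : measurableType d) (P : probability T R).
Implicit Types X Y : T -> R.

Lemma normal_lawD X Y m1 m2 s1 s2 : normal_law P X m1 s1 -> normal_law P Y m2 s2 ->
  indep2 P X Y ->
  normal_law P (fun w => X w + Y w) (m1 + m2) (Num.sqrt (s1 ^+ 2 + s2 ^+ 2)).
Proof.
move=> [mX s10 HX] [mY s20 HY] iXY; split; first exact: measurable_funD.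
  exact: sqrtr_ge0.
move=> B mB.
pose B' := (fun x => x + (m1 + m2)) @^-1` B : set mR.
have mB' : measurable B'.
  rewrite -[X in measurable X]setTI.
  suff : measurable_fun [set: mR] (fun x : mR => x + (m1 + m2) : mR) by exact.
  exact: measurable_funD.
have -> : (fun z => Num.sqrt (s1 ^+ 2 + s2 ^+ 2) * z + (m1 + m2)) @^-1` B =
  (fun z : mR => Num.sqrt (s1 ^+ 2 + s2 ^+ 2) * z) @^-1` B' by [].
rewrite -normal_sum_law //.
have mC : measurable ((fun p : mR * mR => p.1 + p.2) @^-1` B).
  rewrite -[X in measurable X]setTI.
  suff : measurable_fun [set: mR * mR] (fun p : mR * mR => p.1 + p.2 : mR) by exact.
  exact: measurable_funD.
have := joint_lawE mX mY iXY mC; rewrite {1}/preimage /= => ->.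
have maff (s m : R) : measurable_fun [set: mR] (fun z : mR => s * z + m : mR).
  by apply: measurable_funD => //; exact: measurable_funM.
have mphi : measurable_fun [set: mR * mR]
    (fun z : mR * mR => (s1 * z.1 + m1, s2 * z.2 + m2) : mR * mR).
  by apply: measurable_fun_pair; exact: (measurableT_comp (maff _ _)).
pose m := measure_function_pushforward__canonical__measure_function_Measure
  (N01 \x N01)%E mphi.
have mprod (A C : set mR) : measurable A -> measurable C ->
    m (A `*` C) = (law_of P mX A * law_of P mY C)%E.
  move=> mA mC'.
  have mA' : measurable ((fun z : mR => s1 * z + m1 : mR) @^-1` A).
    by rewrite -[X in measurable X]setTI; exact: maff.
  have mC'' : measurable ((fun z : mR => s2 * z + m2 : mR) @^-1` C).
    by rewrite -[X in measurable X]setTI; exact: maff.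
  rewrite law_ofE law_ofE HX // HY //.
  exact: (product_measure1E N01 N01 mA' mC'').
have E := @product_measure_unique _ _ _ _ _ (law_of P mX) (law_of P mY) m mprod _ mC.
apply: (etrans E); rewrite /m /=; congr ((N01 \x N01)%E _).
by apply/seteqP; split=> z; rewrite /B' /preimage /= addrACA.
Qed.

End NormalSum.

Lemma measurable_le_set (R : realType) d (T : measurableType d) (F : T -> R) (b : R) :
  measurable_fun setT F -> measurable [set w | F w <= b].
Proof.
move=> mF; rewrite (_ : [set w | _] = setT `&` F @^-1` `]-oo, b]%classic).
  by apply: mF => //; exact: measurable_itv.
by apply/seteqP; split => w /=; rewrite in_itv; [split|case].
Qed.

Lemma measurable_ge_norm_set (R : realType) d (T : measurableType d) (F : T -> R) (b : R) :
  measurable_fun setT F -> measurable [set w | b <= `|F w|].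
Proof.
move=> mF; rewrite (_ : [set w | _] = setT `&` (fun w => `|F w|) @^-1` `[b, +oo[%classic).
  by apply: (measurableT_comp (@normr_measurable R setT) mF) => //; exact: measurable_itv.
by apply/seteqP; split => w /=; rewrite in_itv /= andbT; [split|case].
Qed.

Section NormalLawL2.
Context (R : realType).
Local Notation mR := (measurableTypeR R).
Local Notation N01 := (@normal_prob R 0 1).
Local Notation Z := (id : mR -> R).

Lemma normal01_L2 : Z \in Lfun N01 2%:E.
Proof.
apply/Lfun2P; split => //; rewrite (integral_normal01_moment R 2); exact: ltry.
Qed.

Lemma ip_normal01 : ip N01 Z Z = 1.
Proof. by apply: EFin_inj; rewrite ipE ?normal01_L2 // (integral_normal01_moment R 2). Qed.

Lemma ip_normal01_cst c : ip N01 Z (cst c) = 0.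
Proof.
rewrite (_ : cst c = fun w => c * cst 1 w); last by apply/funext => w; rewrite /= mulr1.
rewrite ipZr ?L2_cst ?normal01_L2 //.
apply/eqP; rewrite mulf_eq0; apply/orP; right; apply/eqP.
rewrite /ip /Rintegral (_ : integral _ _ _ = 0%E) //.
rewrite -[RHS](integral_normal01_moment R 1).
by apply: eq_integral => z _; rewrite expr1 /= mulr1.
Qed.

Context d (T : measurableType d) (P : probability T R).
Implicit Types X Y : T -> R.

Lemma ip_cst (a b : R) : ip P (cst a) (cst b) = a * b.
Proof.
rewrite /ip (_ : Rintegral _ _ _ = \int[P]_(w in setT) (cst (a * b) w)) //.
transitivity (a * b * fine (P [set: T])); first exact: Rintegral_cst.
by rewrite probability_setT mulr1.
Qed.

End NormalLawL2.

Section NormalLawL2b.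
Context (R : realType) d (T : measurableType d) (P : probability T R).
Local Notation mR := (measurableTypeR R).
Local Notation N01 := (@normal_prob R 0 1).
Local Notation Z := (id : mR -> R).
Implicit Types X Y : T -> R.

Lemma normal_law_L2 X m s : normal_law P X m s ->
  X \in Lfun P 2%:E /\ ip P X X = s ^+ 2 + m ^+ 2.
Proof.
move=> XN; have [mX s0 _] := XN.
have hZ := normal01_L2 R; have hsZ := L2Z s hZ; have hm := L2_cst N01 m.
have hA := L2D hsZ hm.
have E : (\int[P]_w (X w ^+ 2)%:E = (s ^+ 2 + m ^+ 2)%:E)%E.
  have mF : measurable_fun [set: mR] (fun x : mR => (x ^+ 2)%:E).
    by apply/measurable_EFinP; exact: measurable_funX.
  have F0 (x : mR) : (0 <= (x ^+ 2)%:E)%E by rewrite lee_fin sqr_ge0.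
  rewrite (ge0_integral_normal_law XN mF F0) -[LHS](ipE hA) (ipDl hsZ hm hA) (ipDr hsZ hm hsZ) (ipDr hsZ hm hm).
  rewrite (ipZl s hZ hsZ) (ipZr s hZ hZ) (ipZl s hZ hm) (ipZr s hm hZ) (ipC _ (cst m)).
  by rewrite ip_normal01 !ip_normal01_cst ip_cst; congr (_%:E); ring.
have hX : X \in Lfun P 2%:E by apply/Lfun2P; split => //; rewrite E ltry.
by split => //; apply: EFin_inj; rewrite ipE.
Qed.

Lemma normal_law_mean X m s : normal_law P X m s -> \int[P]_w X w = m.
Proof.
move=> XN; have [mX s0 H] := XN; have [hX _] := normal_law_L2 XN.
have hZ := normal01_L2 R; have hsZ := L2Z s hZ; have hm := L2_cst N01 m.
have hA := L2D hsZ hm.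
have mA := measurable_L2 hA.
have mid : measurable_fun setT (EFin \o (id : mR -> R)) by apply/measurable_EFinP.
have E1 : (\int[P]_w (X w)%:E = \int[law_of P mX]_z z%:E)%E.
  by rewrite integral_distribution //; exact: L2_integrable.
have E2 : (\int[law_of N01 mA]_z z%:E = \int[N01]_z (s * z + m)%:E)%E.
  by rewrite integral_distribution //; exact: (L2_integrable hA).
have E3 : (\int[law_of P mX]_z z%:E = \int[law_of N01 mA]_z z%:E)%E.
  by apply: eq_measure_integral => A mA' _; exact: H.
rewrite /Rintegral E1 E3 E2; have := ipDl hsZ hm (L2_cst N01 1); rewrite (ipZl s hZ (L2_cst N01 1)) ip_normal01_cst.
rewrite ip_cst mulr0 add0r mulr1 /ip /Rintegral.
by under eq_integral do rewrite mulr1.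
Qed.

Lemma chebyshev_ip X (e : R) : X \in Lfun P 2%:E -> 0 < e ->
  (P [set w | (e <= `|X w|)%R] <= (ip P X X / e ^+ 2)%:E)%E.
Proof.
move=> hX e0; have mX := measurable_L2 hX; have e20 : 0 < e ^+ 2 by exact: exprn_gt0.
have mE : measurable [set w | e <= `|X w|] by exact: measurable_ge_norm_set.
rewrite mulrC EFinM lee_pdivlMl // ipE //.
rewrite -(integral_cst P mE) // integral_mkcond.
apply: ge0_le_integral => //.
- by move=> w _; rewrite patchE; case: ifP => // _; rewrite lee_fin ltW.
- by apply/(measurable_restrictT _ _).1.
- by apply/measurable_EFinP; exact: measurable_funX.
move=> w _; rewrite patchE; case: ifPn => [|_]; last by rewrite lee_fin sqr_ge0.
rewrite inE /= lee_fin => h; rewrite -(real_normK (num_real (X w))).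
by rewrite lerXn2r // nnegrE // ltW.
Qed.

End NormalLawL2b.

(** * Laws of L2 limits *)

Section LawLimit.
Context (R : realType) d (T : measurableType d) (P : probability T R)
  d' (T' : measurableType d') (Q : probability T' R).

(** If [X <= a] then [U n <= a + e] unless [U n] is [e]-far from [X], and likewise for [V n] and
    [Y]; Chebyshev's inequality removes the exceptional events. Two probability spaces appear
    because the second sequence will live on the line with the standard normal law. One inequality
    suffices, since the hypotheses are symmetric. *)
Lemma cvgL2_cdf_le (U : nat -> T -> R) X (V : nat -> T' -> R) Y :
  (forall n, U n \in Lfun P 2%:E) -> X \in Lfun P 2%:E -> cvgL2 P U X ->
  (forall n, V n \in Lfun Q 2%:E) -> Y \in Lfun Q 2%:E -> cvgL2 Q V Y ->
  (forall n a, P [set w | U n w <= a] = Q [set w | V n w <= a]) ->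
  forall a, (P [set w | (X w <= a)%R] <= Q [set w | (Y w <= a)%R])%E.
Proof.
move=> hU hX UX hV hY VY UV a.
have step (e : R) : 0 < e -> (P [set w | (X w <= a)%R] <= Q [set w | (Y w <= a + e *+ 2)%R])%E.
  move=> e0.
  pose du n w := U n w - X w; pose dv n w := V n w - Y w.
  have hdu n : du n \in Lfun P 2%:E by exact: L2B.
  have hdv n : dv n \in Lfun Q 2%:E by exact: L2B.
  have H n : (P [set w | (X w <= a)%R] <= Q [set w | (Y w <= a + e *+ 2)%R] +
     (ip P (du n) (du n) / e ^+ 2 + ip Q (dv n) (dv n) / e ^+ 2)%:E)%E.
    have h1 : (P [set w | (X w <= a)%R] <=
        P [set w | (U n w <= a + e)%R] + P [set w | (e <= `|du n w|)%R])%E.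
      have m1 := measurable_le_set (a + e) (measurable_L2 (hU n)).
      have m2 := measurable_ge_norm_set e (measurable_L2 (hdu n)).
      apply: le_trans (measureU2 _ m1 m2).
      apply: le_measure; rewrite ?inE.
      - exact: measurable_le_set (measurable_L2 hX).
      - exact: measurableU.
      move=> w /= Xa; have [h|h] := leP (U n w) (a + e); [by left|right].
      by apply: le_trans (ler_norm _); rewrite /du; lra.
    have h2 : (Q [set w | (V n w <= a + e)%R] <=
        Q [set w | (Y w <= a + e *+ 2)%R] + Q [set w | (e <= `|dv n w|)%R])%E.
      have m1 := measurable_le_set (a + e *+ 2) (measurable_L2 hY).
      have m2 := measurable_ge_norm_set e (measurable_L2 (hdv n)).
      apply: le_trans (measureU2 _ m1 m2).
      apply: le_measure; rewrite ?inE.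
      - exact: measurable_le_set (measurable_L2 (hV n)).
      - exact: measurableU.
      move=> w /= Va; have [h|h] := leP (Y w) (a + e *+ 2); [by left|right].
      by rewrite distrC; apply: le_trans (ler_norm _); rewrite mulr2n in h; lra.
    apply: (le_trans h1); rewrite UV (addrC (_ / _)) EFinD addeA; apply: leeD.
      apply: (le_trans h2); apply: leeD => //.
      exact: chebyshev_ip.
    exact: chebyshev_ip.
  apply/lee_addgt0Pr => r r0.
  have E0 : (fun n => ip P (du n) (du n) / e ^+ 2 + ip Q (dv n) (dv n) / e ^+ 2) @ \oo --> (0 : R).
    rewrite -[X in _ --> X]addr0 -[X in _ --> X + _](mul0r (e ^+ 2)^-1).
    rewrite -[X in _ --> _ + X](mul0r (e ^+ 2)^-1).
    by apply: cvgD; apply: cvgMl.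
  have /cvgr0Pnorm_lt /(_ _ r0) [n _ /(_ n (leqnn n)) En] := E0.
  apply: (le_trans (H n)); apply: leeD => //; rewrite lee_fin ltW //.
  by apply: le_lt_trans En; exact: ler_norm.
(* Right continuity of the distribution function lets the error [e] tend to 0. *)
pose F (n : nat) := [set w | Y w <= a + n.+1%:R^-1 *+ 2].
have mY := measurable_L2 hY.
have FE : \bigcap_n F n = [set w | Y w <= a].
  apply/seteqP; split => w /=.
    move=> h; rewrite leNgt; apply/negP => h2.
    have d0 : 0 < Y w - a by rewrite subr_gt0.
    have [n _ /(_ n (leqnn n)) /=] := near_infty_natSinv_lt (PosNum (divr_gt0 d0 (ltr0Sn R 1))).
    rewrite /= => hn; have := h n I; rewrite /F /= mulr2n.
    rewrite ltr_pdivlMr // in hn; move: hn; set q := _^-1; lra.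
  by move=> h n _; rewrite /F /=; apply: le_trans h _; rewrite lerDl mulrn_wge0.
rewrite -FE.
have cF : (Q \o F) @ \oo --> Q (\bigcap_n F n).
  apply: nonincreasing_cvg_mu.
  - by apply: le_lt_trans (ltry 1); apply: probability_le1; exact: measurable_le_set.
  - by move=> n; exact: measurable_le_set.
  - by rewrite FE; exact: measurable_le_set.
  - move=> n m nm; apply/subsetPset => w; rewrite /F /= => /le_trans; apply.
    by rewrite lerD2l lerMn2r /= lef_pV2 ?posrE ?ltr0n // ler_nat ltnS.
rewrite -(cvg_lim _ cF) //; apply: lime_ge; first by apply/cvg_ex; eexists; exact: cF.
by apply: nearW => n; apply: step; rewrite invr_gt0.
Qed.

End LawLimit.

Section NormalLimit.
Context (R : realType) d (T : measurableType d) (P : probability T R).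
Local Notation mR := (measurableTypeR R).
Local Notation N01 := (@normal_prob R 0 1).
Implicit Types X : T -> R.

(** The law of [U n] is that of [s n] times a standard normal variable. The scaled variables
    converge in L2 themselves, because the second moments [s n ^+ 2] converge, and the two limits
    then have the same distribution function. *)
Lemma normal_law_cvgL2 (U : nat -> T -> R) (s : nat -> R) X :
  (forall n, normal_law P (U n) 0 (s n)) -> X \in Lfun P 2%:E -> cvgL2 P U X ->
  normal_law P X 0 (Num.sqrt (ip P X X)).
Proof.
move=> NU hX UX; set t := Num.sqrt _.
have hU n : U n \in Lfun P 2%:E by have [] := normal_law_L2 (NU n).
have hZ := normal01_L2 R.
have sU n : ip P (U n) (U n) = s n ^+ 2.
  by have [_ ->] := normal_law_L2 (NU n); rewrite expr0n addr0.
have s0 n : 0 <= s n by have [] := NU n.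
have t2 : t ^+ 2 = ip P X X by rewrite sqr_sqrtr // ip_ge0.
have t0 : 0 <= t by exact: sqrtr_ge0.
pose V n := (fun z : mR => s n * z : R); pose Y := (fun z : mR => t * z : R).
have hV n : V n \in Lfun N01 2%:E by exact: L2Z.
have hY : Y \in Lfun N01 2%:E by exact: L2Z.
have VY : cvgL2 N01 V Y.
  have H := cvgL2_ip_sqr hU hX UX.
  have H2 : (fun n => `|ip P (U n) (U n) - ip P X X|) @ \oo --> (0 : R).
    by have := cvg_norm (cvgB H (cvg_cst (ip P X X))); rewrite subrr normr0; exact.
  apply: (squeeze_cvgr _ (cvg_cst 0) H2); apply: nearW => n; rewrite ip_ge0 /=.
  have -> : (fun w : mR => V n w - Y w) = (fun w => (s n - t) * w).
    by apply/funext => w; rewrite /V /Y mulrBl.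
  rewrite (ipZl _ hZ (L2Z _ hZ)) (ipZr _ hZ hZ) ip_normal01 mulr1 sU -t2.
  (* Since [s n] and [t] are nonnegative, [(s n - t)^2 <= |s n ^+ 2 - t ^+ 2|]. *)
  have -> : s n ^+ 2 - t ^+ 2 = (s n - t) * (s n + t) by ring.
  rewrite normrM -expr2 -(real_normK (num_real (s n - t))) expr2 ler_wpM2l //.
  rewrite (ger0_norm (addr_ge0 (s0 n) t0)).
  by apply: le_trans (ler_normB _ _) _; rewrite !ger0_norm.
have cdfE n a : P [set w | U n w <= a] = N01 [set w | V n w <= a].
  have [_ _ H] := NU n; have -> : [set w | U n w <= a] = U n @^-1` `]-oo, a]%classic.
    by apply/seteqP; split => w /=; rewrite in_itv.
  rewrite H //; congr (N01 _).
  by apply/seteqP; split => w /=; rewrite in_itv /= addr0.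
have mX := measurable_L2 hX; have mY := measurable_L2 hY.
split => // B mB; rewrite (_ : (fun z => _) = Y); last first.
  by apply/funext => z; rewrite addr0.
suff : law_of P mX B = law_of N01 mY B by exact.
apply: borel_measure_unique => // a; last first.
  by apply: le_lt_trans (ltry 1); exact: probability_le1.
have setE T1 (F : T1 -> R) : F @^-1` `]-oo, a]%classic = [set w | F w <= a].
  by apply/seteqP; split => w /=; rewrite in_itv.
transitivity (P [set w | X w <= a]); first by rewrite -setE.
transitivity (N01 [set w | Y w <= a]); last by rewrite -setE.
apply/eqP; rewrite eq_le; apply/andP; split.
  exact: (cvgL2_cdf_le hU hX UX hV hY VY cdfE).
exact: (cvgL2_cdf_le hV hY VY hU hX UX (fun n b => esym (cdfE n b))).
Qed.

End NormalLimit.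

(** * Independent sigma-algebras *)

Section SubSigmaAlgebra.
Context d (T : measurableType d) (R : realType).
Implicit Types (G H : set (set T)) (X Y : T -> R).

(** Measurability for the sigma-algebra generated by [G], phrased as ordinary measurability on a
    retyped space, so that the closure lemmas for measurable functions apply. *)
Definition measurable_wrt G X :=
  measurable_fun (setT : set (g_sigma_algebraType G)) (X : g_sigma_algebraType G -> R).

Lemma measurable_wrtP G X : measurable_wrt G X <->
  forall B : set R, measurable B -> <<s G >> (X @^-1` B).
Proof.
split=> H B; last by move=> *; rewrite setTI; exact: H.
by move=> mB; rewrite -[_ @^-1` _]setTI; exact: (H measurableT _ mB).
Qed.

Lemma sub_sigma G H : G `<=` <<s H >> -> <<s G >> `<=` <<s H >>.
Proof. by move=> GH; apply: smallest_sub => //; exact: smallest_sigma_algebra. Qed.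

Lemma sub_sigma_measurable G : G `<=` d.-measurable -> <<s G >> `<=` d.-measurable.
Proof. by move=> GH; apply: smallest_sub => //; exact: sigma_algebra_measurable. Qed.

Lemma measurable_wrt_sub G H X : G `<=` <<s H >> -> measurable_wrt G X -> measurable_wrt H X.
Proof. by move=> /sub_sigma GH /measurable_wrtP hX; apply/measurable_wrtP => B mB; exact: GH (hX B mB). Qed.

End SubSigmaAlgebra.

Section Independence.
Context d (T : measurableType d) (R : realType) (P : probability T R).

(** For fixed [C] both sides are finite measures in [A], and they agree on a system stable under
    intersection that contains the whole space. *)
Lemma measure_product_extend (G : set (set T)) (C : set T) :
  setI_closed G -> G setT -> G `<=` d.-measurable -> measurable C ->
  (forall A, G A -> P (A `&` C) = (P A * P C)%E) ->
  forall A, <<s G >> A -> P (A `&` C) = (P A * P C)%E.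
Proof.
move=> GI GT Gm mC H A sA.
have PCfin : P C \is a fin_num by exact: fin_num_measure.
have pc0 : (0 <= fine (P C))%R by exact: fine_ge0.
pose m1 := mrestr P mC; pose m2 := mscale (NngNum pc0) P.
suff : m1 A = m2 A by rewrite /m1 /m2 /mrestr /mscale /= fineK // muleC.
apply: (@g_sigma_algebra_measure_unique _ _ _ G Gm (fun=> setT)) => //.
- by rewrite bigcup_const.
- move=> B GB; transitivity (P (B `&` C)) => //; rewrite H // muleC -[X in (X * _)%E]fineK //.
- move=> _; apply: le_lt_trans (ltry 1).
  by apply: probability_le1; rewrite setTI.
Qed.

Variables (I : choiceType) (J : set I) (G : I -> set (set T)).
Hypothesis Gm : forall i, J i -> G i `<=` d.-measurable.
Hypothesis GI : forall i, J i -> setI_closed (G i).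
Hypothesis GT : forall i, J i -> G i setT.
Hypothesis GP : forall (F : {fset I}) (E : I -> set T),
  (forall i, i \in F -> J i /\ G i (E i)) ->
  P (\bigcap_(i in [set` F]) E i) = (\prod_(i <- F) P (E i))%E.

Definition union_system (J1 : set I) : set (set T) :=
  [set E | exists2 i, J1 i & G i E].

(** Finite intersections of events from the single systems. Unlike [union_system], this is stable
    under intersection; both generate the same sigma-algebra. *)
Definition cylinder (J1 : set I) : set (set T) :=
  [set E | exists (F : {fset I}) (A : I -> set T),
    (forall i, i \in F -> J1 i /\ G i (A i)) /\ E = \bigcap_(i in [set` F]) A i].

Lemma cylinder_setI (J1 : set I) : J1 `<=` J -> setI_closed (cylinder J1).
Proof.
move=> J1J _ _ [F [A [HA ->]]] [F' [A' [HA' ->]]].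
exists (F `|` F')%fset.
exists (fun i => (if i \in F then A i else setT) `&` (if i \in F' then A' i else setT)).
split=> [i|].
  rewrite in_fsetU => /orP iFF.
  have Ji : J1 i by case: iFF => [/HA|/HA'] [].
  split=> //; apply: GI; first exact: J1J.
    by case: ifPn => [/HA[]//|_]; exact/GT/J1J.
  by case: ifPn => [/HA'[]//|_]; exact/GT/J1J.
apply/seteqP; split=> w /=.
  move=> [h h'] i /=; rewrite in_fsetU => _; split.
    by case: ifPn => // iF; exact: h.
  by case: ifPn => // iF; exact: h'.
move=> h; split=> i /= iF; have := h i; rewrite /= in_fsetU iF ?orbT /=.
  by move=> /(_ isT) [].
by move=> /(_ isT) [].
Qed.

Lemma cylinder_setT (J1 : set I) : cylinder J1 setT.
Proof.
exists fset0, (fun=> setT); split=> [i|]; first by rewrite in_fset0.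
by apply/seteqP; split.
Qed.

Lemma cylinder_measurable (J1 : set I) : J1 `<=` J -> cylinder J1 `<=` d.-measurable.
Proof.
move=> J1J _ [F [A [HA ->]]]; apply: fin_bigcap_measurable => // i /= /HA [J1i GA].
by apply: Gm GA; exact: J1J.
Qed.

Lemma union_system_sub_cylinder (J1 : set I) : union_system J1 `<=` cylinder J1.
Proof.
move=> E [i Ji GE]; exists [fset i]%fset, (fun=> E); split=> [j|].
  by rewrite in_fset1 => /eqP ->.
apply/seteqP; split=> w /=; first by move=> ? j.
by move=> /(_ i); apply; rewrite /= in_fset1.
Qed.

Lemma cylinder_indep (J1 J2 : set I) : J1 `<=` J -> J2 `<=` J -> [disjoint J1 & J2] ->
  forall E1 E2, cylinder J1 E1 -> cylinder J2 E2 -> P (E1 `&` E2) = (P E1 * P E2)%E.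
Proof.
move=> J1J J2J /disj_setPS J12 _ _ [F1 [A1 [HA1 ->]]] [F2 [A2 [HA2 ->]]].
pose A i := if i \in F1 then A1 i else A2 i.
have F12 i : i \in F2 -> i \in F1 = false.
  move=> iF2; apply/negP => iF1.
  by apply: (J12 i); split; [have [] := HA1 _ iF1|have [] := HA2 _ iF2].
transitivity (P (\bigcap_(i in [set` (F1 `|` F2)%fset]) A i)).
  congr (P _); apply/seteqP; split=> w /=.
    move=> [h h'] i /=; rewrite in_fsetU /A; case: ifPn => [iF _|_ /= iF]; first exact: h.
    exact: h'.
  move=> h; split=> i /= iF; have := h i; rewrite /= in_fsetU iF ?orbT /A.
    by rewrite iF; exact.
  by rewrite (F12 _ iF); exact.
rewrite GP; last first.
  move=> i; rewrite in_fsetU /A; case: ifPn => /= [/HA1[/J1J]//|_ /HA2[/J2J]//].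
have FF : perm_eq (F1 `|` F2)%fset (F1 ++ F2).
  apply: uniq_perm => [//||i]; last by rewrite in_fsetU mem_cat.
  rewrite cat_uniq !fset_uniq andbT /=; apply/hasPn => i iF2 /=.
  by apply/negP => iF1; have := F12 _ iF2; rewrite iF1.
rewrite (perm_big _ FF) big_cat /=; congr (_ * _)%E.
  rewrite GP => [|i /HA1[/J1J]//]; apply: eq_big_seq => i iF.
  by rewrite /A iF.
rewrite GP => [|i /HA2[/J2J]//]; apply: eq_big_seq => i iF.
by rewrite /A F12.
Qed.

(** Independence of cylinders is extended to generated sigma-algebras in one argument at a time. *)
Lemma union_system_indep (J1 J2 : set I) : J1 `<=` J -> J2 `<=` J -> [disjoint J1 & J2] ->
  forall E1 E2, <<s union_system J1 >> E1 -> <<s union_system J2 >> E2 ->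
  P (E1 `&` E2) = (P E1 * P E2)%E.
Proof.
move=> J1J J2J J12 E1 E2 h1 h2.
have {}h1 : <<s cylinder J1 >> E1.
  apply: sub_sigma h1 => A /union_system_sub_cylinder; exact: sub_sigma_algebra.
have {}h2 : <<s cylinder J2 >> E2.
  apply: sub_sigma h2 => A /union_system_sub_cylinder; exact: sub_sigma_algebra.
have mE2 : measurable E2 by apply: sub_sigma_measurable h2; exact: cylinder_measurable.
apply: (measure_product_extend (cylinder_setI J1J) (cylinder_setT J1)
  (cylinder_measurable J1J)) => // {h1}E1 h1.
have mE1 : measurable E1 by exact: cylinder_measurable h1.
rewrite setIC muleC.
apply: (measure_product_extend (cylinder_setI J2J) (cylinder_setT J2)
  (cylinder_measurable J2J)) => // {mE2 h2}E2 h2.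
by rewrite setIC muleC; exact: cylinder_indep h1 h2.
Qed.

End Independence.

(** * Series of independent variables *)

Section RealSequences.
Variable R : realType.

(** A Cauchy criterion with countable quantifiers only, so that the set of convergence is visibly
    measurable. *)
Lemma cvgn_oscillationP (u : nat -> R) : cvgn u <->
  forall j : nat, exists m : nat, forall k : nat, `|u (m + k)%N - u m| <= j.+1%:R^-1.
Proof.
split=> [/cvg_ex[l ul] j|H].
  have j0 : 0 < j.+1%:R^-1 / 2 :> R by rewrite divr_gt0 ?invr_gt0.
  have /cvgrPdist_le /(_ _ j0) [m _ Hm] := ul.
  exists m => k; have h1 := Hm m (leqnn m); have h2 := Hm (m + k)%N (leq_addr k m).
  have -> : u (m + k)%N - u m = (l - u m) - (l - u (m + k)%N) by ring.
  by apply: le_trans (ler_normB _ _) _; rewrite [leRHS]splitr lerD.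
apply/cauchy_cvgP/cauchy_exP => e e0.
have [j _ /(_ j (leqnn j)) /= je] := near_infty_natSinv_lt (PosNum e0).
have [m Hm] := H j; exists (u m); exists m => // n /= mn.
by rewrite /ball /= distrC -(subnKC mn); apply: le_lt_trans (Hm _) je.
Qed.

Variables (d : measure_display) (T : measurableType d).

Lemma measurable_cvgn (S : nat -> T -> R) : (forall n, measurable_fun setT (S n)) ->
  measurable [set w | cvgn (fun n => S n w)].
Proof.
move=> mS; have -> : [set w | cvgn (fun n => S n w)] =
  \bigcap_(j in @setT nat) \bigcup_(m in @setT nat) \bigcap_(k in @setT nat)
    [set w | `|S (m + k)%N w - S m w| <= j.+1%:R^-1].
  apply/seteqP; split => w /=.
    by move=> /cvgn_oscillationP h j _; have [m hm] := h j; exists m => // k _; exact: hm.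
  by move=> h; apply/cvgn_oscillationP => j; have [m _ hm] := h j I; exists m => k; exact: hm.
apply: bigcapT_measurable => j; apply: bigcup_measurable => m _.
apply: bigcapT_measurable => k; apply: measurable_le_set.
by apply: (measurableT_comp (@normr_measurable R setT)); exact: measurable_funB.
Qed.

(** Where the sequence diverges [limn] returns the default [point]. The limit is therefore glued
    from the everywhere convergent [\1_C * S n] and a constant on the complement of the convergence
    set [C]. *)
Lemma measurable_limn (S : nat -> T -> R) : (forall n, measurable_fun setT (S n)) ->
  measurable_fun setT (fun w => limn (fun n => S n w)).
Proof.
move=> mS.
pose C := [set w | cvgn (fun n => S n w)].
have mC : measurable C by exact: measurable_cvgn.
pose pt : R := point.
have -> : (fun w => limn (fun n => S n w)) =
    (fun w => limn (fun n => \1_C w * S n w) + \1_(~` C) w * pt).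
  apply/funext => w; rewrite !indicE in_setC.
  have [|nC] := boolP (w \in C).
    by move=> _; rewrite mul0r addr0; congr (limn _); apply/funext => n; rewrite mul1r.
  rewrite (_ : (fun n => false%:R * _) = cst 0); last by apply/funext => n; rewrite mul0r.
  rewrite lim_cst // add0r mul1r; apply: dvgP.
  by move=> h; move/negP: nC; apply; rewrite inE.
apply: measurable_funD; last first.
  by apply: measurable_funM => //; apply: measurable_indic; exact: measurableC.
apply: (measurable_fun_cvg (h := fun n w => \1_C w * S n w)) => [n|w _].
  by apply: measurable_funM => //; exact: measurable_indic.
have [|nC] := boolP (w \in C); rewrite indicE.
  move=> wC; rewrite wC; under eq_fun do rewrite mul1r.
  by move: wC; rewrite inE.
by rewrite (negbTE nC); under eq_fun do rewrite mul0r; exact: is_cvg_cst.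
Qed.

End RealSequences.

Section FatouL2.
Context d (T : measurableType d) (R : realType) (P : probability T R).

(** Turns a uniform L2 bound into a bound for an almost sure limit; it replaces an appeal to
    completeness of L2. *)
Lemma fatou_L2 (D : nat -> T -> R) (Y : T -> R) (c : R) :
  (forall n, D n \in Lfun P 2%:E) -> (forall n, ip P (D n) (D n) <= c) ->
  measurable_fun setT Y -> cvg_as P D Y ->
  Y \in Lfun P 2%:E /\ ip P Y Y <= c.
Proof.
move=> hD Dc mY DY.
have mF n : measurable_fun setT (fun w => (D n w ^+ 2)%:E).
  by apply/measurable_EFinP; apply: measurable_funX; exact: measurable_L2 (hD n).
have iY : (\int[P]_w (Y w ^+ 2)%:E <= c%:E)%E.
  rewrite (ae_eq_integral (fun w => limn_einf (fun n => (D n w ^+ 2)%:E))) //.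
  - apply: le_trans (fatou P measurableT mF _) _.
      by move=> n w _; rewrite lee_fin sqr_ge0.
    rewrite limn_einf_lim; apply: lime_le; first exact: is_cvg_einfs.
    apply: nearW => n; apply: le_trans (_ : \int[P]_w (D n w ^+ 2)%:E <= _)%E.
      by apply: ereal_inf_lbound; exists n => /=.
    by rewrite -ipE // lee_fin.
  - by apply/measurable_EFinP; exact: measurable_funX.
  - rewrite /limn_einf; apply: measurableT_comp => //.
    by apply: measurable_fun_limn_esup => n; exact: measurableT_comp.
  apply: filterS DY => w Dw _; apply/esym.
  have Dw2 : (fun n => (D n w ^+ 2)%:E) @ \oo --> (Y w ^+ 2)%:E.
    by apply: cvg_EFin; [exact: nearW|rewrite expr2; apply: cvgM].
  by rewrite (cvg_limn_einf_sup Dw2).1.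
have hY : Y \in Lfun P 2%:E.
  by apply/Lfun2P; split => //; apply: le_lt_trans iY (ltry _).
by split=> //; rewrite -lee_fin ipE.
Qed.

End FatouL2.

Section Kolmogorov0.
Context d (T : measurableType d) (R : realType) (P : probability T R).

Lemma L2_bounded_mul (Y Z : T -> R) : measurable_fun setT Z -> (forall w, `|Z w| <= 1) ->
  Y \in Lfun P 2%:E -> (fun w => Z w * Y w) \in Lfun P 2%:E.
Proof.
move=> mZ Z1 hY; have mY := measurable_L2 hY; apply/Lfun2P; split.
  exact: measurable_funM.
have /Lfun2P[_] := hY; apply: le_lt_trans; apply: ge0_le_integral => //.
- by move=> w _; rewrite lee_fin sqr_ge0.
- by apply/measurable_EFinP; apply: measurable_funX; exact: measurable_funM.
- by apply/measurable_EFinP; exact: measurable_funX.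
move=> w _; rewrite lee_fin exprMn ler_piMl ?sqr_ge0 //.
by rewrite -(real_normK (num_real (Z w))) expr_le1.
Qed.

End Kolmogorov0.

Section Kolmogorov.
Context d (T : measurableType d) (R : realType) (P : probability T R).

Definition past (X : nat -> T -> R) n : set (set T) :=
  [set E | exists k (B : set R), [/\ (k < n)%N, measurable B & E = X k @^-1` B]].

(** Each term is independent of every variable determined by its predecessors, which is the form the
    maximal inequality consumes. *)
Definition indep_seq (X : nat -> T -> R) := forall n (Z : T -> R),
  measurable_wrt (past X n) Z -> indep2 P Z (X n).

Lemma past_measurable (X : nat -> T -> R) n k : (k < n)%N -> measurable_wrt (past X n) (X k).
Proof.
move=> kn; apply/measurable_wrtP => B mB; apply: sub_sigma_algebra.
by exists k, B.
Qed.

Lemma past_sub (X : nat -> T -> R) m n : (m <= n)%N -> past X m `<=` past X n.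
Proof. by move=> mn _ [k [B [km mB ->]]]; exists k, B; split=> //; exact: leq_trans km mn. Qed.

Lemma past_wrt_sub (X : nat -> T -> R) m n (Z : T -> R) : (m <= n)%N ->
  measurable_wrt (past X m) Z -> measurable_wrt (past X n) Z.
Proof.
move=> mn; apply: measurable_wrt_sub => A pA.
by apply: sub_sigma_algebra; exact: past_sub pA.
Qed.

Lemma past_wrt_sum (X : nat -> T -> R) m n : (m <= n)%N ->
  measurable_wrt (past X n) (fun w => \sum_(k < m) X k w).
Proof.
move=> mn; apply: measurable_sum => k; apply: past_measurable.
exact: leq_trans (ltn_ord k) mn.
Qed.

Lemma indep_seq_shift (X : nat -> T -> R) m : indep_seq X -> indep_seq (fun n => X (m + n)%N).
Proof.
move=> iX n Z mZ; apply: iX; apply: measurable_wrt_sub mZ => _ [k [B [kn mB ->]]].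
apply: sub_sigma_algebra; exists (m + k)%N, B; split=> //.
by rewrite ltn_add2l.
Qed.

Variable X : nat -> T -> R.
Hypotheses (hX : forall n, X n \in Lfun P 2%:E) (X0 : forall n, \int[P]_w X n w = 0)
  (iX : indep_seq X).
Let S n w := \sum_(k < n) X k w.

Let hS n : S n \in Lfun P 2%:E.
Proof. by apply: L2_sum => i _; exact: hX. Qed.

Let SS n : S n.+1 = fun w => S n w + X n w.
Proof. by apply/funext => w; rewrite /S big_ord_recr. Qed.

Lemma ip_past_eq0 n Z : Z \in Lfun P 2%:E -> measurable_wrt (past X n) Z -> ip P Z (X n) = 0.
Proof. by move=> hZ mZ; rewrite ip_indep2 ?X0 ?mulr0 //; exact: iX. Qed.

Lemma ip_partial_sum n : ip P (S n) (S n) = \sum_(k < n) ip P (X k) (X k).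
Proof.
elim: n => [|n IH].
  rewrite big_ord0 /ip; under eq_Rintegral do rewrite /S big_ord0 mul0r.
  by rewrite Rintegral_cst // mul0r.
rewrite big_ord_recr /= -IH SS (ipDl (hS n) (hX n) (L2D (hS n) (hX n))).
rewrite (ipDr (hS n) (hX n) (hS n)) (ipDr (hS n) (hX n) (hX n)) (ipC _ (X n) (S n)).
rewrite ip_past_eq0 //; last exact: past_wrt_sum.
by rewrite addr0 add0r.
Qed.

Variable e : R.
Hypothesis e0 : 0 < e.

(** The indicator that the level [e] has been reached at some time [k <= n]. As [S n] only involves
    the terms before [X n], it is determined by [past X n], hence independent of [X n]. *)
Let reached n w : R := (has (fun k => e <= `|S k w|) (iota 0 n.+1))%:R.

Let reachedS n w : reached n.+1 w = if e <= `|S n.+1 w| then 1 else reached n w.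
Proof.
rewrite /reached -[n.+2]addn1 iotaD has_cat add0n [has _ (iota n.+1 1)]/= orbF.
by case: ifP => _; rewrite ?orbT ?orbF.
Qed.

Let reached0 w : reached 0 w = 0.
Proof. by rewrite /reached /= orbF /S big_ord0 normr0 leNgt e0. Qed.

Let reached_past n : measurable_wrt (past X n) (reached n).
Proof.
elim: n => [|n IH].
  by rewrite (_ : reached 0 = cst 0); [exact: measurable_cst|apply/funext => w; rewrite reached0].
pose E := [set w : g_sigma_algebraType (past X n.+1) | e <= `|S n.+1 w|].
have mE : measurable E by apply: measurable_ge_norm_set; exact: past_wrt_sum.
rewrite (_ : reached n.+1 = fun w => \1_E w + (1 - \1_E w) * reached n w).
  have mI : measurable_wrt (past X n.+1) (\1_E : T -> R) by exact: measurable_indic.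
  apply: measurable_funD => //; apply: measurable_funM; first exact: measurable_funB.
  exact: past_wrt_sub IH.
apply/funext => w; rewrite reachedS indicE.
have -> : (w \in E) = (e <= `|S n.+1 w|) by apply/idP/idP; rewrite inE.
by case: ifP => _ /=; rewrite ?subrr ?mul0r ?addr0 // subr0 mul1r add0r.
Qed.

Let reached_le1 n w : `|reached n w| <= 1.
Proof. by rewrite /reached normr_nat lern1; case: has. Qed.

Let reached01 n w : reached n w = 0 \/ reached n w = 1.
Proof. by rewrite /reached; case: has; [right|left]. Qed.

Let reached_measurable n : measurable_fun setT (reached n).
Proof.
move=> _ B mB; rewrite setTI.
have /measurable_wrtP /(_ B mB) := @reached_past n; apply: sub_sigma_measurable.
move=> _ [k [C [_ mC ->]]]; rewrite -[_ @^-1` _]setTI.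
exact: (measurable_L2 (hX k)).
Qed.

Let reached_mul n Y : Y \in Lfun P 2%:E -> (fun w => reached n w * Y w) \in Lfun P 2%:E.
Proof. by apply: L2_bounded_mul. Qed.

Let hR n : reached n \in Lfun P 2%:E.
Proof. by have := reached_mul n (L2_cst P 1); under eq_fun do rewrite /= mulr1. Qed.

Let stopped n w := reached n w * S n w.

Let hU n : stopped n \in Lfun P 2%:E.
Proof. exact: reached_mul. Qed.

(* After the hitting time the partial sum has orthogonal increments, so its second moment
   on the event can only grow. *)
Let maximal n : e ^+ 2 * ip P (reached n) (reached n) <= ip P (stopped n) (stopped n).
Proof.
elim: n => [|n IH].
  rewrite (_ : ip P (reached 0) _ = 0) ?mulr0 ?ip_ge0 //.
  rewrite /ip; under eq_Rintegral do rewrite reached0 mul0r.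
  by rewrite Rintegral_cst // mul0r.
pose V w := reached n w * S n.+1 w.
have hV : V \in Lfun P 2%:E by exact: reached_mul.
have VE : V = fun w => stopped n w + reached n w * X n w.
  by apply/funext => w; rewrite /V /stopped SS mulrDr.
have UV : ip P (stopped n) (stopped n) <= ip P V V.
  have hRX : (fun w => reached n w * X n w) \in Lfun P 2%:E by exact: reached_mul.
  have c0 : ip P (stopped n) (fun w => reached n w * X n w) = 0.
    rewrite -[RHS](@ip_past_eq0 n (stopped n) (hU n)); last first.
      have m1 := @reached_past n; have m2 : measurable_wrt (past X n) (S n) by apply: past_wrt_sum.
      exact: (measurable_funM m1 m2).
    apply: eq_Rintegral => w _; rewrite /stopped.
    by case: (reached01 n w) => ->; rewrite ?mul0r // !mul1r.
  rewrite VE (ipDl (hU n) hRX (L2D (hU n) hRX)).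
  rewrite (ipDr (hU n) hRX (hU n)) (ipDr (hU n) hRX hRX) (ipC _ _ (stopped n)) c0.
  by rewrite addr0 add0r lerDl ip_ge0.
(* This holds pointwise under the integral: where the level is first reached at time [n.+1], the
   square of [S n.+1] is at least [e ^+ 2]; elsewhere the two sides agree. *)
suff : e ^+ 2 * ip P (reached n.+1) (reached n.+1) + ip P V V <=
    ip P (stopped n.+1) (stopped n.+1) + e ^+ 2 * ip P (reached n) (reached n).
  by move: IH UV; lra.
rewrite /ip -!RintegralZl //; try exact: L2M_integrable.
rewrite -!RintegralD //; try exact: L2M_integrable; try exact: L2MZ_integrable.
apply: le_Rintegral => //.
- exact: (@integrableD _ _ _ P _ measurableT _ _ (L2MZ_integrable _ (hR n.+1) (hR n.+1)) (L2M_integrable hV hV)).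
- exact: (@integrableD _ _ _ P _ measurableT _ _ (L2M_integrable (hU n.+1) (hU n.+1)) (L2MZ_integrable _ (hR n) (hR n))).
move=> w _; rewrite /V /stopped reachedS.
case: ifPn => h; case: (reached01 n w) => ->; rewrite ?(mul0r, mulr0, mul1r, mulr1, addr0, add0r) //.
  by rewrite -expr2 -(real_normK (num_real (S n.+1 w))) lerXn2r // nnegrE // ltW.
all: by rewrite addrC.
Qed.

Lemma kolmogorov_maximal n :
  (P [set w | exists2 k, (k <= n)%N & (e <= `|S k w|)%R]
   <= ((\sum_(k < n) ip P (X k) (X k)) / e ^+ 2)%:E)%E.
Proof.
have e20 : 0 < e ^+ 2 by exact: exprn_gt0.
pose D := [set w | exists2 k, (k <= n)%N & (e <= `|S k w|)%R].
have DR w : reached n w = \1_D w.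
  rewrite indicE /reached; congr (_%:R); congr nat_of_bool; apply/idP/idP.
    by move=> /hasP[k]; rewrite mem_iota ltnS => /= kn h; rewrite inE; exists k.
  by rewrite inE => -[k kn h]; apply/hasP; exists k => //; rewrite mem_iota ltnS.
have mD : measurable D.
  rewrite (_ : D = reached n @^-1` [set 1]); last first.
    apply/seteqP; split => w; rewrite /= DR indicE => h.
      by rewrite mem_set.
    apply: contrapT => h2; move: h; rewrite memNset // => /eqP.
    by rewrite eq_sym oner_eq0.
  by rewrite -[_ @^-1` _]setTI; apply: reached_measurable.
have PD : (P D = (ip P (reached n) (reached n))%:E)%E.
  rewrite ipE //; transitivity (P (D `&` setT)); first by rewrite setIT.
  rewrite -(integral_indic P measurableT mD).
  by apply: eq_integral => w _; rewrite DR indicE; case: (_ \in _); rewrite ?expr1n ?expr0n.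
rewrite PD lee_fin ler_pdivlMr // mulrC; apply: le_trans (maximal n) _.
rewrite -ip_partial_sum; apply: le_Rintegral => //; [exact: L2M_integrable..|].
move=> w _; rewrite /stopped; case: (reached01 n w) => ->; rewrite ?mul1r // !mul0r.
by rewrite -expr2 sqr_ge0.
Qed.

End Kolmogorov.

Section IndependentSeries.
Context d (T : measurableType d) (R : realType) (P : probability T R).
Variable X : nat -> T -> R.
Hypotheses (hX : forall n, X n \in Lfun P 2%:E) (X0 : forall n, \int[P]_w X n w = 0)
  (iX : indep_seq P X).
Variable b : R.
Hypothesis Xb : forall n, \sum_(k < n) ip P (X k) (X k) <= b.
Let S n w := \sum_(k < n) X k w.
Let v n := \sum_(k < n) ip P (X k) (X k).

Let hS n : S n \in Lfun P 2%:E.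
Proof. by apply: L2_sum => i _; exact: hX. Qed.

Let Sshift m k w : S (m + k)%N w - S m w = \sum_(i < k) X (m + i)%N w.
Proof. by rewrite /S big_split_ord /= addrAC subrr add0r. Qed.

Let vshift m k : v (m + k)%N - v m = \sum_(i < k) ip P (X (m + i)%N) (X (m + i)%N).
Proof. by rewrite /v big_split_ord /= addrAC subrr add0r. Qed.

Let v_nd : {homo v : m n / (m <= n)%N >-> m <= n}.
Proof.
move=> m n mn; rewrite -(subnKC mn) -subr_ge0 vshift.
by apply: sumr_ge0 => i _; exact: ip_ge0.
Qed.

Let v_cvg : cvgn v.
Proof.
apply: nondecreasing_is_cvgn; first exact: v_nd.
by exists b => _ [n _ <-]; exact: Xb.
Qed.

Let V := limn v.

Let v_le n : v n <= V.
Proof. exact: nondecreasing_cvgn_le. Qed.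

Let tail_cvg0 : (fun n => V - v n) @ \oo --> (0 : R).
Proof. by rewrite -(subrr V); apply: cvgB => //; exact: cvg_cst. Qed.

Let increment_norm m n : (m <= n)%N ->
  ip P (fun w => S n w - S m w) (fun w => S n w - S m w) <= V - v m.
Proof.
move=> mn; rewrite -(subnKC mn).
have -> : (fun w => S (m + (n - m))%N w - S m w) = (fun w => \sum_(i < n - m) X (m + i)%N w).
  by apply/funext => w; rewrite Sshift.
rewrite (@ip_partial_sum _ _ _ P (fun i => X (m + i)%N)) //; last exact: indep_seq_shift.
by rewrite -vshift lerD2r.
Qed.

(** The maximal inequality for the shifted sequence is uniform in the horizon; the events increase
    with the horizon, so continuity from below applies. *)
Let tail_maximal m (e : R) : 0 < e ->
  (P [set w | exists k, (e <= `|S (m + k)%N w - S m w|)%R] <= ((V - v m) / e ^+ 2)%:E)%E.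
Proof.
move=> e0.
pose D n := [set w | exists2 k, (k <= n)%N & (e <= `|\sum_(i < k) X (m + i)%N w|)%R].
have mD n : measurable (D n).
  rewrite (_ : D n = \bigcup_(k in [set k | (k <= n)%N]) [set w | e <= `|\sum_(i < k) X (m + i)%N w|]).
    apply: bigcup_measurable => k _; apply: measurable_ge_norm_set.
    by apply: measurable_sum => i; exact: measurable_L2 (hX _).
  by apply/seteqP; split => w /= [k kn h]; exists k.
have UD : \bigcup_n D n = [set w | exists k, e <= `|S (m + k)%N w - S m w|].
  apply/seteqP; split => w /=.
    by move=> [n _ [k _ h]]; exists k; rewrite Sshift.
  by move=> [k h]; exists k => //; exists k => //; rewrite -Sshift.
have H : (P \o D) @ \oo --> P (\bigcup_n D n).
  apply: nondecreasing_cvg_mu => //.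
    exact: bigcupT_measurable.
  move=> n n' nn'; apply/subsetPset => w [k kn h]; exists k => //.
  exact: leq_trans kn nn'.
rewrite -UD -(cvg_lim _ H) //; apply: lime_le; first by apply/cvg_ex; eexists; exact: H.
apply: nearW => n; apply: le_trans.
  apply: (@kolmogorov_maximal _ _ _ P (fun i => X (m + i)%N)) => //.
  exact: indep_seq_shift.
by rewrite lee_fin ler_wpM2r ?invr_ge0 ?sqr_ge0 // -vshift lerD2r.
Qed.

(** Divergence means that for some [j] the sums move by at least [1/(j+1)] after every [m]. For
    fixed [j] the probability of this is bounded by a multiple of the tail [V - v m] of the
    variances, which tends to 0. *)
Lemma indep_series_cvg : {ae P, forall w, cvgn (fun n => S n w)}.
Proof.
pose B j m := [set w | exists k, j.+1%:R^-1 <= `|S (m + k)%N w - S m w|].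
have mB j m : measurable (B j m).
  rewrite (_ : B j m = \bigcup_k [set w | j.+1%:R^-1 <= `|S (m + k)%N w - S m w|]).
    apply: bigcupT_measurable => k; apply: measurable_ge_norm_set.
    by apply: measurable_funB; exact: measurable_L2 (hS _).
  by apply/seteqP; split => w /= [k]; [move=> h; exists k|move=> _ h; exists k].
have mC j : measurable (\bigcap_m B j m) by exact: bigcapT_measurable.
have N : P.-negligible (\bigcup_j \bigcap_m B j m).
  apply: negligible_bigcup => j; apply/negligibleP => //.
  apply/eqP; rewrite eq_le measure_ge0 andbT; apply/lee_addgt0Pr => r r0.
  have j0 : 0 < j.+1%:R^-1 :> R by rewrite invr_gt0.
  have r1 : 0 < r * j.+1%:R^-1 ^+ 2 by rewrite mulr_gt0 // exprn_gt0.
  have /cvgr0Pnorm_lt /(_ _ r1) [m _ /(_ m (leqnn m)) Hm] := tail_cvg0.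
  rewrite add0e; apply: le_trans (_ : P (B j m) <= _)%E.
    by apply: le_measure; rewrite ?inE //; exact: bigcap_inf.
  apply: le_trans (tail_maximal m j0) _; rewrite lee_fin ler_pdivrMr ?exprn_gt0 //.
  by rewrite ltW //; apply: le_lt_trans Hm; exact: ler_norm.
apply: negligibleS N => w /= h; apply: contrapT => h2; apply: h.
apply/cvgn_oscillationP => j; apply: contrapT => h3; apply: h2.
exists j => // m _; apply: contrapT => h4; apply: h3; exists m => k.
rewrite leNgt; apply/negP => h5; apply: h4; exists k; exact: ltW.
Qed.

Lemma indep_series_cvg_as : cvg_as P S (fun w => limn (fun n => S n w)).
Proof. by apply: filterS indep_series_cvg. Qed.

(** Fatou's lemma for the increments [S (n + k) - S n], as [k] grows, bounds the squared distance
    from [S n] to the limit by the tail of the variances. *)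
Lemma indep_series_cvg_L2 : let f w := limn (fun n => S n w) in
  f \in Lfun P 2%:E /\ cvgL2 P S f.
Proof.
move=> f; have mf : measurable_fun setT f.
  by apply: measurable_limn => n; exact: measurable_L2 (hS n).
have H n : (fun w => f w - S n w) \in Lfun P 2%:E /\
    ip P (fun w => f w - S n w) (fun w => f w - S n w) <= V - v n.
  apply: (@fatou_L2 _ _ _ P (fun k w => S (n + k)%N w - S n w)).
  - by move=> k; exact: L2B.
  - by move=> k; apply: increment_norm; exact: leq_addr.
  - by apply: measurable_funB => //; exact: measurable_L2 (hS n).
  apply: filterS indep_series_cvg_as => w Sw; apply: cvgB; last exact: cvg_cst.
  under eq_fun do rewrite addnC.
  by have := Sw; rewrite -(cvg_shiftn n (fun k => S k w)).
split.
  have := L2D (H 0%N).1 (hS 0).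
  by under eq_fun do rewrite subrK.
apply: (squeeze_cvgr _ (cvg_cst 0) tail_cvg0); apply: nearW => n.
rewrite ip_ge0 /=; apply: le_trans (H n).2; rewrite le_eqVlt; apply/orP; left; apply/eqP.
by apply: eq_Rintegral => w _; rewrite -opprB mulrNN.
Qed.

End IndependentSeries.

(** * Gaussian spaces *)

Section GaussianSpace.
Context d (T : measurableType d) (R : realType) (P : probability T R).
Implicit Types (V : set (T -> R)) (X Y : T -> R).

Definition gaussian_space V :=
  (forall X, V X -> exists s, normal_law P X 0 s) /\
  (forall a X Y, V X -> V Y -> V (fun w => a * X w + Y w)).

Definition L2_closure V X :=
  X \in Lfun P 2%:E /\ exists S, (forall n, V (S n)) /\ cvgL2 P S X.

Lemma gaussian_space_L2 V X : gaussian_space V -> V X -> X \in Lfun P 2%:E.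
Proof. by move=> [VN _] /VN [s /normal_law_L2[]]. Qed.

Lemma gaussian_space_mean V X : gaussian_space V -> V X -> \int[P]_w X w = 0.
Proof. by move=> [VN _] /VN [s /normal_law_mean]. Qed.

Lemma gaussian_space_closure V : gaussian_space V -> gaussian_space (L2_closure V).
Proof.
move=> VG; have [VN VL] := VG; split.
  move=> X [hX [S [VS SX]]]; exists (Num.sqrt (ip P X X)).
  have /choice [s Hs] n : exists s, normal_law P (S n) 0 s by exact: VN.
  exact: normal_law_cvgL2 Hs hX SX.
move=> a X Y [hX [S [VS SX]]] [hY [S' [VS' SY]]].
have hS n := gaussian_space_L2 VG (VS n); have hS' n := gaussian_space_L2 VG (VS' n).
split; first exact: L2D (L2Z a hX) hY.
by exists (fun n w => a * S n w + S' n w); split; [move=> n; exact: VL|exact: cvgL2_lin].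
Qed.

Lemma gaussian_space0 V X : gaussian_space V -> V X -> V (fun=> 0).
Proof.
move=> [_ VL] VX; have := VL (-1) _ _ VX VX; congr V.
by apply/funext => w; rewrite mulN1r addNr.
Qed.

Lemma gaussian_space_sum V (I : Type) (s : seq I) (a : I -> R) (X : I -> T -> R) :
  gaussian_space V -> V (fun=> 0) -> (forall i, V (X i)) ->
  V (fun w => \sum_(i <- s) a i * X i w).
Proof.
move=> [_ VL] V0 VX; elim: s => [|i s IH].
  by under eq_fun do rewrite big_nil.
by under eq_fun do rewrite big_cons; exact: VL.
Qed.

Lemma gaussian_space_function V (T' : Type) (A : set T') (X : T' -> T -> R) :
  gaussian_space V -> V (fun=> 0) -> (forall t, A t -> V (X t)) -> gaussian_function P A X.
Proof.
move=> VG V0 VX m t a At; have [VN _] := VG.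
have : V (fun w => \sum_(i < m) a i * X (t i) w).
  by apply: (@gaussian_space_sum V _ _ a (fun i => X (t i))) => // i; exact: VX.
by move=> /VN [s Hs]; apply/gaussian_rvP; exists 0, s.
Qed.

End GaussianSpace.

Section CenteredCovariance.
Context d (T : measurableType d) (R : realType) (P : probability T R).
Implicit Types X Y : T -> R.

Lemma expectation_eq0 X : X \in Lfun P 2%:E -> \int[P]_w X w = 0 -> ('E_P[X] = 0)%E.
Proof.
move=> hX X0; rewrite unlock -[RHS]/(0%R%:E) -X0 /Rintegral fineK //.
by apply: integrable_fin_num => //; exact: L2_integrable.
Qed.

Lemma covariance_ip X Y : X \in Lfun P 2%:E -> Y \in Lfun P 2%:E ->
  \int[P]_w X w = 0 -> \int[P]_w Y w = 0 -> covariance P X Y = (ip P X Y)%:E.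
Proof.
move=> hX hY X0 Y0; rewrite unlock (expectation_eq0 hX X0) (expectation_eq0 hY Y0) /= unlock /ip fineK; last first.
  by apply: integrable_fin_num => //; exact: L2M_integrable hX hY.
apply: eq_integral => w _; congr (_%:E).
by rewrite -[LHS]/((X w - 0) * (Y w - 0)) !subr0.
Qed.

End CenteredCovariance.

Section IndependentFamily.
Context d (T : measurableType d) (R : realType) (P : probability T R).
Variables (I : choiceType) (J : set I) (D : set R) (g : I -> R -> T -> R)
  (K : I -> R -> R -> R).
Hypothesis gG : forall i, J i -> centered_gaussian P D (g i) (K i).
Hypothesis gI : independent_functions P D J g.

Definition fields (i : I) := generated_sigma_algebra D (g i).
Definition fields_on (J1 : set I) := union_system fields J1.

(** [gaussian_function] leaves the mean of a combination open; here it is 0 by linearity, the fields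
    being centered. *)
Lemma gaussian_normal i (m : nat) (t : 'I_m -> R) (a : 'I_m -> R) : J i ->
  (forall l, D (t l)) -> exists s, normal_law P (fun w => \sum_(l < m) a l * g i (t l) w) 0 s.
Proof.
move=> Ji Dt; have [gF g0 _] := gG Ji.
have g1 r : D r -> exists s, normal_law P (g i r) 0 s.
  move=> Dr; have /gaussian_rvP [mu [s Hs]] := gF 1%N (fun=> r) (fun=> 1) (fun=> Dr).
  have E : (fun w => \sum_(l < 1) 1 * g i r w) = g i r.
    by apply/funext => w; rewrite big_ord1 mul1r.
  rewrite E in Hs; suff E0 : mu = 0 by rewrite E0 in Hs; exists s.
  by rewrite -(normal_law_mean Hs) /Rintegral; have := g0 _ Dr; rewrite unlock => ->.
have gL2 l : g i (t l) \in Lfun P 2%:E by have [s /normal_law_L2[]] := g1 _ (Dt l).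
have /gaussian_rvP [mu [s Hs]] := gF m t a Dt.
suff E0 : mu = 0 by rewrite E0 in Hs; exists s.
rewrite -(normal_law_mean Hs).
have := @ip_suml _ _ _ P _ (index_enum 'I_m) xpredT (fun l w => a l * g i (t l) w) (cst 1).
rewrite /ip; under eq_Rintegral do rewrite mulr1; move=> ->; [|by move=> l _; exact: L2Z|exact: L2_cst].
apply: big1 => l _; under eq_Rintegral do rewrite mulr1.
have [s1 Hs1] := g1 _ (Dt l); have := ipZl (a l) (gL2 l) (L2_cst P 1).
rewrite /ip; under eq_Rintegral do rewrite mulr1; move=> ->.
by under eq_Rintegral do rewrite mulr1; rewrite (normal_law_mean Hs1) mulr0.
Qed.

Lemma gaussian_normal1 i r : J i -> D r -> exists s, normal_law P (g i r) 0 s.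
Proof.
move=> Ji Dr; have [s Hs] := @gaussian_normal i 1 (fun=> r) (fun=> 1) Ji (fun=> Dr).
by exists s; move: Hs; under eq_fun do rewrite big_ord1 mul1r.
Qed.

Lemma gaussian_L2 i r : J i -> D r -> g i r \in Lfun P 2%:E.
Proof. by move=> Ji Dr; have [s /normal_law_L2[]] := gaussian_normal1 Ji Dr. Qed.

Lemma gaussian_mean i r : J i -> D r -> \int[P]_w g i r w = 0.
Proof. by move=> Ji Dr; have [s /normal_law_mean] := gaussian_normal1 Ji Dr. Qed.

Lemma gaussian_ip i r s : J i -> D r -> D s -> ip P (g i r) (g i s) = K i r s.
Proof.
move=> Ji Dr Ds; have [_ g0 gC] := gG Ji; apply: EFin_inj; rewrite -gC //.
by rewrite covariance_ip ?gaussian_mean // gaussian_L2.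
Qed.

Lemma fields_measurable i : J i -> fields i `<=` d.-measurable.
Proof.
move=> Ji; apply: sub_sigma_measurable => _ [r [B [Dr mB ->]]].
by rewrite -[_ @^-1` _]setTI; exact: (measurable_L2 (gaussian_L2 Ji Dr)).
Qed.

Lemma fields_setI i : J i -> setI_closed (fields i).
Proof. by move=> _ A B; exact: (@measurableI _ (g_sigma_algebraType _)). Qed.

Lemma fields_setT i : J i -> fields i setT.
Proof. by move=> _; exact: (@measurableT _ (g_sigma_algebraType _)). Qed.

Lemma gaussian_wrt (J1 : set I) i r : J1 i -> D r -> measurable_wrt (fields_on J1) (g i r).
Proof.
move=> Ji Dr; apply/measurable_wrtP => B mB; apply: sub_sigma_algebra.
by exists i => //; apply: sub_sigma_algebra; exists r, B.
Qed.

Lemma fields_on_sub (J1 J2 : set I) X : J1 `<=` J2 ->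
  measurable_wrt (fields_on J1) X -> measurable_wrt (fields_on J2) (X : T -> R).
Proof.
move=> J12; apply: measurable_wrt_sub => A [i Ji Ai]; apply: sub_sigma_algebra.
by exists i => //; exact: J12.
Qed.

Lemma fields_on_indep (J1 J2 : set I) : J1 `<=` J -> J2 `<=` J -> [disjoint J1 & J2] ->
  forall E1 E2, <<s fields_on J1 >> E1 -> <<s fields_on J2 >> E2 ->
  P (E1 `&` E2) = (P E1 * P E2)%E.
Proof.
exact: (union_system_indep fields_measurable fields_setI fields_setT gI).
Qed.

Lemma fields_on_indep2 (J1 J2 : set I) X Y : J1 `<=` J -> J2 `<=` J -> [disjoint J1 & J2] ->
  measurable_wrt (fields_on J1) X -> measurable_wrt (fields_on J2) Y -> indep2 P X Y.
Proof.
move=> J1J J2J J12 /measurable_wrtP hX /measurable_wrtP hY A B mA mB.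
by apply: (fields_on_indep J1J J2J J12); [exact: hX|exact: hY].
Qed.

(** Finite linear combinations of the field values, as lists of a coefficient, an index and a
    radius; addition is concatenation and repetitions are allowed. *)
Definition family_span : set (T -> R) := [set X | exists s : seq (R * (I * R)),
  (forall p, p \in s -> J p.2.1 /\ D p.2.2) /\
  X = fun w => \sum_(p <- s) p.1 * g p.2.1 p.2.2 w].

Lemma measurable_wrt_bigsum (G : set (set T)) (I' : eqType) (s : seq I') (Z : I' -> T -> R) :
  (forall i, i \in s -> measurable_wrt G (Z i)) ->
  measurable_wrt G (fun w => \sum_(i <- s) Z i w).
Proof.
move=> mZ; under eq_fun do rewrite big_tnth.
by apply: measurable_sum => l; apply: mZ; exact: mem_tnth.
Qed.

Lemma normal_sum_indep (Z : I -> T -> R) (s : seq I) : uniq s ->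
  (forall i, i \in s -> J i) -> (forall i, i \in s -> measurable_wrt (fields_on [set i]) (Z i)) ->
  (forall i, i \in s -> exists c, normal_law P (Z i) 0 c) ->
  exists c, normal_law P (fun w => \sum_(i <- s) Z i w) 0 c.
Proof.
elim: s => [|i s IH] us sJ mZ NZ.
  exists 0; split => // [|B mB].
    by under eq_fun do rewrite big_nil; exact: measurable_cst.
  rewrite (_ : (fun z : R => 0 * z + 0) = cst 0); last by apply/funext => z; rewrite mul0r add0r.
  rewrite (_ : (fun w => \sum_(i <- [::]) Z i w) = cst 0); last by apply/funext => z; rewrite big_nil.
  rewrite !preimage_cst; case: ifP => _; last by rewrite !measure0.
  by rewrite probability_setT; apply/esym; exact: probability_setT.
move: us => /= /andP[si us].
have si' j : j \in s -> j \in i :: s by move=> js; rewrite in_cons js orbT.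
have [c1 N1] := NZ i (mem_head _ _).
have [c2 N2] : exists c, normal_law P (fun w => \sum_(i <- s) Z i w) 0 c.
  by apply: IH => // j /si'; [exact: sJ|exact: mZ|exact: NZ].
exists (Num.sqrt (c1 ^+ 2 + c2 ^+ 2)).
under eq_fun do rewrite big_cons.
rewrite -[X in normal_law _ _ X]addr0; apply: normal_lawD => //.
apply: (@fields_on_indep2 [set i] [set` s]).
- by move=> _ ->; apply: sJ; exact: mem_head.
- by move=> j /= js; apply: sJ; exact: si'.
- by apply/disj_setPS => j [/= ->]; rewrite (negbTE si).
- by apply: mZ; exact: mem_head.
apply: measurable_wrt_bigsum => j js; apply: fields_on_sub (mZ j (si' j js)) => _ -> //.
Qed.

(** Joint normality across different fields is not assumed; it follows from normality inside each
    field and independence between the fields. *)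
Lemma family_span_gaussian : gaussian_space P family_span.
Proof.
split=> [_ [s [sJ ->]]|a _ _ [s [sJ ->]] [s' [sJ' ->]]]; last first.
  exists ([seq (a * p.1, p.2) | p <- s] ++ s'); split.
    by move=> p; rewrite mem_cat => /orP[/mapP[q qs ->]|]; [exact: (sJ q qs)|exact: sJ'].
  apply/funext => w; rewrite big_cat big_map mulr_sumr /=; congr (_ + _).
  by apply: eq_bigr => p _; rewrite mulrA.
(* [U] lists the fields that occur, and [Z i] collects the terms of field [i], so that
   [normal_sum_indep] applies to distinct indices. *)
pose U := undup [seq p.2.1 | p <- s].
pose Z i w := \sum_(p <- s | p.2.1 == i) p.1 * g p.2.1 p.2.2 w.
have -> : (fun w => \sum_(p <- s) p.1 * g p.2.1 p.2.2 w) = (fun w => \sum_(i <- U) Z i w).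
  apply/funext => w; rewrite /Z; under [RHS]eq_bigr do rewrite big_mkcond.
  rewrite exchange_big /= big_seq [RHS]big_seq; apply: eq_bigr => p ps.
  have pU : p.2.1 \in U by rewrite mem_undup; exact: map_f.
  rewrite (bigD1_seq _ pU (undup_uniq _)) /= eqxx big1 ?addr0 // => i.
  by rewrite eq_sym => /negbTE ->.
have UJ i : i \in U -> J i.
  by rewrite mem_undup => /mapP[p ps ->]; have [] := sJ p ps.
have termE i p w : (if p.2.1 == i then p.1 * g p.2.1 p.2.2 w else 0) =
    (if p.2.1 == i then p.1 else 0) * g i p.2.2 w.
  by case: eqP => [->//|_]; rewrite mul0r.
apply: normal_sum_indep => //; first exact: undup_uniq.
  move=> i iU; have Ji := UJ _ iU.
  rewrite /Z; under eq_fun do rewrite big_mkcond.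
  apply: measurable_wrt_bigsum => p ps; under eq_fun do rewrite termE.
  apply: measurable_funM => //; apply: gaussian_wrt => //.
  by have [] := sJ p ps.
move=> i /UJ Ji.
have -> : Z i = fun w => \sum_(l < size s) (if (tnth (in_tuple s) l).2.1 == i then
    (tnth (in_tuple s) l).1 else 0) * g i (tnth (in_tuple s) l).2.2 w.
  apply/funext => w; rewrite /Z big_mkcond big_tnth.
  by apply: eq_bigr => l _; rewrite termE.
by apply: gaussian_normal => // l; have [] := sJ _ (mem_tnth l (in_tuple s)).
Qed.

End IndependentFamily.

(** * Sums along exhaustions *)

Section FsetSums.
Variables (I : choiceType) (V : zmodType) (f : I -> V).
Implicit Types F : {fset I}.

Lemma fset_sum_diff F F' : (F `<=` F')%fset ->
  \sum_(i <- F') f i - \sum_(i <- F) f i = \sum_(i <- (F' `\` F)%fset) f i.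
Proof.
move=> FF'; have p : perm_eq F' (F ++ (F' `\` F)%fset).
  apply: uniq_perm => [//||i].
    rewrite cat_uniq !fset_uniq andbT /=; apply/hasPn => i.
    by rewrite in_fsetD => /andP[].
  rewrite mem_cat in_fsetD; case: (boolP (i \in F)) => //= iF.
  by apply: (fsubsetP FF').
by rewrite (perm_big _ p) big_cat /= addrAC subrr add0r.
Qed.

Variable A : nat -> {fset I}.
Hypothesis HA : exhaustion A.

Lemma exhaustion_le m n : (m <= n)%N -> (A m `<=` A n)%fset.
Proof.
elim: n => [|n IH]; first by rewrite leqn0 => /eqP ->.
rewrite leq_eqVlt => /orP[/eqP -> //|]; rewrite ltnS => /IH /fsubset_trans; apply.
by have [] := HA.
Qed.

Lemma exhaustion_sub F : exists m, (F `<=` A m)%fset.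
Proof.
have [_ H] := HA; have /choice [m Hm] := H.
exists (\max_(i <- F) m i)%N; apply/fsubsetP => i iF.
apply: (fsubsetP (exhaustion_le _)) (Hm i).
by rewrite (big_rem i iF) /= leq_maxl.
Qed.

End FsetSums.

Section ExhaustionSeries.
Context d (T : measurableType d) (R : realType) (P : probability T R).
Variables (I : choiceType) (G : I -> set (set T)) (t : I -> T -> R) (b : R).
Hypothesis GI : forall (J1 J2 : set I) (X Y : T -> R), [disjoint J1 & J2] ->
  measurable_wrt (union_system G J1) X -> measurable_wrt (union_system G J2) Y -> indep2 P X Y.
Hypothesis tG : forall i, measurable_wrt (union_system G [set i]) (t i).
Hypothesis ht : forall i, t i \in Lfun P 2%:E.
Hypothesis t0 : forall i, \int[P]_w t i w = 0.
Implicit Types F : {fset I}.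
Let S F w := \sum_(i <- F) t i w.
Let v F := \sum_(i <- F) ip P (t i) (t i).
Hypothesis vb : forall F, v F <= b.

Let hS F : S F \in Lfun P 2%:E. Proof. exact: L2_sum. Qed.

Let mS F : measurable_wrt (union_system G [set` F]) (S F).
Proof.
apply: measurable_wrt_bigsum => i iF; apply: (measurable_wrt_sub _ (@tG i)) => E [_ -> GE].
by apply: sub_sigma_algebra; exists i.
Qed.

Let ip_S F : ip P (S F) (S F) = v F.
Proof.
rewrite ip_suml //; rewrite big_seq /v [RHS]big_seq; apply: eq_bigr => i iF.
rewrite ip_sumr // (bigD1_seq i) //= big1 ?addr0 // => j ji.
rewrite ip_indep2 ?t0 ?mulr0 //; apply: (GI _ (@tG i) (@tG j)).
by apply/disj_setPS => k [/= -> ij]; rewrite ij eqxx in ji.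
Qed.

Let mean_S F : \int[P]_w S F w = 0.
Proof.
have := @ip_suml _ _ _ P _ (enum_fset F) xpredT t (cst 1) (fun i _ => ht i) (L2_cst P 1).
rewrite /ip; under eq_Rintegral do rewrite mulr1; move=> ->.
by apply: big1 => i _; under eq_Rintegral do rewrite mulr1; exact: t0.
Qed.

Let S_diff F F' : (F `<=` F')%fset -> (fun w => S F' w - S F w) = S (F' `\` F)%fset.
Proof. by move=> FF'; apply/funext => w; exact: fset_sum_diff. Qed.

Let v_diff F F' : (F `<=` F')%fset -> v F' - v F = v (F' `\` F)%fset.
Proof. exact: fset_sum_diff. Qed.

Let v_ge0 F : 0 <= v F. Proof. by apply: sumr_ge0 => i _; exact: ip_ge0. Qed.

Let v_le F F' : (F `<=` F')%fset -> v F <= v F'.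
Proof. by move=> /v_diff H; rewrite -subr_ge0 H. Qed.

Section OneExhaustion.
Variable A : nat -> {fset I}.
Hypothesis HA : exhaustion A.

(** The increments [X n] sum over the disjoint sets of indices that are new at stage [n]. They form
    an independent sequence, whose partial sums are the sums along the exhaustion, delayed by
    one. *)
Let prev n := if n is k.+1 then A k else fset0.
Let X n := S (A n `\` prev n)%fset.

Let prev_sub n : (prev n `<=` A n)%fset.
Proof. by case: n => [|n]; [exact: fsub0set|exact: HA.1]. Qed.

Let sub_prev k n : (k < n)%N -> (A k `<=` prev n)%fset.
Proof. by case: n => // n kn; exact: exhaustion_le. Qed.

Let sum_X n w : \sum_(k < n) X k w = S (prev n) w.
Proof.
elim: n => [|n IH]; first by rewrite big_ord0 /S big_seq_fset0.
by rewrite big_ord_recr /= IH /X -S_diff // addrC subrK.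
Qed.

Let X_indep : indep_seq P X.
Proof.
move=> n Z mZ; apply: (GI (J1 := [set` prev n]) (J2 := [set` (A n `\` prev n)%fset])).
- by apply/disj_setPS => i [/= h]; rewrite in_fsetD h.
- apply: (measurable_wrt_sub _ mZ) => _ [k [B [kn mB ->]]].
  have /measurable_wrtP /(_ B mB) := @mS (A k `\` prev k)%fset; apply: sub_sigma.
  move=> E [i /= iA GE]; apply: sub_sigma_algebra; exists i => //=.
  by apply: (fsubsetP (sub_prev kn)); move: iA; rewrite in_fsetD => /andP[].
- exact: mS.
Qed.

Lemma exhaustion_cvg : {ae P, forall w, cvgn (fun n => S (A n) w)}.
Proof.
have H n : \sum_(k < n) ip P (X k) (X k) <= b.
  suff -> : \sum_(k < n) ip P (X k) (X k) = v (prev n) by exact: vb.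
  elim: n => [|n IH]; first by rewrite big_ord0 /v big_seq_fset0.
  by rewrite big_ord_recr /= IH ip_S -v_diff // addrC subrK.
have := indep_series_cvg (fun n => @hS _) (fun n => @mean_S _) X_indep H.
apply: filterS => w /cvg_ex[l]; under eq_fun do rewrite sum_X.
by rewrite -(cvg_shiftS (fun n => S (prev n) w)) => h; apply/cvg_ex; exists l.
Qed.

(** The limit of the variances is the supremum over all finite sets, hence the same for every
    exhaustion; this makes the tails of two exhaustions comparable. *)
Lemma exhaustion_v_cvg : (fun n => v (A n)) @ \oo --> sup (range v).
Proof.
have sv : has_sup (range v).
  by split; [exists (v fset0), fset0|exists b => _ [F _ <-]].
apply/cvgrPdist_lt => e e0.
have [_ [F _ <-] hF] := sup_adherent e0 sv.
have [m Fm] := exhaustion_sub HA F; exists m => // n /= mn.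
have h1 : v (A n) <= sup (range v) by apply: ub_le_sup; [case: sv|exists (A n)].
rewrite ger0_norm ?subr_ge0 // ltrBlDl -ltrBlDr; apply: (lt_le_trans hF).
apply: v_le; apply: fsubset_trans Fm _; exact: exhaustion_le.
Qed.

End OneExhaustion.

(** Almost sure limits along [A] and along [B] both exist, but nothing identifies them pointwise.
    Fatou's lemma shows that each is an L2 limit along any exhaustion, and L2 limits are unique up
    to a null set. *)
Lemma exhaustion_limn (B A : nat -> {fset I}) : exhaustion B -> exhaustion A ->
  let f w := limn (fun n => S (B n) w) in
  [/\ f \in Lfun P 2%:E, cvgL2 P (fun n => S (A n)) f & cvg_as P (fun n => S (A n)) f].
Proof.
move=> HB HA f.
have key C D : exhaustion C -> exhaustion D -> let h w := limn (fun n => S (C n) w) in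
    h \in Lfun P 2%:E /\ cvgL2 P (fun n => S (D n)) h.
  move=> HC HD h.
  have mh : measurable_fun setT h.
    by apply: measurable_limn => n; exact: measurable_L2 (hS (C n)).
  have H n : (fun w => h w - S (D n) w) \in Lfun P 2%:E /\
    ip P (fun w => h w - S (D n) w) (fun w => h w - S (D n) w) <= sup (range v) - v (D n).
    (* From stage [m] on [C] contains [D n], so the differences are sums over the remaining indices,
       with variance at most the tail. *)
    have [m Dm] := exhaustion_sub HC (D n).
    apply: (@fatou_L2 _ _ _ P (fun k w => S (C (m + k)%N) w - S (D n) w)).
    - by move=> k; exact: L2B.
    - move=> k; have DC : (D n `<=` C (m + k)%N)%fset.
        by apply: fsubset_trans Dm _; apply: exhaustion_le => //; exact: leq_addr.
      rewrite (S_diff DC) ip_S -v_diff // lerD2r; apply: ub_le_sup; last by exists (C (m + k)%N).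
      by exists b => _ [F _ <-].
    - by apply: measurable_funB => //; exact: measurable_L2 (hS (D n)).
    apply: filterS (exhaustion_cvg HC) => w Cw; apply: cvgB; last exact: cvg_cst.
    under eq_fun do rewrite addnC.
    by have : S (C n0) w @[n0 --> \oo] --> h w := Cw; rewrite -(cvg_shiftn m (fun k => S (C k) w)).
  split; first by have := L2D (H 0%N).1 (hS (D 0%N)); under eq_fun do rewrite subrK.
  have tail0 : (fun n => sup (range v) - v (D n)) @ \oo --> (0 : R).
    by rewrite -(subrr (sup (range v))); apply: cvgB; [exact: cvg_cst|exact: exhaustion_v_cvg].
  apply: (squeeze_cvgr _ (cvg_cst 0) tail0); apply: nearW => n.
  rewrite ip_ge0 /=; apply: le_trans (H n).2; rewrite le_eqVlt; apply/orP; left; apply/eqP.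
  by apply: eq_Rintegral => w _; rewrite -opprB mulrNN.
have [hf Af] := key B A HB HA; split => //.
pose h w := limn (fun n => S (A n) w).
have [hh Ah] := key A A HA HA.
have hSA n : S (A n) \in Lfun P 2%:E by [].
have hD := L2B hh hf.
(* Both [h] and [f] are L2 limits of the sums along [A]; the difference of the two copies of the
   sequence is constantly 0. *)
have D0 : ip P (fun w => h w - f w) (fun w => h w - f w) = 0.
  have c1 := cvgL2_lin (-1) hSA hh Ah hSA hf Af.
  have hS0 n : (fun w => -1 * S (A n) w + S (A n) w) \in Lfun P 2%:E by apply: L2D => //; exact: L2Z.
  have hl : (fun w => -1 * h w + f w) \in Lfun P 2%:E by apply: L2D => //; exact: L2Z.
  have := cvgL2_ip_sqr hS0 hl c1; move/cvg_lim => /(_ (@Rhausdorff R)).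
  rewrite (_ : (fun n => _) = cst 0); last first.
    apply/funext => n; rewrite /ip; under eq_Rintegral do rewrite mulN1r addNr mul0r.
    by rewrite Rintegral_cst // mul0r.
  rewrite lim_cst // => E; rewrite [RHS]E; apply: eq_Rintegral => w _.
  by ring.
have : ae_eq P setT (fun w => ((h w - f w) ^+ 2)%:E) (cst 0%E).
  apply/ae_eq_integral_abs => //.
    by apply/measurable_EFinP; apply: measurable_funX; exact: measurable_L2 hD.
  transitivity ((ip P (fun w => h w - f w) (fun w => h w - f w))%:E); last by rewrite D0.
  by rewrite ipE //; apply: eq_integral => w _; rewrite gee0_abs // lee_fin sqr_ge0.
move=> E0; apply: filterS2 E0 (exhaustion_cvg HA) => w /(_ Logic.I) [Ew] Aw.
have : h w - f w = 0 by apply/eqP; rewrite -sqrf_eq0 Ew.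
by move/eqP; rewrite subr_eq0 => /eqP <-.
Qed.

End ExhaustionSeries.

(** * Sums of independent blocks *)

Section BlockIndependence.
Context d (T : measurableType d) (R : realType) (P : probability T R).
Variables (I : choiceType) (J : set I) (D : set R) (g : I -> R -> T -> R)
  (K : I -> R -> R -> R).
Hypothesis gG : forall i, J i -> centered_gaussian P D (g i) (K i).
Hypothesis gI : independent_functions P D J g.
Variables (T' : Type) (blk : nat -> set I) (f : nat -> T' -> T -> R).
Hypothesis blkJ : forall n, blk n `<=` J.
Hypothesis blk_disj : forall m n i, blk m i -> blk n i -> m = n.
Hypothesis f_wrt : forall n x, measurable_wrt (fields_on D g (blk n)) (f n x).

(** Each [f n] is determined by the fields of its block, and blocks are disjoint; the blocks are
    split off one after the other. *)
Lemma blocks_independent : independent_functions P setT setT f.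
Proof.
move=> F E EF.
have {EF}EF n : n \in F -> <<s fields_on D g (blk n) >> (E n).
  move=> /EF[_]; apply: sub_sigma => _ [x [B [_ mB ->]]].
  by have /measurable_wrtP := @f_wrt n x; exact.
(* The induction also records that the intersection belongs to the sigma-algebra of the blocks met
   so far; this is what allows the next block to be split off. *)
suff H (s : seq nat) : uniq s -> (forall n, n \in s -> <<s fields_on D g (blk n) >> (E n)) ->
    <<s fields_on D g (\bigcup_(n in [set` s]) blk n) >> (\bigcap_(n in [set` s]) E n) /\
    P (\bigcap_(n in [set` s]) E n) = (\prod_(n <- s) P (E n))%E.
  by have [] := H (enum_fset F) (fset_uniq F) EF.
elim: s => [_ _|n s IH /= /andP[ns us] sE].
  rewrite big_nil (_ : \bigcap_(n in _) E n = setT); last by apply/seteqP; split.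
  by split; [exact: (@measurableT _ (g_sigma_algebraType _))|exact: probability_setT].
have -> : \bigcap_(m in [set` n :: s]) E m = E n `&` \bigcap_(m in [set` s]) E m.
  apply/seteqP; split => w /=.
    move=> h; split; first by apply: h; rewrite /= mem_head.
    by move=> m /= ms; apply: h; rewrite /= in_cons ms orbT.
  by move=> [h1 h2] m /=; rewrite in_cons => /orP[/eqP->//|]; exact: h2.
have sE' m : m \in s -> <<s fields_on D g (blk m) >> (E m).
  by move=> ms; apply: sE; rewrite in_cons ms orbT.
have [h1 h2] := IH us sE'; have h3 := sE n (mem_head _ _); split.
  apply: (@measurableI _ (g_sigma_algebraType _)).
    apply: sub_sigma h3 => A [i ni Ai]; apply: sub_sigma_algebra; exists i => //.
    by exists n => //=; rewrite mem_head.
  apply: sub_sigma h1 => A [i [m /= ms mi] Ai]; apply: sub_sigma_algebra; exists i => //.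
  by exists m => //=; rewrite in_cons ms orbT.
rewrite big_cons -h2; apply: (fields_on_indep gG gI _ _ _ h3 h1) => //.
  by move=> i [m _ mi]; exact: blkJ mi.
apply/disj_setPS => i [ni [m /= ms mi]].
by rewrite -(blk_disj ni mi) (negbTE ns) in ms.
Qed.

Lemma blocks_indep_seq x : indep_seq P (fun n => f n x).
Proof.
move=> n Z mZ.
apply: (fields_on_indep2 gG gI (J1 := \bigcup_(k in [set k | (k < n)%N]) blk k) (J2 := blk n)) => //.
- by move=> i [m _ mi]; exact: blkJ mi.
- by apply/disj_setPS => i [[m /= mn mi] ni]; rewrite (blk_disj mi ni) ltnn in mn.
apply: (measurable_wrt_sub _ mZ) => _ [k [B [kn mB ->]]].
have /measurable_wrtP /(_ B mB) := @f_wrt k x; apply: sub_sigma => E [i ki Ei].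
by apply: sub_sigma_algebra; exists i => //; exists k.
Qed.

Variable V : set (T -> R).
Hypothesis VG : gaussian_space P V.
Hypothesis fV : forall n x, V (f n x).
Hypothesis fb : forall x, exists b, forall N, \sum_(n < N) ip P (f n x) (f n x) <= b.
Let S N x w := \sum_(n < N) f n x w.
Let F x w := limn (fun N => S N x w).

Let hf n x : f n x \in Lfun P 2%:E. Proof. exact: gaussian_space_L2 VG (fV n x). Qed.

Let f0 n x : \int[P]_w f n x w = 0. Proof. exact: gaussian_space_mean VG (fV n x). Qed.

Let hS N x : S N x \in Lfun P 2%:E. Proof. exact: L2_sum. Qed.

Lemma block_sum_cvg_as x : cvg_as P (fun N => S N x) (F x).
Proof.
have [b Hb] := fb x.
exact: (indep_series_cvg_as (fun n => hf n x) (fun n => f0 n x) (@blocks_indep_seq x) Hb).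
Qed.

Lemma block_sum_L2 x : F x \in Lfun P 2%:E /\ cvgL2 P (fun N => S N x) (F x).
Proof.
have [b Hb] := fb x.
exact: (indep_series_cvg_L2 (fun n => hf n x) (fun n => f0 n x) (@blocks_indep_seq x) Hb).
Qed.

Lemma block_sum_closure x : L2_closure P V (F x).
Proof.
have [hF SF] := block_sum_L2 x; split => //; exists (fun N => S N x); split => // N.
have V0 := gaussian_space0 VG (fV 0 x).
have := @gaussian_space_sum _ _ _ P V _ (index_enum 'I_N) (fun=> 1) (fun n => f n x) VG V0.
by under eq_fun do under eq_bigr do rewrite mul1r; apply => i; exact: fV.
Qed.

Lemma block_ip0 m n x y : m != n -> ip P (f m x) (f n y) = 0.
Proof.
move=> mn; rewrite ip_indep2 ?f0 ?mulr0 //.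
apply: (fields_on_indep2 gG gI _ _ _ (@f_wrt m x) (@f_wrt n y)) => //.
by apply/disj_setPS => i [mi ni]; rewrite (blk_disj mi ni) eqxx in mn.
Qed.

Lemma block_sum_ip x y :
  (fun N => \sum_(n < N) ip P (f n x) (f n y)) @ \oo --> ip P (F x) (F y).
Proof.
have [hx Sx] := block_sum_L2 x; have [hy Sy] := block_sum_L2 y.
have := cvgL2_ip (fun N => hS N x) hx Sx (fun N => hS N y) hy Sy.
suff E N : ip P (S N x) (S N y) = \sum_(n < N) ip P (f n x) (f n y) by under eq_fun do rewrite E.
rewrite ip_suml //; apply: eq_bigr => m _.
rewrite ip_sumr // (bigD1 m) //= big1 ?addr0 // => n nm.
by apply: block_ip0; rewrite eq_sym.
Qed.

End BlockIndependence.

Section TupleSums.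
Variable (R : realType).

Lemma sum_tuple_prod n M (a : nat -> R) :
  \sum_(i : n.-tuple 'I_M) \prod_(j < n) a (tnth i j) = (\sum_(k < M) a k) ^+ n.
Proof.
rewrite -[in RHS](card_ord n) -prodr_const bigA_distr_bigA.
rewrite (reindex (@tuple_of_finfun _ _)) /=; last first.
  exists (@finfun_of_tuple _ _) => f _; first exact: tuple_of_finfunK.
  exact: finfun_of_tupleK.
apply: eq_bigr => f _; apply: eq_bigr => j _.
by rewrite tnth_map tnth_ord_tuple.
Qed.

Definition box n M : {fset n.-tuple nat} :=
  [fset map_tuple (fun k : 'I_M => k : nat) i | i in {: n.-tuple 'I_M}]%fset.

Lemma map_val_inj n M : injective (map_tuple (fun k : 'I_M => k : nat) : n.-tuple 'I_M -> n.-tuple nat).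
Proof.
by move=> s t /(congr1 val) /= /inj_map h; apply: val_inj; apply: h => i j; exact: val_inj.
Qed.

Lemma sum_box n M (F : n.-tuple nat -> R) :
  \sum_(i : n.-tuple 'I_M) F (map_tuple (fun k : 'I_M => k : nat) i) = \sum_(i <- box n M) F i.
Proof.
rewrite big_imfset /=; last by move=> s t _ _; exact: map_val_inj.
by rewrite big_enum.
Qed.

Lemma mem_box n M (i : n.-tuple nat) : (i \in box n M) = all (fun k => (k < M)%N) i.
Proof.
apply/imfsetP/allP => /=.
  by move=> [t _ ->] k /mapP[j _ ->]; exact: ltn_ord.
move=> iM; have lt j : (tnth i j < M)%N by apply: iM; exact: mem_tnth.
exists (mktuple (fun j => Ordinal (lt j))) => //.
by apply: eq_from_tnth => j; rewrite tnth_map tnth_mktuple.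
Qed.

Lemma box_exhaustion n : exhaustion (box n).
Proof.
split=> [M|i].
  apply/fsubsetP => i; rewrite !mem_box => /allP iM; apply/allP => k /iM.
  by move=> kM; exact: ltnW.
exists (\max_(k <- i) k).+1; rewrite mem_box; apply/allP => k ki.
by rewrite ltnS (big_rem k ki) /= leq_maxl.
Qed.

End TupleSums.

(** * The case of infinite dimension *)

Lemma cvg_exprn (R : realType) (u : nat -> R) (l : R) n :
  u @ \oo --> l -> (fun M => u M ^+ n) @ \oo --> l ^+ n.
Proof.
move=> ul; elim: n => [|n IH].
  by under eq_fun do rewrite expr0; rewrite expr0; exact: cvg_cst.
by under eq_fun do rewrite exprS; rewrite exprS; exact: cvgM.
Qed.

Section L2Facts.
Variable R : realType.
Implicit Types x y : l2 R.

Lemma enorm_ge0 (V : normedModType R) (dot : V -> V -> R) (x : V) : 0 <= enorm dot x.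
Proof. exact: sqrtr_ge0. Qed.

Lemma l2_dotZZ a b x y : l2_dot (a *: x) (b *: y) = a * b * l2_dot x y.
Proof. by rewrite l2_dotZl l2_dotC l2_dotZl l2_dotC mulrA. Qed.

(** An inequality because [unitv] maps 0 to 0. *)
Lemma l2_dot_unitv_le1 x : l2_dot (unitv (@l2_dot R) x) (unitv (@l2_dot R) x) <= 1.
Proof.
rewrite /unitv l2_dotZZ -invfM -expr2 sqr_sqrtr ?l2_dot_ge0 //.
have [->|x0] := eqVneq (l2_dot x x) 0; first by rewrite mulr0.
by rewrite mulVf.
Qed.

Lemma unitv0 (V : normedModType R) (dot : V -> V -> R) : unitv dot 0 = 0.
Proof. by rewrite /unitv scaler0. Qed.

Lemma l2_dot_cvg_sum x y : (fun M => \sum_(k < M) x k * y k) @ \oo --> l2_dot x y.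
Proof.
have := @l2_dot_cvg R x y.
suff -> : (fun M => \sum_(k < M) x k * y k) = series (fun k => x k * y k) by [].
by apply/funext => M; rewrite /series /= big_mkord.
Qed.

Lemma l2_sum_sqr_le x M : \sum_(k < M) x k * x k <= l2_dot x x.
Proof.
have := nondecreasing_cvgn_le _ (@l2_dot_cvg R x x) M.
rewrite /series /= big_mkord; apply.
by apply: nondecreasing_series => k _ _; rewrite -expr2 sqr_ge0.
Qed.

End L2Facts.

Section InfiniteDimensional.
Context (R : realType) (disp : measure_display) (Omega : measurableType disp)
  (P : probability Omega R).
Variables (Ch : nat -> R -> R) (K : l2 R -> l2 R -> R) (alpha : nat -> R -> R -> R)
  (g : forall n, n.-tuple nat -> R -> Omega -> R).
Hypothesis ChE : forall n t, Ch n t = t ^+ n.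
Hypothesis HK : associated_kernels (@l2_dot R) Ch K alpha.
Hypothesis gG : forall n (i : n.-tuple nat),
  centered_gaussian P (@nonneg_half_line R) (g i) (alpha n).
Local Notation I := {n : nat & n.-tuple nat}.
Local Notation D := (@nonneg_half_line R).
Let g' (p : I) := g (tagged p).
Hypothesis gI : independent_functions P D setT g'.
Local Notation nrm := (enorm (@l2_dot R)).
Local Notation uv := (unitv (@l2_dot R)).

Let emb n (i : n.-tuple nat) : I := Tagged (fun n => n.-tuple nat) i.

Let emb_inj n : injective (@emb n).
Proof. by move=> i j /eqP; rewrite /emb eq_Tagged => /eqP. Qed.

Let gG' (p : I) : setT p -> centered_gaussian P D (g' p) (alpha (tag p)).
Proof. by move=> _; exact: gG. Qed.

Let nrmD x : D (nrm x). Proof. exact: enorm_ge0. Qed.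

Let c n (x : l2 R) (i : n.-tuple nat) : R := \prod_(j < n) (uv x : l2 R) (tnth i j).

Let tE n x (i : n.-tuple nat) : term_infty g x i = fun w => c x i * g' (emb i) (nrm x) w.
Proof. by apply/funext => w; rewrite /term_infty mulrC. Qed.

Let hg n (i : n.-tuple nat) x : g' (emb i) (nrm x) \in Lfun P 2%:E.
Proof. exact: (gaussian_L2 gG' (i := emb i)). Qed.

Let ht n x (i : n.-tuple nat) : term_infty g x i \in Lfun P 2%:E.
Proof. by rewrite tE; exact: L2Z. Qed.

Let t0 n x (i : n.-tuple nat) : \int[P]_w term_infty g x i w = 0.
Proof.
rewrite tE RintegralZl //; last exact: L2_integrable.
by rewrite (gaussian_mean gG' (i := emb i)) ?mulr0.
Qed.

(** The series for fixed [n] runs over tuples, whereas independence is assumed over all pairs of a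
    degree and a tuple; [emb] carries one setting into the other. *)
Let Gt n (i : n.-tuple nat) := fields D g' (emb i).

Let Gt_on n (J1 : set (n.-tuple nat)) X : measurable_wrt (union_system (@Gt n) J1) X ->
  measurable_wrt (fields_on D g' (@emb n @` J1)) (X : Omega -> R).
Proof.
apply: measurable_wrt_sub => E [i Ji Ei]; apply: sub_sigma_algebra.
by exists (emb i) => //; exists i.
Qed.

Let Gt_indep n (J1 J2 : set (n.-tuple nat)) (X Y : Omega -> R) : [disjoint J1 & J2] ->
  measurable_wrt (union_system (@Gt n) J1) X -> measurable_wrt (union_system (@Gt n) J2) Y ->
  indep2 P X Y.
Proof.
move=> /disj_setPS J12 /Gt_on hX /Gt_on hY.
apply: (fields_on_indep2 gG' gI _ _ _ hX hY) => //.
apply/disj_setPS => _ [[i Ji <-] [j Jj /emb_inj ij]].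
by apply: (J12 i); split => //; rewrite -ij.
Qed.

Let t_wrt n x (i : n.-tuple nat) : measurable_wrt (union_system (@Gt n) [set i]) (term_infty g x i).
Proof.
rewrite tE; apply: measurable_funM; first exact: measurable_cst.
apply/measurable_wrtP => B mB; apply: sub_sigma_algebra; exists i => //.
by apply: sub_sigma_algebra; exists (nrm x), B.
Qed.

Let t_ip n x y (i : n.-tuple nat) : ip P (term_infty g x i) (term_infty g y i) =
  alpha n (nrm x) (nrm y) * \prod_(j < n) ((uv x : l2 R) (tnth i j) * (uv y : l2 R) (tnth i j)).
Proof.
rewrite !tE (ipZl _ (hg i x) (L2Z _ (hg i y))) (ipZr _ (hg i x) (hg i y)).
have E : ip P (g' (emb i) (nrm x)) (g' (emb i) (nrm y)) = alpha n (nrm x) (nrm y).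
  exact: (gaussian_ip gG' (i := emb i) Logic.I (nrmD x) (nrmD y)).
by rewrite E big_split -!/(c _ i) mulrA mulrC.
Qed.

Let t_ip0 n x y (i j : n.-tuple nat) : i != j -> ip P (term_infty g x i) (term_infty g y j) = 0.
Proof.
move=> ij; rewrite ip_indep2 ?t0 ?mulr0 //; apply: (Gt_indep _ (@t_wrt n x i) (@t_wrt n y j)).
by apply/disj_setPS => k [/= -> h]; rewrite h eqxx in ij.
Qed.

Let alpha_ge0 n x : 0 <= alpha n (nrm x) (nrm x).
Proof.
have i : n.-tuple nat := [tuple of nseq n 0%N].
by rewrite -(gaussian_ip gG' (i := emb i)) // ip_ge0.
Qed.

(** A finite set is enlarged to a box, where the variances add up to [alpha n] times the [n]-th
    power of a partial sum of squared coordinates of [unitv x], a number of [0, 1]. *)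
Let bound n x (F : {fset n.-tuple nat}) :
  \sum_(i <- F) ip P (term_infty g x i) (term_infty g x i) <= alpha n (nrm x) (nrm x).
Proof.
have [M FM] := exhaustion_sub (box_exhaustion n) F.
apply: le_trans (_ : \sum_(i <- box n M) ip P (term_infty g x i) (term_infty g x i) <= _).
  rewrite -subr_ge0 fset_sum_diff //; apply: sumr_ge0 => i _; exact: ip_ge0.
rewrite -sum_box; under eq_bigr do rewrite t_ip.
rewrite -mulr_sumr.
rewrite (_ : \sum_(_ : _) _ = (\sum_(k < M) (uv x : l2 R) k * (uv x : l2 R) k) ^+ n); last first.
  rewrite -(sum_tuple_prod n M (fun k => (uv x : l2 R) k * (uv x : l2 R) k)).
  apply: eq_bigr => i _; apply: eq_bigr => j _.
  by rewrite tnth_map.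
rewrite ler_piMr // exprn_ile1 //.
  by apply: sumr_ge0 => k _; rewrite -expr2 sqr_ge0.
exact: le_trans (l2_sum_sqr_le _ _) (l2_dot_unitv_le1 x).
Qed.

Let f_box n x : f_infty g n x = fun w => limn (fun M => \sum_(i <- box n M) term_infty g x i w).
Proof.
apply/funext => w; rewrite /f_infty; congr (limn _); apply/funext => M.
by rewrite -(sum_box _ (fun i => term_infty g x i w)).
Qed.

Let f_exhaustion n x (A : nat -> {fset n.-tuple nat}) : exhaustion A ->
  [/\ f_infty g n x \in Lfun P 2%:E,
      cvgL2 P (fun M w => \sum_(i <- A M) term_infty g x i w) (f_infty g n x)
    & cvg_as P (fun M w => \sum_(i <- A M) term_infty g x i w) (f_infty g n x)].
Proof.
move=> HA; rewrite f_box.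
exact: (exhaustion_limn (@Gt_indep n) (@t_wrt n x) (@ht n x) (@t0 n x) (@bound n x)
  (box_exhaustion n) HA).
Qed.

Let part n x M w := \sum_(i <- box n M) term_infty g x i w.

Let hpart n x M : part n x M \in Lfun P 2%:E.
Proof. by apply: L2_sum => i _; exact: ht. Qed.

Let f_ip n x y : ip P (f_infty g n x) (f_infty g n y) =
  alpha n (nrm x) (nrm y) * Ch n (l2_dot (uv x) (uv y)).
Proof.
have [hx Sx _] := f_exhaustion x (box_exhaustion n).
have [hy Sy _] := f_exhaustion y (box_exhaustion n).
have C1 := cvgL2_ip (@hpart n x) hx Sx (@hpart n y) hy Sy.
have C2 : (fun M => ip P (@part n x M) (@part n y M)) @ \oo -->
    alpha n (nrm x) (nrm y) * Ch n (l2_dot (uv x) (uv y)).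
  have E M : ip P (@part n x M) (@part n y M) =
      alpha n (nrm x) (nrm y) * (\sum_(k < M) (uv x : l2 R) k * (uv y : l2 R) k) ^+ n.
    rewrite ip_suml //.
    rewrite -(sum_tuple_prod n M (fun k => (uv x : l2 R) k * (uv y : l2 R) k)) mulr_sumr -sum_box.
    apply: eq_bigr => i _; set ii := map_tuple _ i.
    rewrite ip_sumr // (bigD1_seq ii) ?fset_uniq //; last first.
      by rewrite /= mem_box; apply/allP => k /mapP[j _ ->]; exact: ltn_ord.
    rewrite big1 => [|j ji]; last by rewrite t_ip0 // eq_sym.
    apply: etrans; first exact: addr0.
    rewrite (t_ip x y ii); congr (_ * _); apply: eq_bigr => j _.
    have -> : tnth ii j = tnth i j :> nat by exact: tnth_map.
    by [].
  under eq_fun do rewrite E.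
  rewrite ChE; apply: cvgM; first exact: cvg_cst.
  by apply: cvg_exprn; exact: l2_dot_cvg_sum.
by rewrite -(cvg_lim _ C1) // (cvg_lim _ C2).
Qed.

Let blk n : set I := [set p | tag p = n].

Let f_wrt n x : measurable_wrt (fields_on D g' (blk n)) (f_infty g n x).
Proof.
rewrite f_box.
apply: (@measurable_limn R _ (g_sigma_algebraType (fields_on D g' (blk n)))
  (fun M w => \sum_(i <- box n M) term_infty g x i w)) => M.
apply: measurable_wrt_bigsum => i _; rewrite tE; apply: measurable_funM; first exact: measurable_cst.
exact: gaussian_wrt.
Qed.

Let V := L2_closure P (family_span setT D g').

Let spanG : gaussian_space P (family_span setT D g').
Proof. exact: family_span_gaussian gG' gI. Qed.

Let VG : gaussian_space P V. Proof. exact: gaussian_space_closure. Qed.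

Let fV n x : V (f_infty g n x).
Proof.
have [hx Sx _] := f_exhaustion x (box_exhaustion n); split => //.
exists (@part n x); split => // M.
exists [seq (c x i, (emb i, nrm x)) | i <- box n M]; split => [p|].
  by move=> /mapP[i _ ->]; split => //; exact: nrmD.
by apply/funext => w; rewrite big_map; apply: eq_bigr => i _; rewrite tE.
Qed.

Let kernel_series x y :
  (fun N => \sum_(n < N) ip P (f_infty g n x) (f_infty g n y)) @ \oo --> K x y.
Proof.
have [_ _ _ Ks K0] := HK.
under eq_fun do under eq_bigr do rewrite f_ip.
(* At the origin the inner product is 0 and [0 ^+ n] vanishes for [n > 0], so only the degree 0 term
   remains, as in the reading of the kernel there. *)
have zero : x = 0 \/ y = 0 -> (fun N => \sum_(n < N) alpha n (nrm x) (nrm y) *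
    Ch n (l2_dot (uv x) (uv y))) @ \oo --> K x y.
  move=> xy; rewrite K0 // -(cvg_shiftS _).
  rewrite (_ : (fun _ => _) = cst (alpha 0 (nrm x) (nrm y))); first exact: cvg_cst.
  apply/funext => N; rewrite big_ord_recl /= big1 ?addr0 => [|i _].
    by rewrite ChE expr0 mulr1.
  have -> : l2_dot (uv x) (uv y) = 0.
    by case: xy => ->; rewrite unitv0 ?[l2_dot _ 0]l2_dotC -(scale0r (0 : l2 R)) l2_dotZl mul0r.
  by rewrite ChE expr0n mulr0.
have [x0|x0] := eqVneq x 0; first by apply: zero; left.
have [y0|y0] := eqVneq y 0; first by apply: zero; right.
by have := Ks x y x0 y0; rewrite /series /=; under eq_fun do rewrite big_mkord.
Qed.

(** The variances of the partial sums increase to [K x x]; this is the bound required for the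
    convergence of the series. *)
Let f_bounded x : exists b, forall N, \sum_(n < N) ip P (f_infty g n x) (f_infty g n x) <= b.
Proof.
exists (K x x) => N; rewrite -(cvg_lim _ (@kernel_series x x)) //.
apply: (nondecreasing_cvgn_le (u_ := fun N => \sum_(n < N) ip P (f_infty g n x) (f_infty g n x))).
  apply/nondecreasing_seqP => M; rewrite big_ord_recr lerDl; exact: ip_ge0.
by apply/cvg_ex; exists (K x x); exact: kernel_series.
Qed.

Let blk_disj m n p : blk m p -> blk n p -> m = n. Proof. by rewrite /blk /= => -> ->. Qed.

Let blkT n : blk n `<=` setT. Proof. by []. Qed.

Lemma infinite_dimensional_representation :
  [/\ forall n (x : l2 R) (A : nat -> {fset n.-tuple nat}), exhaustion A ->
        let part M w := \sum_(i <- A M) term_infty g x i w in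
        cvg_L2 P part (f_infty g n x) /\ cvg_as P part (f_infty g n x),
      forall n, gaussian_function P setT (f_infty g n),
      independent_functions P setT setT (f_infty g),
      forall x : l2 R,
        let part M w := \sum_(n < M) f_infty g n x w in
        cvg_L2 P part (series_infty g x) /\ cvg_as P part (series_infty g x)
    & centered_gaussian P setT (series_infty g) K].
Proof.
have V0 := gaussian_space0 VG (fV 0 0).
have sV x := block_sum_closure gG' gI blkT blk_disj f_wrt VG fV f_bounded x.
have VcG := gaussian_space_closure VG.
split.
- move=> n x A HA; have [h1 h2 h3] := f_exhaustion x HA; split => //.
  by apply/cvg_L2P; split => // M; apply: L2_sum => i _; exact: ht.
- by move=> n; apply: (gaussian_space_function VG V0) => x _; exact: fV.
- exact: (blocks_independent gG' gI blkT blk_disj f_wrt).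
- move=> x; split; last exact: (block_sum_cvg_as gG' gI blkT blk_disj f_wrt VG fV f_bounded).
  have [h1 h2] := block_sum_L2 gG' gI blkT blk_disj f_wrt VG fV f_bounded x.
  apply/cvg_L2P; split => // N; apply: L2_sum => i _; exact: gaussian_space_L2 VG (fV _ _).
split.
- by apply: (gaussian_space_function VcG (gaussian_space0 VcG (sV 0))) => x _; exact: sV.
- move=> x _; apply: expectation_eq0.
    exact: gaussian_space_L2 VcG (sV x).
  exact: gaussian_space_mean VcG (sV x).
move=> x y _ _; rewrite covariance_ip.
- congr (_%:E); have C : (fun N => \sum_(n < N) ip P (f_infty g n x) (f_infty g n y)) @ \oo -->
      ip P (series_infty g x) (series_infty g y).
    exact: (block_sum_ip gG' gI blkT blk_disj f_wrt VG fV f_bounded).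
 
  by rewrite -(cvg_lim _ (@kernel_series x y)) // (cvg_lim _ C).
- exact: gaussian_space_L2 VcG (sV x).
- exact: gaussian_space_L2 VcG (sV y).
- exact: gaussian_space_mean VcG (sV x).
- exact: gaussian_space_mean VcG (sV y).
Qed.

End InfiniteDimensional.

(** * Polar coordinates *)

Section ScaledMeasure.
Context d (T : measurableType d) (R : realType) (m : {measure set T -> \bar R}).

Lemma integral_mscale (k : {nonneg R}) (D : set T) (f : T -> \bar R) : measurable D ->
  m.-integrable D f -> (\int[mscale k m]_(x in D) f x = k%:num%:E * \int[m]_(x in D) f x)%E.
Proof.
move=> mD fi; have mf := measurable_int _ fi.
have mfp : measurable_fun D (f^\+)%E by exact: measurable_funepos.
have mfn : measurable_fun D (f^\-)%E by exact: measurable_funeneg.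
have h1 := integrable_pos_fin_num mD fi; have h2 := integrable_neg_fin_num mD fi.
rewrite [LHS]integralE (ge0_integral_mscale m mD k mfp) // (ge0_integral_mscale m mD k mfn) //.
have E : (\int[m]_(x in D) f x = \int[m]_(x in D) f^\+ x - \int[m]_(x in D) f^\- x)%E by exact: integralE.
rewrite E [RHS]muleBr //.
by apply: fin_num_adde_defl; rewrite fin_numN.
Qed.

End ScaledMeasure.

Section LebesgueTuple.
Variable R : realType.
Local Notation mR := (measurableTypeR R).
Local Notation lam := (@lebesgue_measure R).
Local Notation leb n := (lebesgue_tuple R n).

Definition tscale n (c : R) (t : n.-tuple R) : n.-tuple R := [tuple c * tnth t i | i < n].

Lemma measurable_tscale n c : measurable_fun setT (@tscale n c).
Proof.
apply/measurable_fun_tnthP => i.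
rewrite (_ : _ \o _ = fun t => c * tnth t i); last by apply/funext => t /=; rewrite tnth_mktuple.
by apply: measurable_funM => //; exact: measurable_tnth.
Qed.

Lemma tscale_tcons n c (p : mR * n.-tuple R) :
  tscale c (tcons p) = tcons (c * p.1, tscale c p.2).
Proof.
apply: eq_from_tnth => i; rewrite tnth_mktuple.
by case: (unliftP ord0 i) => [j ->|->]; rewrite ?tnthS ?tnth0 ?tnth_mktuple.
Qed.

Lemma ge0_integral_lebesgue_tupleS n (F : n.+1.-tuple R -> \bar R) :
  measurable_fun setT F -> (forall t, 0 <= F t)%E ->
  (\int[leb n.+1]_t F t = \int[lam]_x \int[leb n]_t F (tcons (x, t)))%E.
Proof.
move=> mF F0; rewrite (ge0_integral_pushforward (@measurable_tcons R n)) //=.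
rewrite preimage_setT fubini_tonelli1 //.
by apply: measurableT_comp => //; exact: measurable_tcons.
Qed.

(** One coordinate at a time, by Tonelli's theorem; each contributes a factor [c^-1]. *)
Lemma ge0_integral_tscale n c (F : n.-tuple R -> \bar R) : 0 < c ->
  measurable_fun setT F -> (forall t, 0 <= F t)%E ->
  (\int[leb n]_t F (tscale c t) = (c^-1 ^+ n)%:E * \int[leb n]_t F t)%E.
Proof.
move=> c0; elim: n F => [|n IH] F mF F0.
  rewrite expr0 mul1e; apply: eq_integral => t _; congr F.
  by rewrite (tuple0 (tscale c t)) (tuple0 t).
have ic0 : 0 <= c^-1 by rewrite invr_ge0 ltW.
have mF2 : measurable_fun setT (fun p : mR * n.-tuple R => F (tcons p)).
  by apply: measurableT_comp => //; exact: measurable_tcons.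
rewrite ge0_integral_lebesgue_tupleS //; last first.
  by apply: measurableT_comp => //; exact: measurable_tscale.
transitivity (\int[lam]_x ((c^-1 ^+ n)%:E * \int[leb n]_t F (tcons ((c * x + 0)%R, t))))%E.
  apply: eq_integral => x _; rewrite -IH //.
    by apply: eq_integral => t _; rewrite tscale_tcons addr0.
  exact: (measurable_fun_pair2 _ mF2).
have mG : measurable_fun [set: mR] (fun x : mR => \int[leb n]_t F (tcons (x, t)))%E.
  exact: (measurable_fun_fubini_tonelli_F (m2 := leb n) _ mF2 (fun p => F0 (tcons p))).
have G0 (x : mR) : (0 <= \int[leb n]_t F (tcons (x, t)))%E by exact: integral_ge0.
rewrite ge0_integralZl //; last 2 first.
- by apply: (measurableT_comp mG); apply: measurable_funD => //; exact: measurable_funM.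
- by rewrite lee_fin exprn_ge0.
by rewrite (ge0_integral_affine 0 c0 G0 mG) ge0_integral_lebesgue_tupleS // muleA -EFinM -exprSr.
Qed.

Lemma lebesgue_tuple_tscale n c (A : set (n.-tuple R)) : 0 < c -> measurable A ->
  leb n (tscale c @^-1` A) = ((c^-1 ^+ n)%:E * leb n A)%E.
Proof.
move=> c0 mA.
have mA' : measurable (tscale c @^-1` A).
  by rewrite -[_ @^-1` _]setTI; exact: measurable_tscale.
have := @ge0_integral_tscale n c (fun t => (\1_A t)%:E) c0.
rewrite [in X in _ -> _ -> _ = (_ * X)%E]integral_indic // setIT => <-.
- rewrite -[in LHS](setIT (_ @^-1` _)) -integral_indic //.
- by apply/measurable_EFinP; exact: measurable_indic.
- by move=> t; rewrite lee_fin.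
Qed.

(** The analytic meaning of [gauss_mean] on monomials: the integral factors into one-dimensional
    moments. *)
Lemma gaussian_monomial n (m : 'I_n -> nat) :
  (leb n).-integrable setT (fun t => (\prod_(i < n) (tnth t i ^+ m i * normal_pdf 0 1 (tnth t i)))%:E) /\
  (\int[leb n]_t (\prod_(i < n) (tnth t i ^+ m i * normal_pdf 0 1 (tnth t i)))%:E =
    (\prod_(i < n) normal_moment (m i))%:R%:E)%E.
Proof.
elim: n m => [|n IH] m.
  rewrite big_ord0 (_ : (fun t => _) = cst 1%E); last by apply/funext => t; rewrite big_ord0.
  split; last by rewrite integral_cst // mul1e /= diracT.
  apply/integrableP; split => //; rewrite integral_cst //= normr1 mul1e.
  by rewrite diracT ltry.
pose f k := fun x : mR => x ^+ k * normal_pdf 0 1 x.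
pose h := fun t : n.-tuple R => \prod_(i < n) (tnth t i ^+ m (lift ord0 i) * normal_pdf 0 1 (tnth t i)).
have [ih Eh] := IH (fun i => m (lift ord0 i)).
pose F := fun t : n.+1.-tuple R => \prod_(i < n.+1) (tnth t i ^+ m i * normal_pdf 0 1 (tnth t i)).
have FE : (fun p => (F (tcons p))%:E) = (fun p => (f (m ord0) p.1 * h p.2)%:E).
  apply/funext => p; rewrite /F big_ord_recl tnth0; congr (_ * _)%:E.
  by apply: eq_bigr => i _; rewrite tnthS.
have mf k : measurable_fun setT (f k).
  by apply: measurable_funM; [exact: measurable_funX|exact: measurable_normal_pdf].
have mh : measurable_fun setT h.
  apply: measurable_prod => i _; apply: measurable_funM.
    by apply: measurable_funX; exact: measurable_tnth.
  by apply: (measurableT_comp (measurable_normal_pdf 0 1)); exact: measurable_tnth.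
have mF : measurable_fun setT F.
  apply: measurable_prod => i _; apply: measurable_funM.
    by apply: measurable_funX; exact: measurable_tnth.
  by apply: (measurableT_comp (measurable_normal_pdf 0 1)); exact: measurable_tnth.
have if_ := integrable_normal_moment R (m ord0).
have iF : (lam \x leb n)%E.-integrable setT (fun p => (F (tcons p))%:E).
  by rewrite FE; exact: integrable_prodM.
split.
  apply: (@integrable_pushforward _ _ _ _ R _ (@measurable_tcons R n) (lam \x leb n)%E setT (EFin \o F)) => //.
  exact/measurable_EFinP.
rewrite (integral_pushforward (@measurable_tcons R n) (f := EFin \o F)) //=; last exact/measurable_EFinP.
rewrite preimage_setT; transitivity (\int[lam \x leb n]_p (f (m ord0) p.1 * h p.2)%:E)%E.
  by apply: eq_integral => p _; have := congr1 (fun u => u p) FE.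
rewrite integral_prodM // Eh integral_normal_moment big_ord_recl natrM EFinM.
by [].
Qed.

End LebesgueTuple.

Section Polar.
Variables (R : realType) (d : nat).
Local Notation mR := (measurableTypeR R).
Local Notation leb := (lebesgue_tuple R d).
Local Notation nz := (@normalize R d).
Implicit Types (t : d.-tuple R) (B : set (d.-tuple R)).

Definition sumsq t : R := \sum_(i < d) tnth t i ^+ 2.
Definition unit_sphere : set (d.-tuple R) := [set t | sumsq t = 1].

Lemma sumsq_ge0 t : 0 <= sumsq t.
Proof. by apply: sumr_ge0 => i _; exact: sqr_ge0. Qed.

Lemma sumsq_tscale c t : sumsq (tscale c t) = c ^+ 2 * sumsq t.
Proof.
by rewrite /sumsq mulr_sumr; apply: eq_bigr => i _; rewrite tnth_mktuple exprMn.
Qed.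

Lemma normalizeE t : nz t = tscale (Num.sqrt (sumsq t))^-1 t.
Proof. by []. Qed.

Lemma tscaleA a b t : tscale a (tscale b t) = tscale (a * b) t.
Proof. by apply: eq_from_tnth => i; rewrite !tnth_mktuple mulrA. Qed.

(** The value at the origin is 0, because the inverse of 0 is 0; directions on the sphere thus
    belong exactly to nonzero vectors. *)
Lemma sumsq_normalize t : sumsq (nz t) = (sumsq t != 0)%:R.
Proof.
rewrite normalizeE sumsq_tscale exprVn sqr_sqrtr ?sumsq_ge0 //.
by case: eqVneq => [->|h]; rewrite ?mulr0 // mulVf.
Qed.

Lemma normalize_tscale c t : 0 < c -> nz (tscale c t) = nz t.
Proof.
move=> c0; rewrite !normalizeE tscaleA sumsq_tscale sqrtrM ?sqr_ge0 // sqrtr_sqr gtr0_norm //.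
by rewrite invfM mulrAC mulVf ?mul1r // gt_eqF.
Qed.

Lemma normalize_sphere t : (nz @^-1` unit_sphere) t <-> sumsq t != 0.
Proof.
rewrite /unit_sphere /= sumsq_normalize; case: eqP => _; split => //.
by move=> /eqP; rewrite eq_sym oner_eq0.
Qed.

Lemma measurable_sumsq' : measurable_fun setT (sumsq : d.-tuple R -> mR).
Proof. exact: measurable_sumsq. Qed.

Lemma measurable_unit_sphere : measurable unit_sphere.
Proof.
rewrite (_ : unit_sphere = setT `&` sumsq @^-1` [set 1]); last by rewrite setTI.
by apply: measurable_sumsq' => //; exact: measurable_set1.
Qed.

Lemma measurable_normalize_preimage B : measurable B -> measurable (nz @^-1` B).
Proof. by move=> mB; rewrite -[_ @^-1` _]setTI; exact: measurable_normalize. Qed.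

Definition cone_measure B := leb (nz @^-1` B `&` @unit_ball R d).

Lemma sphere_measureE B : sphere_measure B = (d%:R%:E * cone_measure B)%E.
Proof. by []. Qed.

Section Cone.
Variables (B : set (d.-tuple R)) (mB : measurable B) (BS : B `<=` unit_sphere).

(** For [r > 0], dilation by the square root of [r] carries the cone in the unit ball to the one of
    that radius. For [r <= 0] the set is empty, since the direction of the origin is not on the
    sphere. *)
Lemma cone_radius (r : R) : leb (nz @^-1` B `&` sumsq @^-1` `]-oo, r]%classic) =
  ((if 0 < r then Num.sqrt r ^+ d else 0)%:E * cone_measure B)%E.
Proof.
case: ifPn => r0; last first.
  rewrite mul0e (_ : _ `&` _ = set0) ?measure0 //; apply/seteqP; split => t //= [Bt].
  have /normalize_sphere t0 : (nz @^-1` unit_sphere) t by exact: BS.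
  rewrite in_itv /= leNgt => /negP; apply.
  by rewrite -leNgt in r0; apply: le_lt_trans r0 _; rewrite lt_def t0 sumsq_ge0.
have s0 : 0 < Num.sqrt r by rewrite sqrtr_gt0.
have mN := measurable_normalize_preimage mB.
have -> : nz @^-1` B `&` sumsq @^-1` `]-oo, r]%classic =
    tscale (Num.sqrt r)^-1 @^-1` (nz @^-1` B `&` @unit_ball R d).
  have E t : (sumsq t <= r) = (sumsq (tscale (Num.sqrt r)^-1 t) <= 1).
    by rewrite sumsq_tscale exprVn (sqr_sqrtr (ltW r0)) mulrC ler_pdivrMr // mul1r.
  apply/seteqP; split => t /= []; rewrite in_itv /= normalize_tscale ?invr_gt0 // => h1 h2.
    by split => //; rewrite /unit_ball /= -/(sumsq _) -E.
  by split => //; rewrite E.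
rewrite lebesgue_tuple_tscale ?invr_gt0 ?invrK //.
by apply: measurableI => //; exact: measurable_unit_ball.
Qed.


Let preB := nz @^-1` B.
Let ind_ge0 t : 0 <= \1_preB t :> R. Proof. by []. Qed.
Let ind_meas : measurable_fun setT (\1_preB : d.-tuple R -> R).
Proof. exact: measurable_indic (measurable_normalize_preimage mB). Qed.

(** The image of Lebesgue measure on the cone over [B] under the squared norm. By [radial_measureE]
    it depends on [B] only through the factor [cone_measure B], which is the content of polar
    coordinates. *)
Definition radial_measure : {measure set mR -> \bar R} :=
  measure_function_pushforward__canonical__measure_function_Measure
    (density_measure leb ind_ge0 ind_meas) measurable_sumsq'.

Lemma radial_measureE (r : R) : radial_measure `]-oo, r]%classic =
  ((if 0 < r then Num.sqrt r ^+ d else 0)%:E * cone_measure B)%E.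
Proof.
have mI : measurable (sumsq @^-1` `]-oo, r]%classic).
  by rewrite -[_ @^-1` _]setTI; apply: measurable_sumsq' => //; exact: measurable_itv.
by rewrite -cone_radius -(integral_indic leb mI (measurable_normalize_preimage mB)).
Qed.

Lemma ge0_integral_radial (F : mR -> \bar R) : measurable_fun setT F -> (forall x, 0 <= F x)%E ->
  (\int[radial_measure]_x F x = \int[leb]_t (F (sumsq t) * (\1_preB t)%:E))%E.
Proof.
move=> mF F0; rewrite (ge0_integral_pushforward measurable_sumsq') //.
rewrite preimage_setT; apply: (@ge0_integral_density _ _ R leb
  (density_measure leb ind_ge0 ind_meas) _ ind_ge0 ind_meas (fun _ _ => erefl)) => //.
  by move=> t; exact: F0.
exact: (measurableT_comp mF measurable_sumsq').
Qed.

End Cone.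

Definition gauss_density t : R := \prod_(i < d) normal_pdf 0 1 (tnth t i).

Lemma gauss_densityE t : gauss_density t = normal_peak 1 ^+ d * expR (- sumsq t / 2).
Proof.
rewrite /gauss_density; under eq_bigr do rewrite normal_pdf01E.
rewrite big_split /= prodr_const card_ord; congr (_ * _).
rewrite -expR_sum; congr expR.
by rewrite /sumsq -sumrN mulr_suml.
Qed.

Lemma gauss_density_ge0 t : 0 <= gauss_density t.
Proof. by apply: prodr_ge0 => i _; exact: normal_pdf_ge0. Qed.

Lemma measurable_gauss_density : measurable_fun setT gauss_density.
Proof.
apply: measurable_prod => i _.
by apply: (measurableT_comp (measurable_normal_pdf 0 1)); exact: measurable_tnth.
Qed.

Definition monomial (m : 'I_d -> nat) t : R := \prod_(i < d) tnth t i ^+ m i.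

Lemma measurable_monomial m : measurable_fun setT (monomial m).
Proof.
by apply: measurable_prod => i _; apply: measurable_funX; exact: measurable_tnth.
Qed.

Lemma gaussian_monomialE m :
  leb.-integrable setT (fun t => (monomial m t * gauss_density t)%:E) /\
  (\int[leb]_t (monomial m t * gauss_density t)%:E =
    (\prod_(i < d) normal_moment (m i))%:R%:E)%E.
Proof.
rewrite (_ : (fun t => _) = fun t => (\prod_(i < d) (tnth t i ^+ m i * normal_pdf 0 1 (tnth t i)))%:E).
  exact: gaussian_monomial.
by apply/funext => t; rewrite big_split.
Qed.

(** On the ball the Gaussian density is at least [c], and its total mass is 1. *)
Lemma unit_ball_finite : (leb (@unit_ball R d) < +oo)%E.
Proof.
pose c := normal_peak 1 ^+ d * expR (- 1 / 2) : R.
have c0 : 0 < c by rewrite mulr_gt0 ?expR_gt0 // exprn_gt0 // normal_peak_gt0 // oner_eq0.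
have [_ E] := gaussian_monomialE (fun=> 0%N).
have mball := @measurable_unit_ball R d.
have H : (c%:E * leb (@unit_ball R d) <= 1)%E.
  have <- : (\int[leb]_t (monomial (fun=> 0%N) t * gauss_density t)%:E = 1)%E.
    by rewrite E big1.
  rewrite -integral_cst // integral_mkcond; apply: ge0_le_integral => //.
  - by move=> t _; rewrite patchE; case: ifP => // _; rewrite lee_fin ltW.
  - by apply/(measurable_restrictT _ _).1.
  - apply/measurable_EFinP; apply: measurable_funM; first exact: measurable_monomial.
    exact: measurable_gauss_density.
  move=> t _; rewrite /monomial big1 // mul1r patchE; case: ifPn => [|_]; last first.
    by rewrite lee_fin gauss_density_ge0.
  rewrite inE /unit_ball /= -/(sumsq t) => h; rewrite lee_fin gauss_densityE ler_wpM2l //.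
    by rewrite exprn_ge0 // normal_peak_ge0.
  by rewrite ler_expR ler_pM2r // lerN2.
rewrite ltey; apply/negP => /eqP h; move: H.
by rewrite h gt0_muley ?lte_fin // leye_eq.
Qed.

Lemma cone_fin B : measurable B -> cone_measure B \is a fin_num.
Proof.
move=> mB; rewrite ge0_fin_numE //; apply: le_lt_trans unit_ball_finite.
apply: le_measure; rewrite ?inE; [|exact: measurable_unit_ball|exact: subIsetr].
by apply: measurableI; [exact: measurable_normalize_preimage|exact: measurable_unit_ball].
Qed.

(** The radial measures of [B] and of the whole sphere are proportional. Multiplying out avoids
    dividing by the measure of the sphere, whose positivity is established later. *)
Lemma polar_ratio B (F : mR -> \bar R) : measurable B -> B `<=` unit_sphere ->
  measurable_fun setT F -> (forall x, 0 <= F x)%E ->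
  (cone_measure unit_sphere * \int[leb]_t (F (sumsq t) * (\1_(nz @^-1` B) t)%:E) =
   cone_measure B * \int[leb]_t (F (sumsq t) * (\1_(nz @^-1` unit_sphere) t)%:E))%E.
Proof.
move=> mB BS mF F0; have mS := measurable_unit_sphere.
have bS0 : 0 <= fine (cone_measure unit_sphere) by exact: fine_ge0.
have bB0 : 0 <= fine (cone_measure B) by exact: fine_ge0.
have ES : cone_measure unit_sphere = (fine (cone_measure unit_sphere))%:E by rewrite fineK // cone_fin.
have EB : cone_measure B = (fine (cone_measure B))%:E by rewrite fineK // cone_fin.
rewrite ES EB -(ge0_integral_radial mB mF F0) -(ge0_integral_radial mS mF F0).
have E1 := @ge0_integral_mscale _ _ R (radial_measure mB) setT measurableT (NngNum bS0) F mF (fun x _ => F0 x).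
have E2 := @ge0_integral_mscale _ _ R (radial_measure mS) setT measurableT (NngNum bB0) F mF (fun x _ => F0 x).
apply: etrans (esym E1) _; apply: etrans E2.
have RE (k : {nonneg R}) B' (mB' : measurable B') (r : R) : B' `<=` unit_sphere ->
    mscale k (radial_measure mB') `]-oo, r]%classic =
    (k%:num%:E * ((if 0 < r then Num.sqrt r ^+ d else 0)%:E * (fine (cone_measure B'))%:E))%E.
  by move=> B'S; rewrite fineK ?cone_fin // -(radial_measureE mB' B'S).
apply: eq_measure_integral => A mA _.
apply: borel_measure_unique => // r.
  apply: etrans (RE _ _ mB r BS) _; apply: esym; apply: etrans (RE _ _ mS r _) _ => //=.
  by rewrite -!EFinM; congr (_%:E); ring.
have := RE (NngNum bS0) _ mB r BS; rewrite -!EFinM => H.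
by apply: le_lt_trans (ltry _); rewrite le_eqVlt; apply/orP; left; apply/eqP; exact: H.
Qed.

End Polar.

Section SphereMonomials.
Variables (R : realType) (d : nat).
Hypothesis d0 : (0 < d)%N.
Local Notation mR := (measurableTypeR R).
Local Notation leb := (lebesgue_tuple R d).
Local Notation nz := (@normalize R d).
Local Notation S := (@unit_sphere R d).
Local Notation sigma := (@sphere_measure R d).
Implicit Types (t : d.-tuple R) (B : set (d.-tuple R)).

Let single (i0 : 'I_d) k : 'I_d -> nat := fun i => if i == i0 then k else 0%N.

Let single_moment i0 k : (\prod_(i < d) normal_moment (single i0 k i) = normal_moment k)%N.
Proof.
rewrite (bigD1 i0) //= big1 => [|j ji]; last by rewrite /single (negbTE ji).
by rewrite muln1 /single eqxx.
Qed.

Let single_sum i0 k : (\sum_(i < d) single i0 k i = k)%N.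
Proof.
rewrite (bigD1 i0) //= big1 => [|j ji]; last by rewrite /single (negbTE ji).
by rewrite addn0 /single eqxx.
Qed.

Let single_monomial i0 k t : monomial (single i0 k) t = tnth t i0 ^+ k.
Proof.
rewrite /monomial (bigD1 i0) //= big1 => [|j ji]; last by rewrite /single (negbTE ji) expr0.
by rewrite mulr1 /single eqxx.
Qed.

(* the Gaussian weight [sumsq t ^+ n * gauss_density t] as a function of [sumsq t] *)
Let weight n (r : mR) : R := `|r| ^+ n * (normal_peak 1 ^+ d * expR (- r / 2)).

Let weight_ge0 n r : 0 <= weight n r.
Proof. by rewrite /weight !mulr_ge0 ?exprn_ge0 ?normal_peak_ge0 ?expR_ge0. Qed.

Let measurable_weight n : measurable_fun setT (weight n).
Proof.
apply: measurable_funM; first by apply: measurable_funX; exact: (@normr_measurable R setT).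
apply: measurable_funM => //; apply: (measurableT_comp (@measurable_expR R)).
by apply: measurable_funM => //; exact: measurable_funN.
Qed.

Let weightE n t : weight n (sumsq t) = sumsq t ^+ n * gauss_density t.
Proof. by rewrite /weight gauss_densityE ger0_norm // sumsq_ge0. Qed.

Let measurable_weightq n : measurable_fun setT (fun t => weight n (sumsq t)).
Proof. exact: (measurableT_comp (measurable_weight n) (@measurable_sumsq' R d)). Qed.

Let sumsq_eq0 t : sumsq t = 0 -> forall i, tnth t i = 0.
Proof.
move=> /eqP; rewrite psumr_eq0 => [/allP h i|i _]; last exact: sqr_ge0.
by apply/eqP; have := h i (mem_index_enum i); rewrite /= sqrf_eq0.
Qed.

Let indic_weight n t : (0 < n)%N ->
  weight n (sumsq t) * \1_(nz @^-1` S) t = weight n (sumsq t).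
Proof.
move=> n0; have [q0|q0] := eqVneq (sumsq t) 0.
  by rewrite weightE q0 expr0n eqn0Ngt n0 !mul0r.
by rewrite indicE mem_set ?mulr1 //; apply/normalize_sphere.
Qed.

(** The squared norm is at most [d] times the largest squared coordinate, so its [n]-th power is at
    most [d ^+ n] times the sum of the [tnth t i ^+ (2 * n)], which have finite Gaussian moments. *)
Let weight_finite n : (\int[leb]_t (weight n (sumsq t))%:E < +oo)%E.
Proof.
pose F i t : R := monomial (single i (2 * n)) t * gauss_density t.
have FE i t : F i t = tnth t i ^+ (2 * n) * gauss_density t.
  by rewrite /F single_monomial.
have F0 i t : 0 <= F i t.
  by rewrite FE exprM mulr_ge0 ?gauss_density_ge0 // exprn_ge0 // sqr_ge0.
have mF i : measurable_fun setT (F i).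
  by apply: measurable_funM; [exact: measurable_monomial|exact: measurable_gauss_density].
have b0 : 0 <= d%:R ^+ n :> R by rewrite exprn_ge0.
have le t : weight n (sumsq t) <= d%:R ^+ n * \sum_(i < d) F i t.
  have [i Hi] : exists i, forall j, tnth t j ^+ 2 <= tnth t i ^+ 2.
    have [i _ Hi] := @Order.TotalTheory.arg_maxP _ _ _ (Ordinal d0) xpredT (fun i => tnth t i ^+ 2) isT.
    by exists i => j; exact: Hi.
  rewrite weightE; apply: le_trans (_ : d%:R ^+ n * F i t <= _).
    rewrite FE mulrA ler_wpM2r ?gauss_density_ge0 // exprM -exprMn.
    have h2 : 0 <= d%:R * tnth t i ^+ 2 by apply: mulr_ge0 => //; exact: sqr_ge0.
    apply: lerXn2r; rewrite ?nnegrE ?sumsq_ge0 // /sumsq.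
    apply: le_trans (ler_sum _ (fun j _ => Hi j)) _.
    by rewrite sumr_const card_ord mulr_natl.
  by rewrite ler_wpM2l // (bigD1 i) //= lerDl; apply: sumr_ge0.
apply: le_lt_trans (_ : \int[leb]_t (d%:R ^+ n * \sum_(i < d) F i t)%:E < +oo)%E.
  apply: ge0_le_integral => //.
  - by move=> t _; rewrite lee_fin.
  - exact/measurable_EFinP.
  - by apply/measurable_EFinP; apply: measurable_funM => //; exact: measurable_sum.
  by move=> t _; rewrite lee_fin.
under eq_integral do rewrite EFinM.
rewrite ge0_integralZl //; last 2 first.
- by apply/measurable_EFinP; exact: measurable_sum.
- by move=> t _; rewrite lee_fin; apply: sumr_ge0.
under eq_integral do rewrite -sumEFin.
have mFE i : measurable_fun setT (fun t => (F i t)%:E) by exact/measurable_EFinP.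
have FE0 i t : setT t -> (0 <= (F i t)%:E)%E by rewrite lee_fin.
rewrite (ge0_integral_sum leb measurableT mFE FE0).
under eq_bigr do rewrite (gaussian_monomialE R _).2.
by rewrite sumEFin -EFinM ltry.
Qed.

(** Otherwise the radial measure vanishes and the Gaussian integral of the squared norm is 0,
    although it dominates the second moment 1 of a single coordinate. *)
Lemma cone_sphere_gt0 : 0 < fine (cone_measure S).
Proof.
have mS := @measurable_unit_sphere R d.
rewrite lt_def fine_ge0 // andbT; apply/negP => /eqP b0.
have c0 : cone_measure S = 0%E by rewrite -[LHS]fineK ?b0 // cone_fin.
have mw : measurable_fun setT (fun x : mR => (weight 1 x)%:E) by exact/measurable_EFinP.
have w0 (x : mR) : (0 <= (weight 1 x)%:E)%E by rewrite lee_fin.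
have : (\int[leb]_t ((weight 1 (sumsq t))%:E * (\1_(nz @^-1` S) t)%:E) = 0)%E.
  rewrite -(ge0_integral_radial mS mw w0) -(integral_measure_zero setT (fun x => (weight 1 x)%:E)).
  apply: eq_measure_integral => A mA _; apply: borel_measure_unique => // r.
    by rewrite (radial_measureE mS) // c0 mule0.
  by rewrite (radial_measureE mS) // c0 mule0.
under eq_integral do rewrite -EFinM indic_weight //.
move=> E0; pose i0 := Ordinal d0.
pose m := single i0 2.
have [_ E1] := gaussian_monomialE R m.
have /eqP : (1%:E <= 0 :> \bar R)%E.
  have -> : 1%:E = (\int[leb]_t (monomial m t * gauss_density t)%:E)%E.
    by rewrite E1 single_moment.
  rewrite -E0.
  have mE t : monomial m t = tnth t i0 ^+ 2.
    exact: single_monomial.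
  apply: ge0_le_integral => //.
  - by move=> t _; rewrite lee_fin mE mulr_ge0 ?gauss_density_ge0 ?sqr_ge0.
  - apply/measurable_EFinP; apply: measurable_funM; first exact: measurable_monomial.
    exact: measurable_gauss_density.
  - exact/measurable_EFinP.
  move=> t _; rewrite lee_fin mE weightE ler_wpM2r ?gauss_density_ge0 //.
  rewrite expr1 /sumsq (bigD1 i0) //= lerDl; apply: sumr_ge0 => i _; exact: sqr_ge0.
by rewrite lee_fin ler10.
Qed.

Lemma sphere_measure_S : sigma S = (d%:R * fine (cone_measure S))%:E.
Proof.
have mS := @measurable_unit_sphere R d.
by rewrite sphere_measureE EFinM fineK // cone_fin.
Qed.

Lemma sphere_measure_gt0 : 0 < fine (sigma S).
Proof. by rewrite sphere_measure_S mulr_gt0 ?ltr0n // cone_sphere_gt0. Qed.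

Lemma monomial_tscale c m t : monomial m (tscale c t) = c ^+ (\sum_(i < d) m i) * monomial m t.
Proof.
rewrite /monomial expr_sum -big_split /=; apply: eq_bigr => i _.
by rewrite tnth_mktuple exprMn.
Qed.

Lemma integrable_sphere_monomial m : sigma.-integrable S (EFin \o monomial m).
Proof.
have mS := @measurable_unit_sphere R d.
apply: (@le_integrable _ _ R sigma S mS _ (cst 1%E)).
- by apply/measurable_EFinP; apply: measurable_funTS; exact: measurable_monomial.
- move=> t St; rewrite /= normr1 lee_fin /monomial normr_prod.
  apply: prodr_ile1 => i _; rewrite normr_ge0 normrX exprn_ile1 //.
  have : tnth t i ^+ 2 <= 1.
    have <- : sumsq t = 1 by [].
    by rewrite /sumsq (bigD1 i) //= lerDl; apply: sumr_ge0 => j _; exact: sqr_ge0.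
  by rewrite -(real_normK (num_real (tnth t i))) expr_le1.
apply/integrableP; split; first exact: measurable_cst.
rewrite integral_cst // normr1 mul1e; apply: le_lt_trans (ltry (d%:R * fine (cone_measure S))).
by rewrite le_eqVlt; apply/orP; left; apply/eqP; exact: sphere_measure_S.
Qed.

(** A monomial of degree [2 * n] is [sumsq t ^+ n] times its value at the direction of [t]. Its
    Gaussian integral is thus the integral of a function of the direction against the weighted
    measure, whose image on the sphere is a multiple of the surface measure. *)
Lemma sphere_monomial_ratio n : (0 < n)%N -> exists2 C : R, C != 0 & forall m : 'I_d -> nat,
  (\sum_(i < d) m i = 2 * n)%N ->
  C * \int[sigma]_(t in S) monomial m t = (\prod_(i < d) normal_moment (m i))%:R.
Proof.
move=> n0; have mS := @measurable_unit_sphere R d; have bS := cone_sphere_gt0.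
pose G := (\int[leb]_t (weight n (sumsq t))%:E)%E.
have G0 : (0 <= G)%E by apply: integral_ge0 => t _; rewrite lee_fin.
have Gfin : G \is a fin_num by rewrite ge0_fin_numE //; exact: weight_finite.
pose C := fine G / (d%:R * fine (cone_measure S)).
have C0 : 0 <= C by rewrite /C mulr_ge0 ?fine_ge0 // invr_ge0 mulr_ge0 // ltW.
have mw : measurable_fun setT (fun x : mR => (weight n x)%:E) by exact/measurable_EFinP.
have w0 (x : mR) : (0 <= (weight n x)%:E)%E by rewrite lee_fin.
have wq0 t : 0 <= weight n (sumsq t) by exact: weight_ge0.
pose nu := measure_function_pushforward__canonical__measure_function_Measure
  (density_measure leb wq0 (measurable_weightq n)) (@measurable_normalize R d).
(* By [polar_ratio] the direction is distributed proportionally to the surface measure; [C] is the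
   total weight [G] divided by the total surface. *)
have nuE B : measurable B -> B `<=` S -> nu B = mscale (NngNum C0) sigma B.
  move=> mB BS; have := polar_ratio mB BS mw w0.
  have -> : (\int[leb]_t ((weight n (sumsq t))%:E * (\1_(nz @^-1` S) t)%:E) = G)%E.
    by apply: eq_integral => t _; rewrite -EFinM indic_weight.
  have -> : (\int[leb]_t ((weight n (sumsq t))%:E * (\1_(nz @^-1` B) t)%:E) = nu B)%E.
    rewrite /nu /= /pushforward /density_measure integral_mkcond.
    apply: eq_integral => t _; rewrite patchE indicE.
    by case: (_ \in _); rewrite ?mule1 ?mule0.
  rewrite -(fineK (cone_fin mS)) -(fineK (cone_fin mB)) -(fineK Gfin) => H.
  have -> : mscale (NngNum C0) sigma B = (C * (d%:R * fine (cone_measure B)))%:E.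
    by rewrite !EFinM (fineK (cone_fin mB)).
  have {}H : nu B = ((fine (cone_measure S))^-1 * (fine (cone_measure B) * fine G))%:E.
    by rewrite [in RHS]EFinM [X in (_ * X)%E]EFinM -H muleA -EFinM mulVf ?mul1e // gt_eqF.
  rewrite H; congr (_%:E); rewrite /C; field.
  by rewrite gt_eqF //= pnatr_eq0 -lt0n.
have main m : (\sum_(i < d) m i = 2 * n)%N ->
    C * \int[sigma]_(t in S) monomial m t = (\prod_(i < d) normal_moment (m i))%:R.
  move=> mn; have [iM EM] := gaussian_monomialE R m.
  have mM := @measurable_monomial R d m; have im := integrable_sphere_monomial m.
  pose A := nz @^-1` S; have mA : measurable A by exact: measurable_normalize_preimage.
  (* The monomial at the direction, cut off at the origin. There the original monomial vanishes as
     well, because [n > 0]. *)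
  pose h t : R := \1_A t * monomial m (nz t).
  have hw t : h t * weight n (sumsq t) = monomial m t * gauss_density t.
    rewrite /h indicE weightE; have [tA|tA] := boolP (t \in A).
      move: tA; rewrite inE => /normalize_sphere q0; rewrite mul1r normalizeE monomial_tscale mn exprM exprVn.
      rewrite sqr_sqrtr ?sumsq_ge0 //.
      have q0' : sumsq t ^+ n != 0 by exact: expf_neq0.
      by rewrite exprVn; field.
    have q0 : sumsq t = 0.
      apply/eqP; apply: contraNT tA => q0; rewrite inE; exact/normalize_sphere.
    rewrite !mul0r; apply/esym/eqP; rewrite mulf_eq0; apply/orP; left.
    have : monomial m t = 0 ^+ (\sum_(i < d) m i) * monomial m t.
      rewrite -monomial_tscale; congr (monomial m _); apply: eq_from_tnth => i.
      by rewrite tnth_mktuple mul0r (sumsq_eq0 q0).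
    by rewrite mn expr0n muln_eq0 /= eqn0Ngt n0 mul0r => ->.
  have mMn : measurable_fun setT (fun t => monomial m (nz t)).
    exact: (measurableT_comp mM (@measurable_normalize R d)).
  have mh : measurable_fun setT h by apply: measurable_funM => //; exact: measurable_indic.
  pose nu0 := density_measure leb wq0 (measurable_weightq n).
  have ih : nu0.-integrable setT (EFin \o h).
    apply/(@integrable_density _ _ R leb nu0 _ wq0 (measurable_weightq n) (fun _ _ => erefl) _ mh).
    by apply: eq_integrable iM => // t _; rewrite /= hw.
  have hE : (EFin \o (fun t => monomial m (nz t))) \_ A = EFin \o h.
    by apply/funext => t; rewrite /h /= !patchE indicE; case: (_ \in _); rewrite ?mul1r ?mul0r.
  have iA : nu0.-integrable A (EFin \o (fun t => monomial m (nz t))).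
    by apply/(integrable_mkcond _ mA); rewrite hE.
  have E1 : (\int[nu]_(t in S) (monomial m t)%:E = (\prod_(i < d) normal_moment (m i))%:R%:E)%E.
    rewrite -EM (integral_pushforward (@measurable_normalize R d)) //; last exact/measurable_EFinP.
    rewrite integral_mkcond.
    transitivity (\int[nu0]_t (h t)%:E)%E; first by apply: eq_integral => t _; rewrite -[RHS]/((EFin \o h) t) -hE.
    rewrite (@integral_density _ _ R leb nu0 _ wq0 (measurable_weightq n) (fun _ _ => erefl) _ mh ih).
    by apply: eq_integral => t _; rewrite hw.
  have E2 : (\int[nu]_(t in S) (monomial m t)%:E = C%:E * \int[sigma]_(t in S) (monomial m t)%:E)%E.
    rewrite (eq_measure_integral (mscale (NngNum C0) sigma)); last by move=> B mB BS; exact: nuE.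
    exact: (integral_mscale (NngNum C0) mS im).
  apply: EFin_inj; rewrite -E1 E2 EFinM; congr (_ * _)%E.
  by rewrite /Rintegral; apply: fineK; exact: (integrable_fin_num mS im).
exists C => //; apply/negP => /eqP C00.
(* [C] cannot be 0, because the power [2 * n] of one coordinate has a nonzero Gaussian moment. *)
have := main _ (single_sum (Ordinal d0) (2 * n)); rewrite C00 mul0r single_moment.
move/esym/eqP; rewrite pnatr_eq0.
have : (0 < normal_moment (2 * n))%N.
  elim: (n) => // k IH; rewrite mulnS add2n /=; case: (2 * k)%N IH => //= l; rewrite muln_gt0 //.
by rewrite lt0n => /negbTE ->.
Qed.

End SphereMonomials.

(** * Averages over the sphere and the addition theorem *)

Section SphereMean.
Variables (R : realType) (d : nat).
Hypothesis d0 : (0 < d)%N.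
Local Notation C := R[i].
Local Notation mpoly := (mpoly.mpoly d C).
Local Notation homog n := (mpoly.ishomog1 n mpoly.mdeg).
Local Notation S := (@unit_sphere R d).
Local Notation sigma := (@sphere_measure R d).
Implicit Types (p q : mpoly) (f g F : 'rV[R]_d -> C) (x y : 'rV[R]_d).

Definition rv_eval x p : C := mpoly.meval (fun i => (x 0 i)%:C) p.

Lemma conj_conjc (z : C) : z^* = conjc z.
Proof. by []. Qed.

Lemma rv_dot_tuple (t : d.-tuple R) : rv_dot (rv_tuple t) (rv_tuple t) = sumsq t.
Proof. by apply: eq_bigr => i _; rewrite !mxE expr2. Qed.

Lemma sphere_tupleE : [set t : d.-tuple R | sphere (rv_tuple t)] = S.
Proof. by apply/seteqP; split => t; rewrite /sphere /unit_sphere /= rv_dot_tuple. Qed.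

Definition sphere_mean F : C := (fine (sigma S))^-1%:C *
  (Rintegral sigma S (fun t => complex.Re (F (rv_tuple t))) +i*
   Rintegral sigma S (fun t => complex.Im (F (rv_tuple t)))).

Lemma sphere_innerE f g : sphere_inner f g = sphere_mean (fun x => f x * (g x)^*).
Proof. by rewrite /sphere_inner sphere_tupleE. Qed.

Lemma eq_sphere_mean F G : (forall x, sphere x -> F x = G x) -> sphere_mean F = sphere_mean G.
Proof.
move=> FG; have E t : t \in S -> F (rv_tuple t) = G (rv_tuple t).
  by rewrite -sphere_tupleE inE => /FG.
by rewrite /sphere_mean; congr (_ * (_ +i* _)); apply: eq_Rintegral => t /E ->.
Qed.

Lemma Rintegral_monomials (I : Type) (s : seq I) (a : I -> R) (m : I -> 'I_d -> nat) :
  sigma.-integrable S (EFin \o (fun t => \sum_(i <- s) a i * monomial (m i) t)) /\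
  \int[sigma]_(t in S) (\sum_(i <- s) a i * monomial (m i) t) =
  \sum_(i <- s) a i * \int[sigma]_(t in S) monomial (m i) t.
Proof.
have mS := @measurable_unit_sphere R d.
elim: s => [|i s [IH1 IH2]].
  rewrite big_nil (_ : (fun t => _) = cst 0); last by apply/funext => t; rewrite big_nil.
  split; first by apply: integrable0.
  by rewrite Rintegral_cst // mul0r.
have im := integrable_sphere_monomial R (m i).
have iam : sigma.-integrable S (EFin \o (fun t => a i * monomial (m i) t)).
  by apply: eq_integrable (integrableZl mS (a i) im) => // t _; rewrite /= EFinM.
rewrite big_cons.
rewrite (_ : (fun t => _) = (fun t => a i * monomial (m i) t + \sum_(j <- s) a j * monomial (m j) t)).
  split; first exact: (@integrableD _ _ R sigma S mS _ _ iam IH1).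
  by rewrite RintegralD // IH2 RintegralZl.
by apply/funext => t; rewrite big_cons.
Qed.

Lemma sphere_mean_cst c : sphere_mean (cst c) = c.
Proof.
have mS := @measurable_unit_sphere R d; have s0 := sphere_measure_gt0 R d0.
rewrite /sphere_mean !Rintegral_cst //.
case: c => a b /=; rewrite /GRing.mul /= !mul0r subr0 addr0.
by congr (_ +i* _); rewrite mulrCA mulVf ?mulr1 // gt_eqF.
Qed.

Lemma rv_evalE (t : d.-tuple R) p : rv_eval (rv_tuple t) p =
  \sum_(m <- mpoly.msupp p) mpoly.mcoeff m p * (monomial (fun i => m i) t)%:C.
Proof.
rewrite /rv_eval mpoly.mevalE; apply: eq_bigr => m _; congr (_ * _).
rewrite /monomial rmorph_prod; apply: eq_bigr => i _.
by rewrite rmorphXn /= mxE.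
Qed.

Lemma Re_sum (I : Type) (s : seq I) (F : I -> C) :
  complex.Re (\sum_(i <- s) F i) = \sum_(i <- s) complex.Re (F i).
Proof. by elim: s => [|i s IH]; rewrite ?big_nil // !big_cons -IH; case: (F i); case: (\sum_(_ <- _) _). Qed.

Lemma Im_sum (I : Type) (s : seq I) (F : I -> C) :
  complex.Im (\sum_(i <- s) F i) = \sum_(i <- s) complex.Im (F i).
Proof. by elim: s => [|i s IH]; rewrite ?big_nil // !big_cons -IH; case: (F i); case: (\sum_(_ <- _) _). Qed.

Lemma ReM_real (z : C) (a : R) : complex.Re (z * a%:C) = complex.Re z * a.
Proof. by case: z => u v; rewrite /= mulr0 subr0. Qed.

Lemma ImM_real (z : C) (a : R) : complex.Im (z * a%:C) = complex.Im z * a.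
Proof. by case: z => u v; rewrite /= mulr0 add0r. Qed.

(* Over R^d the Gaussian integral of a homogeneous polynomial factors through the sphere. *)
Lemma sphere_mean_homog n : exists k : C, forall p, p \is homog (2 * n) ->
  sphere_mean (rv_eval^~ p) = k * gauss_mean p.
Proof.
have [->|n0] := posnP n.
  exists 1 => p; rewrite muln0 => /homog0_const[c ->].
  rewrite mul1r gauss_meanZ gauss_mean1 mulr1 -[RHS]sphere_mean_cst.
  by apply: eq_sphere_mean => x _; rewrite /rv_eval mpoly.mevalZ mpoly.meval1 mulr1.
have [D D0 HD] := sphere_monomial_ratio R d0 n0.
exists ((fine (sigma S))^-1 * D^-1)%:C => p hp.
rewrite rmorphM /= -mulrA /sphere_mean; congr (_ * _).
have E t : rv_eval (rv_tuple t) p =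
    \sum_(m <- mpoly.msupp p) mpoly.mcoeff m p * (monomial (fun i => m i) t)%:C := rv_evalE t p.
under eq_Rintegral do rewrite E Re_sum.
under [X in _ +i* X]eq_Rintegral do rewrite E Im_sum.
have ReE t : \sum_(m <- mpoly.msupp p) complex.Re (mpoly.mcoeff m p * (monomial (fun i => m i) t)%:C) =
   \sum_(m <- mpoly.msupp p) complex.Re (mpoly.mcoeff m p) * monomial (fun i => m i) t.
  by apply: eq_bigr => m _; rewrite ReM_real.
have ImE t : \sum_(m <- mpoly.msupp p) complex.Im (mpoly.mcoeff m p * (monomial (fun i => m i) t)%:C) =
   \sum_(m <- mpoly.msupp p) complex.Im (mpoly.mcoeff m p) * monomial (fun i => m i) t.
  by apply: eq_bigr => m _; rewrite ImM_real.
under eq_Rintegral do rewrite ReE.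
under [X in _ +i* X]eq_Rintegral do rewrite ImE.
rewrite (Rintegral_monomials _ (fun m => complex.Re (mpoly.mcoeff m p)) (fun (m : mpoly.multinom d) i => m i)).2.
rewrite (Rintegral_monomials _ (fun m => complex.Im (mpoly.mcoeff m p)) (fun (m : mpoly.multinom d) i => m i)).2.
have moment (m : mpoly.multinom d) : m \in mpoly.msupp p ->
    \int[sigma]_(t in S) monomial (fun i => m i) t = D^-1 * (\prod_(i < d) normal_moment (m i))%:R.
  move=> mp; have /mpoly.dhomogP hp' := hp; have := hp' m mp; rewrite /= mpoly.mdegE => mn.
  by rewrite -(HD _ mn) mulrA mulVf ?mul1r.
rewrite /gauss_mean mulr_sumr; apply/eqP; rewrite eq_complex /= Re_sum Im_sum.
have termE (z : C) (k : nat) : (D^-1)%:C * (z * k%:R) = z * (D^-1 * k%:R)%:C.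
  by rewrite (rmorphM (real_complex R)) (rmorph_nat (real_complex R)) mulrCA.
apply/andP; split; apply/eqP; rewrite big_seq [RHS]big_seq; apply: eq_bigr => m mp.
  by rewrite (moment m mp) termE ReM_real.
by rewrite (moment m mp) termE ImM_real.
Qed.

(** Conjugated coefficients: at real points the value is the conjugate of that of [p], so inner
    products of harmonics are averages of polynomials. *)
Definition conj_poly p : mpoly :=
  \sum_(m <- mpoly.msupp p) (mpoly.mcoeff m p)^* *: mpoly.mpolyX C m.

Lemma homog_conj_poly n p : p \is homog n -> conj_poly p \is homog n.
Proof.
move=> /mpoly.dhomogP hp; rewrite /conj_poly big_seq; apply: rpred_sum => m mp.
by apply: rpredZ; rewrite mpoly.dhomogX /= (hp m mp).
Qed.

Lemma rv_eval_conj x p : rv_eval x (conj_poly p) = (rv_eval x p)^*.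
Proof.
rewrite /rv_eval /conj_poly raddf_sum mpoly.mevalE rmorph_sum; apply: eq_bigr => m _.
rewrite /= mpoly.mevalZ mpoly.mevalX rmorphM /=; congr (_ * _).
rewrite rmorph_prod; apply: eq_bigr => i _; rewrite rmorphXn /=; congr (_ ^+ _).
by rewrite conj_conjc conjc_real.
Qed.

End SphereMean.

Section AdditionTheorem.
Variables (R : realType) (d : nat) (Ch : nat -> R -> R).
Hypotheses (d2 : (2 <= d)%N) (HCh : normalized_gegenbauer ((d%:R - 2) / 2)%:E Ch).
Local Notation C := R[i].
Local Notation homog n := (mpoly.ishomog1 n mpoly.mdeg).
Implicit Types (x y : 'rV[R]_d).

Let cplx x (i : 'I_d) : C := (x 0 i)%:C.

Lemma sphere_dot_bound x y : sphere x -> sphere y -> -1 <= rv_dot x y <= 1.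
Proof.
move=> hx hy; have [h1 h2] : 0 <= rv_dot (x + y) (x + y) /\ 0 <= rv_dot (x - y) (x - y).
  by split; apply: sumr_ge0 => i _; rewrite -expr2 sqr_ge0.
have E1 : rv_dot (x + y) (x + y) = rv_dot x x + rv_dot y y + 2 * rv_dot x y.
  rewrite /rv_dot mulr_sumr -!big_split /=; apply: eq_bigr => i _; rewrite !mxE; ring.
have E2 : rv_dot (x - y) (x - y) = rv_dot x x + rv_dot y y - 2 * rv_dot x y.
  rewrite /rv_dot mulr_sumr -sumrN -!big_split /=; apply: eq_bigr => i _; rewrite !mxE; ring.
rewrite /sphere /= in hx hy; rewrite E1 hx hy in h1; rewrite E2 hx hy in h2.
by apply/andP; split; lra.
Qed.

Let cplx_sqr y : sphere y -> \sum_i cplx y i ^+ 2 = 1.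
Proof.
move=> hy; rewrite -[RHS](rmorph1 (real_complex R)) -[in RHS]hy rmorph_sum.
by apply: eq_bigr => i _; rewrite rmorphM expr2.
Qed.

Lemma rv_eval_zonal x y n : sphere x -> sphere y ->
  rv_eval x (zonal (cplx y) n) = (Ch n (rv_dot x y))%:C.
Proof.
move=> hx hy.
have [c0 c1 cS] := normalized_gegenbauer_recurrence d2 HCh (sphere_dot_bound hx hy).
have evR : rv_eval x (rho C d) = 1.
  rewrite -(cplx_sqr hx) /rv_eval /rho raddf_sum; apply: eq_bigr => i _.
  by rewrite /= !expr2 mpoly.mevalM mpoly.mevalXU.
have evD : rv_eval x (dir (cplx y)) = (rv_dot x y)%:C.
  rewrite /rv_eval /dir raddf_sum rmorph_sum; apply: eq_bigr => i _.
  by rewrite /= mpoly.mevalZ mpoly.mevalXU rmorphM /= mulrC.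
elim/zonal_ind2: n => [||n IH IH1].
- by rewrite zonal0 /rv_eval mpoly.meval1 c0.
- by rewrite zonal1 evD c1.
apply: (mulfI (zonal_den_neq0 C d2 n)).
transitivity (rv_eval x ((n + d.-1)%:R * zonal (cplx y) n.+2)).
  by rewrite /rv_eval mpoly.mevalM rmorph_nat.
rewrite zonal_rec // -(rmorph_nat (real_complex R)) -rmorphM cS.
rewrite /rv_eval mpoly.mevalB !mpoly.mevalM !rmorph_nat -!/(rv_eval _ _) IH IH1 evR evD.
by rewrite !(rmorphB, rmorphM, rmorph_nat) /= mul1r mulrA.
Qed.

Lemma gegenbauer1 n : Ch n 1 = 1.
Proof.
have b1 : -1 <= (1 : R) <= 1 by apply/andP; split; lra.
have [c0 c1 cS] := normalized_gegenbauer_recurrence d2 HCh b1.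
elim/zonal_ind2: n => // n IH IH1.
have nz : (n + d.-1)%:R != 0 :> R := zonal_den_neq0 R d2 n.
apply: (mulfI nz); rewrite cS IH IH1 !mulr1.
have [e ->] : exists e, d = e.+2 by exists d.-2; case: (d) d2 => [|[]].
by rewrite /= -!natr1 !natrD; ring.
Qed.

Variables (n N : nat) (Y : 'I_N -> 'rV[R]_d -> C).
Hypothesis HY : orthonormal_basis_harmonics n Y.

Lemma addition_theorem : (0 < N)%N /\ forall x y, sphere x -> sphere y ->
  (Ch n (rv_dot x y))%:C = N%:R^-1 * \sum_(k < N) Y k x * (Y k y)^*.
Proof.
have d0 : (0 < d)%N by exact: leq_trans d2.
have [YH YO YB] := HY.
have [k Hk] := sphere_mean_homog R d0 n.
have [b b0 Hb] := gauss_mean_zonal C n d2.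
have /choice [p Hp] i : exists p, [/\ p \is homog n, lapl p = 0 &
    forall x, sphere x -> Y i x = rv_eval x p] by have [q Hq] := YH i; exists q.
have hp i : p i \is homog n by have [] := Hp i.
have YE i x : sphere x -> Y i x = rv_eval x (p i) by have [_ _] := Hp i; apply.
have YcE i x : sphere x -> (Y i x)^* = rv_eval x (conj_poly (p i)).
  by move=> hx; rewrite rv_eval_conj -YE.
(* All averages below are of products of two polynomials of degree [n], so [sphere_mean_homog]
   applies with a single constant [k]. *)
have hM q r : q \is homog n -> r \is homog n -> q * r \is homog (2 * n).
  by move=> hq hr; rewrite mul2n -addnn; exact: mpoly.dhomogM.
have gO i j : k * gauss_mean (p i * conj_poly (p j)) = (i == j)%:R.
  rewrite -YO sphere_innerE -Hk ?hM ?homog_conj_poly //.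
  apply: eq_sphere_mean => x hx; rewrite YE // YcE //.
  by rewrite /rv_eval mpoly.mevalM.
pose kb := (k * b)^*.
have key x y : sphere x -> sphere y ->
    (Ch n (rv_dot x y))%:C = kb * \sum_(i < N) Y i x * (Y i y)^*.
  move=> hx hy.
  have ZH : spherical_harmonic n (fun z => rv_eval z (zonal (cplx y) n)).
    exists (zonal (cplx y) n); split => //; first exact: homog_zonal.
    by apply: lapl_zonal => //; exact: cplx_sqr.
  have [c Hc] := YB _ ZH.
  (* The average of [Y i] against the conjugate of the zonal polynomial is computed twice: by
     orthonormality, and by the reproducing property, the zonal polynomial being real on the
     sphere. *)
  have cE i : (c i)^* = k * b * Y i y.
    have E1 : sphere_mean (fun z => Y i z * (rv_eval z (zonal (cplx y) n))^*) = (c i)^*.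
      transitivity (sphere_mean (fun z => rv_eval z (p i * \sum_(j < N) (c j)^* *: conj_poly (p j)))).
        apply: eq_sphere_mean => z hz; rewrite Hc // YE // /rv_eval mpoly.mevalM; congr (_ * _).
        rewrite !raddf_sum; apply: eq_bigr => j _.
        by rewrite /= mpoly.mevalZ rmorphM /= YcE.
      rewrite Hk; last first.
        by apply: hM => //; apply: rpred_sum => j _; apply: rpredZ; exact: homog_conj_poly.
      have -> : p i * \sum_(j < N) (c j)^* *: conj_poly (p j) =
          \sum_(j < N) (c j)^* *: (p i * conj_poly (p j)).
        by rewrite mulr_sumr; apply: eq_bigr => j _; rewrite scalerAr.
      rewrite gauss_mean_sum mulr_sumr (bigD1 i) //= big1 => [|j ji].
        by rewrite addr0 gauss_meanZ mulrCA gO eqxx mulr1.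
      by rewrite gauss_meanZ mulrCA gO eq_sym (negbTE ji) mulr0.
    rewrite -E1 -mulrA; have [_ lp _] := Hp i.
    rewrite (YE i y hy) -[rv_eval y _](erefl (mpoly.meval (cplx y) (p i))).
    rewrite -(Hb (cplx y) (p i) (cplx_sqr hy) (hp i) lp) -Hk; last exact: hM (homog_zonal _ _).
    apply: eq_sphere_mean => z hz; rewrite YE // rv_eval_zonal // conj_conjc conjc_real.
    by rewrite -rv_eval_zonal // /rv_eval mpoly.mevalM.
  rewrite -(rv_eval_zonal n hx hy) Hc // mulr_sumr; apply: eq_bigr => i _.
  have -> : c i = kb * (Y i y)^* by rewrite -[LHS]conjCK cE rmorphM.
  by rewrite -mulrA; congr (_ * _); exact: mulrC.
have one y : sphere y -> kb * \sum_(i < N) Y i y * (Y i y)^* = 1.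
  by move=> hy; rewrite -key // hy gegenbauer1.
(* Orthonormality gives each squared modulus of [Y i] the average 1; in particular [N] cannot be
   0. *)
have kbN : kb * N%:R = 1.
  have <- : k * gauss_mean (kb *: \sum_(i < N) p i * conj_poly (p i)) = kb * N%:R.
    rewrite gauss_meanZ mulrCA gauss_mean_sum mulr_sumr; congr (_ * _).
    by under eq_bigr do rewrite gO eqxx; rewrite sumr_const card_ord.
  rewrite -Hk; last first.
    by apply: rpredZ; apply: rpred_sum => i _; apply: hM => //; exact: homog_conj_poly.
  rewrite -[RHS](sphere_mean_cst d0 1); apply: eq_sphere_mean => y hy.
  rewrite /= -[RHS](one y hy) /rv_eval mpoly.mevalZ raddf_sum; congr (_ * _).
  by apply: eq_bigr => i _; rewrite /= mpoly.mevalM YcE // YE.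
have N0 : (0 < N)%N.
  by rewrite lt0n; apply/eqP => N0; move/eqP: kbN; rewrite N0 mulr0 eq_sym oner_eq0.
split => // x y hx hy; rewrite key //; congr (_ * _).
have NC : N%:R != 0 :> C by rewrite pnatr_eq0 -lt0n.
by apply: (mulIf NC); rewrite kbN mulVf.
Qed.

End AdditionTheorem.

(** * The case of finite dimension *)

Section ComplexLimits.
Variable R : realType.
Local Notation C := R[i].
Implicit Types (z : nat -> C) (l : C).

Lemma normcE (u : C) : `|u| = (Normc.normc u)%:C.
Proof. by []. Qed.

Lemma Re_le_normc (u : C) : `|complex.Re u| <= Normc.normc u.
Proof.
by case: u => a b /=; rewrite -sqrtr_sqr ler_wsqrtr // lerDl sqr_ge0.
Qed.

Lemma Im_le_normc (u : C) : `|complex.Im u| <= Normc.normc u.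
Proof.
by case: u => a b /=; rewrite -sqrtr_sqr ler_wsqrtr // lerDr sqr_ge0.
Qed.

Lemma normc_le (u : C) : Normc.normc u <= `|complex.Re u| + `|complex.Im u|.
Proof.
case: u => a b /=; rewrite -[leRHS]ger0_norm ?addr_ge0 // -sqrtr_sqr ler_wsqrtr //.
rewrite -(real_normK (num_real a)) -(real_normK (num_real b)).
have := mulr_ge0 (normr_ge0 a) (normr_ge0 b); nra.
Qed.

Lemma ReB (u v : C) : complex.Re (u - v) = complex.Re u - complex.Re v.
Proof. by case: u; case: v. Qed.

Lemma ImB (u v : C) : complex.Im (u - v) = complex.Im u - complex.Im v.
Proof. by case: u; case: v. Qed.

Lemma cvg_complexP z l : ((fun n => z n : C^o) @ \oo --> (l : C^o)) <->
  ((fun n => complex.Re (z n)) @ \oo --> complex.Re l) /\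
  ((fun n => complex.Im (z n)) @ \oo --> complex.Im l).
Proof.
split=> [zl|[zr zi]].
  have H (e : R) : 0 < e -> \forall n \near \oo, Normc.normc (l - z n) < e.
    move=> e0; have e0' : 0 < e%:C by rewrite ltcR.
    have /cvgrPdist_lt /(_ _ e0') := zl; apply: filterS => n /=.
    by rewrite normcE ltcR.
  split; apply/cvgrPdist_lt => e e0; apply: filterS (H e e0) => n; apply: le_lt_trans.
    by rewrite -ReB Re_le_normc.
  by rewrite -ImB Im_le_normc.
apply/cvgrPdist_lt => e e0.
(* In the order of the complex numbers a positive element is real. *)
have eE : e = (complex.Re e)%:C.
  by move: e0; case: e => a b; rewrite ltcE /= => /andP[/eqP ->].
have r0 : 0 < complex.Re e by rewrite eE ltcR in e0.
have r2 : 0 < complex.Re e / 2 by rewrite divr_gt0.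
have /cvgrPdist_lt /(_ _ r2) Hr := zr; have /cvgrPdist_lt /(_ _ r2) Hi := zi.
apply: filterS2 Hr Hi => n hr hi; rewrite /= normcE eE ltcR.
apply: le_lt_trans (normc_le _) _; rewrite ReB ImB [ltRHS]splitr; exact: ltrD.
Qed.

Lemma lim_complex z l : ((fun n => z n : C^o) @ \oo --> (l : C^o)) ->
  limn (fun n => z n : C^o) = l.
Proof. by move=> zl; apply: (@cvg_lim C^o) => //; exact: norm_hausdorff. Qed.

Lemma is_cvg_complexP z : cvgn (fun n => z n : C^o) <->
  cvgn (fun n => complex.Re (z n)) /\ cvgn (fun n => complex.Im (z n)).
Proof.
split=> [/cvg_ex[l /cvg_complexP[h1 h2]]|[h1 h2]].
  by split; apply/cvg_ex; [exists (complex.Re l)|exists (complex.Im l)].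
apply/cvg_ex; exists (limn (fun n => complex.Re (z n)) +i* limn (fun n => complex.Im (z n))).
exact/cvg_complexP.
Qed.

(** Where the complex sequence diverges, its [limn] is the default point, whose parts need not be
    the real limits of the parts; the convergence set is therefore treated separately. *)
Lemma measurable_lim_complex d (T : measurableType d) (S : nat -> T -> C) :
  (forall n, measurable_fun setT (fun w => complex.Re (S n w))) ->
  (forall n, measurable_fun setT (fun w => complex.Im (S n w))) ->
  measurable_fun setT (fun w => complex.Re (limn (fun n => S n w : C^o) : C)) /\
  measurable_fun setT (fun w => complex.Im (limn (fun n => S n w : C^o) : C)).
Proof.
move=> mr mi; pose pt : C := (point : C^o).
pose A := [set w | cvgn (fun n => complex.Re (S n w))] `&`
  [set w | cvgn (fun n => complex.Im (S n w))].
have mA : measurable A by apply: measurableI; exact: measurable_cvgn.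
have mI : measurable_fun setT (\1_A : T -> R) by exact: measurable_indic.
have mI' : measurable_fun setT (\1_(~` A) : T -> R).
  by apply: measurable_indic; exact: measurableC.
have E w : (limn (fun n => S n w : C^o) : C) =
    if w \in A then limn (fun n => complex.Re (S n w)) +i* limn (fun n => complex.Im (S n w)) else pt.
  case: ifPn => [|nA].
    rewrite inE => -[h1 h2]; apply: lim_complex; exact/cvg_complexP.
  apply: (@dvgP C^o) => /is_cvg_complexP[h1 h2]; move/negP: nA; apply.
  by rewrite inE; split.
split.
  rewrite (_ : (fun w => _) = fun w => \1_A w * limn (fun n => complex.Re (S n w)) +
      \1_(~` A) w * complex.Re pt).
    by apply: measurable_funD; apply: measurable_funM => //; exact: measurable_limn.
  apply/funext => w; rewrite E !indicE in_setC.
  by case: (w \in A); rewrite /= ?mul1r ?mul0r ?addr0 ?add0r.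
rewrite (_ : (fun w => _) = fun w => \1_A w * limn (fun n => complex.Im (S n w)) +
    \1_(~` A) w * complex.Im pt).
  by apply: measurable_funD; apply: measurable_funM => //; exact: measurable_limn.
apply/funext => w; rewrite E !indicE in_setC.
by case: (w \in A); rewrite /= ?mul1r ?mul0r ?addr0 ?add0r.
Qed.

End ComplexLimits.

Section AlmostSureEquality.
Context d (T : measurableType d) (R : realType) (P : probability T R).
Implicit Types X Y : T -> R.

(** This and the next two lemmas transfer results from the pair of real limits to the parts of the
    complex limit, which agree with them almost surely. *)
Lemma ae_L2 X Y : measurable_fun setT X -> Y \in Lfun P 2%:E ->
  {ae P, forall w, X w = Y w} -> X \in Lfun P 2%:E.
Proof.
move=> mX hY XY; have /Lfun2P[mY iY] := hY; apply/Lfun2P; split => //.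
rewrite (ae_eq_integral (fun w => (Y w ^+ 2)%:E)) //.
- by apply/measurable_EFinP; exact: measurable_funX.
- by apply/measurable_EFinP; exact: measurable_funX.
by apply: filterS XY => w -> _.
Qed.

Lemma ae_ip X Y X' Y' : X \in Lfun P 2%:E -> Y \in Lfun P 2%:E ->
  X' \in Lfun P 2%:E -> Y' \in Lfun P 2%:E ->
  {ae P, forall w, X w = X' w} -> {ae P, forall w, Y w = Y' w} -> ip P X Y = ip P X' Y'.
Proof.
move=> hX hY hX' hY' XX YY; rewrite /ip /Rintegral.
rewrite (ae_eq_integral (fun w => (X' w * Y' w)%:E)) //.
- by apply/measurable_EFinP; apply: measurable_funM (measurable_L2 hX) (measurable_L2 hY).
- by apply/measurable_EFinP; apply: measurable_funM (measurable_L2 hX') (measurable_L2 hY').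
by apply: filterS2 XX YY => w -> -> _.
Qed.

Lemma ae_cvgL2 (S : nat -> T -> R) X Y : (forall n, S n \in Lfun P 2%:E) ->
  X \in Lfun P 2%:E -> Y \in Lfun P 2%:E -> {ae P, forall w, X w = Y w} ->
  cvgL2 P S Y -> cvgL2 P S X.
Proof.
move=> hS hX hY XY; rewrite /cvgL2.
have E n : ip P (fun w => S n w - X w) (fun w => S n w - X w) =
    ip P (fun w => S n w - Y w) (fun w => S n w - Y w).
  have XY' : {ae P, forall w, S n w - X w = S n w - Y w} by apply: filterS XY => w ->.
  by apply: ae_ip => //; exact: L2B.
by under eq_fun do rewrite -E.
Qed.

End AlmostSureEquality.

Section FiniteDimensional.
Context (R : realType) (disp : measure_display) (Omega : measurableType disp)
  (P : probability Omega R).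
Variables (d : nat) (Ch : nat -> R -> R) (K : 'rV[R]_d -> 'rV[R]_d -> R)
  (alpha : nat -> R -> R -> R) (N : nat -> nat)
  (Y : forall n, 'I_(N n) -> 'rV[R]_d -> R[i]) (g : nat -> nat -> R -> Omega -> R).
Local Notation C := R[i].
Local Notation D := (@nonneg_half_line R).
Local Notation nrm := (enorm (@rv_dot R d)).
Local Notation uv := (unitv (@rv_dot R d)).
Hypotheses (d2 : (2 <= d)%N) (HCh : normalized_gegenbauer ((d%:R - 2) / 2)%:E Ch)
  (HK : associated_kernels (@rv_dot R d) Ch K alpha)
  (HY : forall n, orthonormal_basis_harmonics n (@Y n)).
Let J : set (nat * nat) := [set nk | (nk.2 < N nk.1)%N].
Let g' (nk : nat * nat) := g nk.1 nk.2.
Hypothesis gG0 : forall n k, (k < N n)%N -> centered_gaussian P D (g n k) (alpha n).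
Hypothesis gI : independent_functions P D J g'.

Let gG nk : J nk -> centered_gaussian P D (g' nk) (alpha nk.1).
Proof. by case: nk => n k; exact: gG0. Qed.

Let nrmD x : D (nrm x). Proof. exact: enorm_ge0. Qed.

Let N_gt0 n : (0 < N n)%N.
Proof. by have [] := addition_theorem d2 HCh (HY n). Qed.

Let rv_dot_ge0 (x : 'rV[R]_d) : 0 <= rv_dot x x.
Proof. by apply: sumr_ge0 => i _; rewrite -expr2 sqr_ge0. Qed.

Let uv_sphere x : x != 0 -> sphere (uv x).
Proof.
move=> x0; have q0 : rv_dot x x != 0.
  apply: contra x0; rewrite psumr_eq0 => [/allP h|i _]; last by rewrite -expr2 sqr_ge0.
  apply/eqP/rowP => i; rewrite mxE; apply/eqP.
  by have := h i (mem_index_enum i); rewrite /= -expr2 sqrf_eq0.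
have E : rv_dot (uv x) (uv x) = (nrm x)^-1 ^+ 2 * rv_dot x x.
  rewrite /rv_dot mulr_sumr; apply: eq_bigr => i _; rewrite !mxE expr2 -!mulrA.
  by rewrite [x 0 i * _]mulrCA.
by rewrite /sphere /= E exprVn sqr_sqrtr // mulVf.
Qed.

(** The real coefficients of [f_finite] in the fields [g n k]; the boolean selects the imaginary
    part. In degree 0 only the field [k = 0] contributes, and only to the real part, the origin
    included. *)
Let coef n (k : 'I_(N n)) (u : 'rV[R]_d * bool) : R :=
  if n == 0%N then (if (k == 0 :> nat) && ~~ u.2 then 1 else 0)
  else if u.1 == 0 then 0
  else (Num.sqrt (N n)%:R)^-1 *
    (if u.2 then complex.Im (Y k (uv u.1)) else complex.Re (Y k (uv u.1))).

Let f n (u : 'rV[R]_d * bool) := re_im (f_finite Y g n) u.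

Let fE n u : f n u = fun w => \sum_(k < N n) coef k u * g' (n, k : nat) (nrm u.1) w.
Proof.
apply/funext => w; case: u => x b; rewrite /f /re_im /f_finite /coef /=.
have [n0|n0] := eqVneq n 0%N.
  rewrite (bigD1 (Ordinal (N_gt0 n))) //= big1 => [|k]; last first.
    by rewrite -val_eqE /= => /negbTE ->; rewrite mul0r.
  by rewrite n0; case: b; rewrite /= ?mul0r ?mul1r addr0.
have [x0|x0] := eqVneq x 0.
  by rewrite big1 => [|k _]; [case: b|rewrite mul0r].
have reC (a : R) (z : C) : complex.Re (a%:C * z) = a * complex.Re z.
  by case: z => p q; rewrite /= mul0r subr0.
have imC (a : R) (z : C) : complex.Im (a%:C * z) = a * complex.Im z.
  by case: z => p q; rewrite /= mul0r addr0.
case: b; rewrite ?imC ?reC ?Im_sum ?Re_sum mulr_sumr; apply: eq_bigr => k _;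
  by rewrite ?imC ?reC -mulrA; congr (_ * _); exact: mulrC.
Qed.

Let hg n (k : 'I_(N n)) x : g' (n, k : nat) (nrm x) \in Lfun P 2%:E.
Proof. by apply: (gaussian_L2 gG) => //=; exact: ltn_ord. Qed.

Let V := family_span J D g'.

Let VG : gaussian_space P V. Proof. exact: family_span_gaussian gG gI. Qed.

Let fV n u : V (f n u).
Proof.
exists [seq (coef k u, ((n, k : nat), nrm u.1)) | k <- enum 'I_(N n)]; split.
  by move=> p /mapP[k _ ->] /=; split; [exact: ltn_ord|exact: nrmD].
by rewrite fE; apply/funext => w; rewrite big_map big_enum.
Qed.

Let blk n : set (nat * nat) := [set nk | nk.1 = n /\ (nk.2 < N n)%N].

Let blkJ n : blk n `<=` J. Proof. by move=> [m k] /= [<-]. Qed.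

Let blk_disj m n nk : blk m nk -> blk n nk -> m = n. Proof. by move=> [<- _] [<-]. Qed.

Let f_wrt n u : measurable_wrt (fields_on D g' (blk n)) (f n u).
Proof.
rewrite fE; apply: measurable_sum => k; apply: measurable_funM; first exact: measurable_cst.
by apply: gaussian_wrt => //=; split => //; exact: ltn_ord.
Qed.

Let g_ip n (k l : 'I_(N n)) x y : ip P (g' (n, k : nat) (nrm x)) (g' (n, l : nat) (nrm y)) =
  (k == l)%:R * alpha n (nrm x) (nrm y).
Proof.
have Jk : J (n, k : nat) by exact: ltn_ord.
have Jl : J (n, l : nat) by exact: ltn_ord.
have [<-|kl] := eqVneq k l; first by rewrite mul1r; exact: (gaussian_ip gG Jk).
rewrite mul0r ip_indep2 ?(hg k) ?(hg l) //; first by rewrite (gaussian_mean gG Jk) // mul0r.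
apply: (fields_on_indep2 gG gI (J1 := [set (n, k : nat)]) (J2 := [set (n, l : nat)])).
- by move=> _ ->.
- by move=> _ ->.
- by apply/disj_setPS => _ [/= -> [/eqP]]; rewrite val_eqE (negbTE kl).
- exact: gaussian_wrt.
- exact: gaussian_wrt.
Qed.

Let f_ip n u v : ip P (f n u) (f n v) =
  alpha n (nrm u.1) (nrm v.1) * \sum_(k < N n) coef k u * coef k v.
Proof.
rewrite !fE ip_suml; last 2 first.
- by move=> k _; apply: L2Z; exact: hg.
- by apply: L2_sum => k _; apply: L2Z; exact: hg.
rewrite mulr_sumr; apply: eq_bigr => k _.
rewrite ip_sumr; last 2 first.
- by move=> l _; apply: L2Z; exact: hg.
- by apply: L2Z; exact: hg.
rewrite (bigD1 k) //= big1 ?addr0 => [|l lk].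
  by rewrite (ipZl _ (hg k _) (L2Z _ (hg k _))) (ipZr _ (hg k _) (hg k _)) g_ip eqxx mul1r mulrA mulrC.
by rewrite (ipZl _ (hg k _) (L2Z _ (hg l _))) (ipZr _ (hg k _) (hg l _)) g_ip eq_sym (negbTE lk) mul0r !mulr0.
Qed.

(** The angular factor of the kernel with its conventions at the origin: 1 in degree 0, otherwise
    0. *)
Let angular n x y : R :=
  if n == 0%N then 1 else if (x == 0) || (y == 0) then 0 else Ch n (rv_dot (uv x) (uv y)).

Let coefE n (k : 'I_(N n)) x : n != 0%N -> x != 0 ->
  coef k (x, false) +i* coef k (x, true) = (Num.sqrt (N n)%:R)^-1%:C * Y k (uv x).
Proof.
move=> n0 x0; rewrite /coef (negbTE n0) /= (negbTE x0).
by case: (Y k (uv x)) => a b; rewrite /GRing.mul /= !mul0r subr0 addr0.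
Qed.

(** The addition theorem in terms of the coefficients. The right side is real: the real part of the
    identity yields the covariance, and the imaginary part a symmetry that makes the covariance
    real. *)
Let coef_sum n x y :
  \sum_(k < N n) (coef k (x, false) +i* coef k (x, true)) * (coef k (y, false) +i* coef k (y, true))^* =
  (angular n x y)%:C.
Proof.
rewrite /angular; have [n0|n0] := eqVneq n 0%N.
  have c0 (k : 'I_(N n)) u : coef k u = ((k == 0 :> nat) && ~~ u.2)%:R.
    by rewrite /coef (introT eqP n0); case: ifP.
  rewrite (bigD1 (Ordinal (N_gt0 n))) //= big1 => [|k].
    by rewrite !c0 /= addr0 conj_conjc conjc1 mulr1.
  by rewrite -val_eqE !c0 /= => /negbTE ->; rewrite mul0r.
have [x0|x0] := eqVneq x 0.
  by apply: big1 => k _; rewrite /coef (negbTE n0) /= x0 eqxx mul0r.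
have [y0|y0] := eqVneq y 0.
  by apply: big1 => k _; rewrite /coef (negbTE n0) /= y0 eqxx conj_conjc conjc0 mulr0.
have [_ A] := addition_theorem d2 HCh (HY n).
rewrite /= A; [|exact: uv_sphere..].
rewrite mulr_sumr; apply: eq_bigr => k _; rewrite !coefE // rmorphM /= conj_conjc conjc_real.
rewrite mulrACA; congr (_ * _).
rewrite -rmorphM -expr2 exprVn sqr_sqrtr // (rmorphV (real_complex R)) ?unitfE ?pnatr_eq0 -?lt0n //.
by rewrite rmorph_nat.
Qed.

Let coef_re n x y : \sum_(k < N n) coef k (x, false) * coef k (y, false) +
  \sum_(k < N n) coef k (x, true) * coef k (y, true) = angular n x y.
Proof.
rewrite -[RHS]/(complex.Re (angular n x y)%:C) -coef_sum Re_sum -big_split /=.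
by apply: eq_bigr => k _; rewrite mulrN opprK.
Qed.

Let coef_im n x y : \sum_(k < N n) coef k (x, true) * coef k (y, false) =
  \sum_(k < N n) coef k (x, false) * coef k (y, true).
Proof.
apply/eqP; rewrite -subr_eq0 -sumrN -big_split /=; apply/eqP.
rewrite -[RHS]/(complex.Im (angular n x y)%:C) -coef_sum Im_sum.
by apply: eq_bigr => k _; rewrite /= mulrN addrC.
Qed.

Let kernel_series x y :
  (fun M => \sum_(n < M) alpha n (nrm x) (nrm y) * angular n x y) @ \oo --> K x y.
Proof.
have [_ _ _ Ks K0] := HK.
have zero : x = 0 \/ y = 0 ->
    (fun M => \sum_(n < M) alpha n (nrm x) (nrm y) * angular n x y) @ \oo --> K x y.
  move=> xy; rewrite K0 // -(cvg_shiftS _).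
  rewrite (_ : (fun _ => _) = cst (alpha 0 (nrm x) (nrm y))); first exact: cvg_cst.
  apply/funext => M; rewrite big_ord_recl /= big1 ?addr0 => [|i _].
    by rewrite /angular eqxx mulr1.
  by rewrite /angular /=; case: xy => ->; rewrite eqxx ?orbT mulr0.
have [x0|x0] := eqVneq x 0; first by apply: zero; left.
have [y0|y0] := eqVneq y 0; first by apply: zero; right.
have := Ks x y x0 y0; rewrite /series /=.
have E M : \sum_(n < M) alpha n (nrm x) (nrm y) * angular n x y =
    \sum_(0 <= n < M) alpha n (nrm x) (nrm y) * Ch n (rv_dot (uv x) (uv y)).
  rewrite big_mkord; apply: eq_bigr => n _; rewrite /angular (negbTE x0) (negbTE y0) /=.
  case: eqVneq => // ->.
  have [-> _ _] := normalized_gegenbauer_recurrence d2 HCh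
    (sphere_dot_bound (uv_sphere x0) (uv_sphere y0)).
  by [].
by under [in X in _ -> X]eq_fun do rewrite E.
Qed.

Let alpha_ge0 n x : 0 <= alpha n (nrm x) (nrm x).
Proof.
have Jk : J (n, 0%N) by exact: N_gt0.
by rewrite -(gaussian_ip gG Jk (nrmD x) (nrmD x)) ip_ge0.
Qed.

Let coef_le n x b : \sum_(k < N n) coef k (x, b) * coef k (x, b) <= angular n x x.
Proof.
rewrite -coef_re; have H b' : 0 <= \sum_(k < N n) coef k (x, b') * coef k (x, b').
  by apply: sumr_ge0 => k _; rewrite -expr2 sqr_ge0.
by case: b; rewrite ?lerDl ?lerDr.
Qed.

Let angular_ge0 n x : 0 <= angular n x x.
Proof.
apply: le_trans (coef_le n x true); apply: sumr_ge0 => k _; rewrite -expr2; exact: sqr_ge0.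
Qed.

(** Real and imaginary parts share the variance [alpha n * angular n], so each is bounded by it, and
    these variances sum to [K x x]. *)
Let f_bounded u : exists b, forall M, \sum_(n < M) ip P (f n u) (f n u) <= b.
Proof.
case: u => x b; exists (K x x) => M.
apply: le_trans (_ : \sum_(n < M) alpha n (nrm x) (nrm x) * angular n x x <= _).
  by apply: ler_sum => n _; rewrite f_ip ler_wpM2l //; exact: coef_le.
rewrite -(cvg_lim _ (@kernel_series x x)) //.
apply: (nondecreasing_cvgn_le (u_ := fun M => \sum_(n < M) alpha n (nrm x) (nrm x) * angular n x x)).
  by apply/nondecreasing_seqP => m; rewrite big_ord_recr lerDl mulr_ge0.
by apply/cvg_ex; exists (K x x); exact: kernel_series.
Qed.

Let F u w := limn (fun M => \sum_(n < M) f n u w).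

Let F_as u : cvg_as P (fun M w => \sum_(n < M) f n u w) (F u).
Proof. exact: (block_sum_cvg_as gG gI blkJ blk_disj f_wrt VG fV f_bounded). Qed.

Let F_L2 u : F u \in Lfun P 2%:E /\ cvgL2 P (fun M w => \sum_(n < M) f n u w) (F u).
Proof. exact: (block_sum_L2 gG gI blkJ blk_disj f_wrt VG fV f_bounded). Qed.

Let hf n u : f n u \in Lfun P 2%:E. Proof. exact: gaussian_space_L2 VG (fV n u). Qed.

Let hS M u : (fun w => \sum_(n < M) f n u w) \in Lfun P 2%:E.
Proof. by apply: L2_sum => n _; exact: hf. Qed.

Let part x M w : C := \sum_(n < M) f_finite Y g n x w.

Let part_Re x M w : complex.Re (part x M w) = \sum_(n < M) f n (x, false) w.
Proof. exact: Re_sum. Qed.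

Let part_Im x M w : complex.Im (part x M w) = \sum_(n < M) f n (x, true) w.
Proof. exact: Im_sum. Qed.

Let series_as x : ccvg_as P (part x) (series_finite Y g x) /\
  {ae P, forall w, series_finite Y g x w = F (x, false) w +i* F (x, true) w}.
Proof.
have H : {ae P, forall w, (fun M => part x M w : C^o) @ \oo -->
    (F (x, false) w +i* F (x, true) w : C^o)}.
  apply: filterS2 (F_as (x, false)) (F_as (x, true)) => w h0 h1; apply/cvg_complexP; split.
    by under eq_fun do rewrite part_Re.
  by under eq_fun do rewrite part_Im.
have E w : (fun M => part x M w : C^o) @ \oo --> (F (x, false) w +i* F (x, true) w : C^o) ->
    series_finite Y g x w = F (x, false) w +i* F (x, true) w by exact: lim_complex.
split; last by apply: filterS H => w; exact: E.
by apply: filterS H => w h; rewrite (E w h).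
Qed.

(** Parts of the complex limit, to be distinguished from the real limits [F], for which the block
    lemmas are available. *)
Let G u := re_im (series_finite Y g) u.

Let G_ae u : {ae P, forall w, G u w = F u w}.
Proof.
by case: u => x b; have [_] := series_as x; apply: filterS => w; rewrite /G /re_im /= => ->; case: b.
Qed.

Let mG u : measurable_fun setT (G u).
Proof.
case: u => x b.
have mr M : measurable_fun setT (fun w => complex.Re (part x M w)).
  by under eq_fun do rewrite part_Re; exact: measurable_L2 (hS M (x, false)).
have mi M : measurable_fun setT (fun w => complex.Im (part x M w)).
  by under eq_fun do rewrite part_Im; exact: measurable_L2 (hS M (x, true)).
have [h1 h2] := measurable_lim_complex mr mi.
by case: b.
Qed.

Let hG u : G u \in Lfun P 2%:E. Proof. exact: ae_L2 (@mG u) (F_L2 u).1 (G_ae u). Qed.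

Let G_cvg u : cvgL2 P (fun M w => \sum_(n < M) f n u w) (G u).
Proof. exact: ae_cvgL2 (fun M => hS M u) (hG u) (F_L2 u).1 (G_ae u) (F_L2 u).2. Qed.

Let V0 : V (fun=> 0). Proof. exact: gaussian_space0 VG (fV 0 (0, false)). Qed.

Let VcG : gaussian_space P (L2_closure P V). Proof. exact: gaussian_space_closure. Qed.

Let GV u : L2_closure P V (G u).
Proof.
split => //; exists (fun M w => \sum_(n < M) f n u w); split; last exact: G_cvg.
move=> M.
have := @gaussian_space_sum _ _ _ P V _ (index_enum 'I_M) (fun=> 1) (fun n => f n u) VG V0.
by under eq_fun do under eq_bigr do rewrite mul1r; apply => i; exact: fV.
Qed.

Let G0 u : \int[P]_w G u w = 0. Proof. exact: gaussian_space_mean VcG (GV u). Qed.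

Let G_ip u v : (fun M => \sum_(n < M) alpha n (nrm u.1) (nrm v.1) *
  \sum_(k < N n) coef k u * coef k v) @ \oo --> ip P (G u) (G v).
Proof.
have := cvgL2_ip (fun M => hS M u) (hG u) (@G_cvg u) (fun M => hS M v) (hG v) (@G_cvg v).
suff E M : ip P (fun w => \sum_(n < M) f n u w) (fun w => \sum_(n < M) f n v w) =
    \sum_(n < M) alpha n (nrm u.1) (nrm v.1) * \sum_(k < N n) coef k u * coef k v.
  by under eq_fun do rewrite E.
rewrite ip_suml //; apply: eq_bigr => m _.
rewrite ip_sumr // (bigD1 m) //= big1 ?addr0 => [|n nm]; first exact: f_ip.
by apply: (block_ip0 gG gI blkJ blk_disj f_wrt VG fV); rewrite eq_sym.
Qed.

Let series_L2 x : ccvg_L2 P (part x) (series_finite Y g x).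
Proof.
split=> [M||].
- by split; [under eq_fun do rewrite part_Re|under eq_fun do rewrite part_Im]; exact: hS.
- by split; [exact: (hG (x, false))|exact: (hG (x, true))].
pose dr M w := \sum_(n < M) f n (x, false) w - G (x, false) w.
pose di M w := \sum_(n < M) f n (x, true) w - G (x, true) w.
have hdr M : dr M \in Lfun P 2%:E by exact: L2B.
have hdi M : di M \in Lfun P 2%:E by exact: L2B.
(* The modulus of the error is treated as a real L2 variable converging to 0; its square is the sum
   of the squared errors of the two parts. *)
pose h M w := Normc.normc (part x M w - series_finite Y g x w).
have hE M w : h M w = Num.sqrt (dr M w ^+ 2 + di M w ^+ 2).
  rewrite /h /dr /di -part_Re -part_Im /G /re_im /= -ReB -ImB.
  by case: (_ - _).
have h2 M w : h M w ^+ 2 = dr M w ^+ 2 + di M w ^+ 2.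
  by rewrite hE sqr_sqrtr // addr_ge0 // sqr_ge0.
have mh M : measurable_fun setT (h M).
  have -> : h M = fun w => Num.sqrt (dr M w ^+ 2 + di M w ^+ 2) by apply/funext => w; exact: hE.
  apply: (@measurableT_comp _ _ _ _ _ _ (Num.sqrt : R -> R)).
    by apply: continuous_measurable_fun; exact: sqrt_continuous.
  by apply: measurable_funD; apply: measurable_funX; exact: (measurable_L2 (P := P)).
have iE M : (\int[P]_w (h M w ^+ 2)%:E = (ip P (dr M) (dr M) + ip P (di M) (di M))%:E)%E.
  rewrite EFinD !ipE // -ge0_integralD //.
  - by apply: eq_integral => w _; rewrite h2.
  - by move=> w _; rewrite lee_fin sqr_ge0.
  - by apply/measurable_EFinP; apply: measurable_funX; exact: measurable_L2 (hdr M).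
  - by move=> w _; rewrite lee_fin sqr_ge0.
  - by apply/measurable_EFinP; apply: measurable_funX; exact: measurable_L2 (hdi M).
have hh M : h M \in Lfun P 2%:E by apply/Lfun2P; split => //; rewrite iE ltry.
have h0 : cvgL2 P h (fun=> 0).
  have H : (fun M => ip P (dr M) (dr M) + ip P (di M) (di M)) @ \oo --> (0 : R).
    by rewrite -[X in _ --> X]addr0; apply: cvgD; [exact: (@G_cvg (x, false))|exact: (@G_cvg (x, true))].
  rewrite /cvgL2; have E M : ip P (fun w => h M w - 0) (fun w => h M w - 0) =
      ip P (dr M) (dr M) + ip P (di M) (di M).
    apply: EFin_inj; rewrite -iE -ipE //.
    by congr ((ip P _ _)%:E); apply/funext => w; rewrite subr0.
  by under eq_fun do rewrite E.
have [_ _] := (cvg_L2P P h (fun=> 0)).2 (And3 hh (L2_0 P) h0).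
by under eq_fun do under eq_fun do rewrite subr0.
Qed.

Let cexp0 x : cexpectation P (series_finite Y g x) = 0.
Proof.
rewrite /cexpectation.
have -> : ('E_P[fun w => complex.Re (series_finite Y g x w)] = 0)%E.
  by apply: expectation_eq0; [exact: (hG (x, false))|exact: (G0 (x, false))].
have -> : ('E_P[fun w => complex.Im (series_finite Y g x w)] = 0)%E.
  by apply: expectation_eq0; [exact: (hG (x, true))|exact: (G0 (x, true))].
by [].
Qed.

Let ccov x y : ccovariance P (series_finite Y g x) (series_finite Y g y) = (K x y)%:C.
Proof.
rewrite /ccovariance !cexp0 /cexpectation.
have int u v : P.-integrable setT (EFin \o (fun w => G u w * G v w)).
  exact: L2M_integrable.
have ReE : (fun w => complex.Re ((series_finite Y g x w - 0) * (series_finite Y g y w - 0)^*)) =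
    (fun w => G (x, false) w * G (y, false) w + G (x, true) w * G (y, true) w).
  apply/funext => w; rewrite !subr0 /G /re_im /=.
  by case: (series_finite _ _ x w) => a b; case: (series_finite _ _ y w) => a' b' /=; rewrite mulrN opprK.
have ImE : (fun w => complex.Im ((series_finite Y g x w - 0) * (series_finite Y g y w - 0)^*)) =
    (fun w => G (x, true) w * G (y, false) w - G (x, false) w * G (y, true) w).
  apply/funext => w; rewrite !subr0 /G /re_im /=.
  by case: (series_finite _ _ x w) => a b; case: (series_finite _ _ y w) => a' b' /=; rewrite mulrN addrC.
rewrite ReE ImE; congr (_ +i* _).
  transitivity (ip P (G (x, false)) (G (y, false)) + ip P (G (x, true)) (G (y, true))).
    by rewrite unlock /ip -RintegralD.
  have C1 : (fun M => \sum_(n < M) alpha n (nrm x) (nrm y) * angular n x y) @ \oo -->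
      ip P (G (x, false)) (G (y, false)) + ip P (G (x, true)) (G (y, true)).
    rewrite (_ : (fun M => _) = (fun M =>
      \sum_(n < M) alpha n (nrm x) (nrm y) * \sum_(k < N n) coef k (x, false) * coef k (y, false) +
      \sum_(n < M) alpha n (nrm x) (nrm y) * \sum_(k < N n) coef k (x, true) * coef k (y, true))).
      by apply: cvgD; [exact: (@G_ip (x, false) (y, false))|exact: (@G_ip (x, true) (y, true))].
    apply/funext => M; rewrite -big_split; apply: eq_bigr => n _ /=.
    by rewrite -mulrDr coef_re.
  exact: (cvg_unique (@Rhausdorff R) C1 (@kernel_series x y)).
transitivity (ip P (G (x, true)) (G (y, false)) - ip P (G (x, false)) (G (y, true))).
  by rewrite unlock /ip -RintegralB.
(* The imaginary part of the covariance is a difference of two mixed inner products, limits of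
   sequences that coincide by [coef_im]. *)
apply/eqP; rewrite subr_eq0; apply/eqP.
pose A b c M := \sum_(n < M) alpha n (nrm x) (nrm y) * \sum_(k < N n) coef k (x, b) * coef k (y, c).
have C1 : A true false @ \oo --> ip P (G (x, true)) (G (y, false)) := @G_ip (x, true) (y, false).
have C2 : A false true @ \oo --> ip P (G (x, false)) (G (y, true)) := @G_ip (x, false) (y, true).
have AE : A true false = A false true.
  by apply/funext => M; apply: eq_bigr => n _; rewrite coef_im.
by rewrite AE in C1; exact: (cvg_unique (@Rhausdorff R) C1 C2).
Qed.

Lemma finite_dimensional_representation :
  [/\ forall n, gaussian_function P setT (re_im (f_finite Y g n)),
      independent_functions P setT setT (fun n => re_im (f_finite Y g n)),
      forall x : 'rV[R]_d,
        let part M w := \sum_(n < M) f_finite Y g n x w in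
        ccvg_L2 P part (series_finite Y g x) /\ ccvg_as P part (series_finite Y g x)
    & ccentered_gaussian P (series_finite Y g) (fun x y => (K x y)%:C)].
Proof.
split.
- by move=> n; apply: (gaussian_space_function VG V0) => u _; exact: (fV n u).
- exact: (blocks_independent gG gI blkJ blk_disj f_wrt).
- by move=> x; split; [exact: series_L2|exact: (series_as x).1].
split.
- by apply: (gaussian_space_function VcG (gaussian_space0 VcG (GV (0, false)))) => u _; exact: GV.
- exact: cexp0.
- exact: ccov.
Qed.

End FiniteDimensional.

(** * The representation in both cases *)

Unset Implicit Arguments.

Theorem theorem5p1 (R : realType) (disp : measure_display)
    (Omega : measurableType disp) (P : probability Omega R) :
  (* d infinite *)
  (forall (Ch : nat -> R -> R) (K : l2 R -> l2 R -> R) (alpha : nat -> R -> R -> R)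
      (g : forall n, n.-tuple nat -> R -> Omega -> R),
    normalized_gegenbauer +oo%E Ch ->
    isotropic_kernel (@l2_dot R) K ->
    associated_kernels (@l2_dot R) Ch K alpha ->
    (forall n (i : n.-tuple nat),
      centered_gaussian P (@nonneg_half_line R) (g n i) (alpha n)) ->
    independent_functions P (@nonneg_half_line R) setT
      (fun i : {n : nat & n.-tuple nat} => g (tag i) (tagged i)) ->
    [/\ forall n (x : l2 R) (A : nat -> {fset n.-tuple nat}), exhaustion A ->
          let part M w := \sum_(i <- A M) term_infty g x i w in
          cvg_L2 P part (f_infty g n x) /\ cvg_as P part (f_infty g n x),
        forall n, gaussian_function P setT (f_infty g n),
        independent_functions P setT setT (f_infty g),
        forall x : l2 R,
          let part M w := \sum_(n < M) f_infty g n x w in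
          cvg_L2 P part (series_infty g x) /\ cvg_as P part (series_infty g x)
      & centered_gaussian P setT (series_infty g) K]) /\
  (* d finite *)
  (forall (d : nat) (Ch : nat -> R -> R) (K : 'rV[R]_d -> 'rV[R]_d -> R)
      (alpha : nat -> R -> R -> R) (N : nat -> nat)
      (Y : forall n, 'I_(N n) -> 'rV[R]_d -> R[i])
      (g : nat -> nat -> R -> Omega -> R),
    (2 <= d)%N ->
    normalized_gegenbauer ((d%:R - 2) / 2)%:E Ch ->
    isotropic_kernel (@rv_dot R d) K ->
    associated_kernels (@rv_dot R d) Ch K alpha ->
    (forall n, orthonormal_basis_harmonics n (Y n)) ->
    (forall n k, (k < N n)%N ->
      centered_gaussian P (@nonneg_half_line R) (g n k) (alpha n)) ->
    independent_functions P (@nonneg_half_line R)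
      [set nk : nat * nat | (nk.2 < N nk.1)%N] (fun nk => g nk.1 nk.2) ->
    [/\ forall n, gaussian_function P setT (re_im (f_finite Y g n)),
        independent_functions P setT setT (fun n => re_im (f_finite Y g n)),
        forall x : 'rV[R]_d,
          let part M w := \sum_(n < M) f_finite Y g n x w in
          ccvg_L2 P part (series_finite Y g x) /\ ccvg_as P part (series_finite Y g x)
      & ccentered_gaussian P (series_finite Y g) (fun x y => (K x y)%:C)]).
Proof.
split.
  move=> Ch K alpha g ChE _ HK gG gI.
  exact: (infinite_dimensional_representation ChE HK gG gI).
move=> d Ch K alpha N Y g d2 HCh _ HK HY gG gI.
exact: (finite_dimensional_representation d2 HCh HK HY gG gI).
Qed.
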